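(* Let $(E,\nabla)$ be a pair of a vector bundle $E$ of rank $r$ on a (smooth projective, complex) curve $C$ and a connection $\nabla:E\to E\otimes\Omega^1_C(D)$ with poles along a divisor $D$ whose multiplicity at $x$ is $m\geq 2$. Take a generator $z$ of the maximal ideal of $\mathcal O_{C,x}$ and a variable $w$ with $w^r=z$. Let $\nu(w)=\nu_0(z)+\nu_1(z)w+\cdots+\nu_{r-1}(z)w^{r-1}$ with $\nu_0(z)\in\sum_{i=0}^{m-1}\mathbb Cz^{i-m}dz$, $\nu_k(z)\in\sum_{i=0}^{m-2}\mathbb Cz^{i-m}dz$ for $1\le k\le r-1$, and nonzero leading term of $\nu_1(z)$ (i.e. nonzero coefficient of $z^{-m}dz$). Then the following conditions are equivalent. (1) $(E,\nabla)$ is generic $\nu$-ramified at $x$, that is, $(\widehat E,\widehat\nabla)\cong(\mathbb C[[w]],\nabla_\nu)$. (2) There is a generic $\nu$-ramified structure on $(E,\nabla)$ at $x$. (3) There is a factorized $\nu$-ramified structure on $(E,\nabla)$ at $x$.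
   Context: $(\widehat E,\widehat\nabla)=(E,\nabla)\otimes\widehat{\mathcal O}_{C,x}$ is the formal completion at $x$, and $\nabla_\nu:\mathbb C[[w]]\to\mathbb C[[w]]\otimes\frac{dz}{z^m}$ is $\nabla_\nu(f)=df+f\nu(w)$, with $\mathbb C[[w]]$ viewed as a free $\mathbb C[[z]]$-module of rank $r$ ($z=w^r$). $\nabla|_{mx}:E|_{mx}\to E\otimes\Omega^1_C(D)|_{mx}$ is the $\mathcal O_{mx}$-linear map induced by $\nabla$. $R=\mathbb C[w]/(w^{mr-r+1})$ is an algebra over $\mathcal O_{mx}=\mathbb C[z]/(z^m)$ via $z=w^r$. Symbols $(w^a)/(w^b)$ denote subquotients of $\mathbb C[w]$ by ideals, $(z)=(w^r)$. **Generic $\nu$-ramified structure on $(E,\nabla)$ at $x$**: a tuple $((V_k,L_k,\pi_k)_{0\le k\le r-1},(\phi_k)_{1\le k\le r})$ such that (i) $E|_{mx}=V_0\supset V_1\supset\cdots\supset V_{r-1}\supset V_r=zV_0$ is a filtration by $\mathcal O_{mx}$-submodules with $\mathrm{length}(V_k/V_{k+1})=1$ and $\nabla|_{mx}(V_k)\subset V_k\otimes\Omega^1_C(D)|_{mx}$; (ii) $\pi_k:V_k\otimes_{\mathcal O_{mx}}R\to L_k$ is a quotient free $R$-module of rank one, $\pi_k|_{V_k}:V_k\to L_k$ is surjective, and $(\pi_k\otimes1)\circ(\nabla|_{mx}\otimes\mathrm{id}_R)=(\nu(w)+\frac kr\frac{dz}z)\circ\pi_k$; (iii) $\phi_k:L_k\to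 wL_{k-1}$ ($1\le k\le r-1$) and $\phi_r:(z)/(w^{mr+1})\otimes_{\mathbb C[w]}L_0\to wL_{r-1}$ are surjective $\mathbb C[w]$-homomorphisms such that $\phi_k\circ\pi_k$ equals $\pi_{k-1}$ composed with $V_k\otimes R\to V_{k-1}\otimes R$, and $\phi_r\circ(1\otimes\pi_0)$ equals $\pi_{r-1}$ composed with the map $(z)/(z^{m+1})\otimes V_0\otimes R\to V_{r-1}\otimes R$ induced by $zV_0\subset V_{r-1}$; (iv) there are $\mathbb C[w]$-isomorphisms $\psi_k:L_k\to(w)/(w^{mr-r+2})\otimes L_{k-1}$ ($1\le k\le r-1$) whose composites with $(w)/(w^{mr-r+2})\otimes L_{k-1}\to wL_{k-1}$ are $\phi_k$, and such that $(z)/(w^{mr+1})\otimes L_0\xrightarrow{\phi_r}L_{r-1}\xrightarrow{\psi_{r-1}}\cdots\xrightarrow{\psi_1}(w^{r-1})/(w^{mr})\otimes L_0$ is obtained by tensoring $L_0$ with the canonical map $(z)/(w^{mr+1})\to(w^{r-1})/(w^{mr})$. **Factorized $\nu$-ramified structure on $(E,\nabla)$ at $x$**: a tuple $(V_k,\vartheta_k,\varkappa_k)_{0\le k\le r-1}$ such that (i) the $V_k$ satisfy condition (i) above. Put $\overline V_k=V_k/z^{m-1}V_{k+1}$ and $\overline W_k=\mathrm{Hom}_{\mathcal O_{mx}}(\overline V_{r-k-1},\mathcal O_{mx})$. There are canonical maps $\overline V_k\to\overline V_{k-1}$ (induced by inclusion) and $(z)/(z^{m+1})\otimes\overline V_0\to\overline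 V_{r-1}$ (induced by $zV_0\subset V_{r-1}$), and dually $\overline W_k\to\overline W_{k-1}$ (dual of $\overline V_{r-k}\to\overline V_{r-k-1}$) and $(z)/(z^{m+1})\otimes\overline W_0\to\overline W_{r-1}$ (obtained by tensoring with $(z)/(z^{m+1})$ the dual of $(z)/(z^{m+1})\otimes\overline V_0\to\overline V_{r-1}$); (ii) $\vartheta_k:\overline W_k\times\overline W_{r-k-1}\to\mathcal O_{mx}$ are $\mathcal O_{mx}$-bilinear with $\vartheta_k(v,v')=\vartheta_{r-k-1}(v',v)$, and the induced $\theta_k:\overline W_k\to\mathrm{Hom}(\overline W_{r-k-1},\mathcal O_{mx})=\overline V_k$ are isomorphisms commuting with the canonical maps (with $1\otimes\theta_0$ on $(z)/(z^{m+1})\otimes\overline W_0$); (iii) $\varkappa_k:\overline V_k\times\overline V_{r-k-1}\to\mathcal O_{mx}$ are $\mathcal O_{mx}$-bilinear with $\varkappa_k(v,v')=\varkappa_{r-k-1}(v',v)$, and the induced $\kappa_k:\overline V_k\to\overline W_k$ commute with the canonical maps; (iv) $N_k:=\theta_k\circ\kappa_k$ satisfies $N_k^r=z\,\mathrm{id}$ and $N_k^{mr-r+1}=0$, the induced ring homomorphism $R\to\mathrm{End}_{\mathcal O_{mx}}(\overline V_k)$, $f(w)\mapsto f(N_k)$, is injective, and $V_k\to\overline V_k$ intertwines $\nabla|_{mx}$ with $\nu(N_k)+\frac kr\frac{dz}z$; (v) for the $\mathbb C[w]$-module structure on $\overline V_k$ given by $N_k$, there are $\mathbb C[w]$-isomorphisms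 $\psi_k:\overline V_k\to(w)/(w^{mr-r+2})\otimes\overline V_{k-1}$ ($1\le k\le r-1$) whose composites with $(w)/(w^{mr-r+2})\otimes\overline V_{k-1}\to w\overline V_{k-1}\subset\overline V_{k-1}$ are the canonical maps, and such that $(z)/(z^{m+1})\otimes\overline V_0\to\overline V_{r-1}\xrightarrow{\psi_{r-1}}\cdots\xrightarrow{\psi_1}(w^{r-1})/(w^{mr})\otimes\overline V_0$ is obtained from the canonical map $(z)/(z^{m+1})\to(w^{r-1})/(w^{mr})$. *)

(* Defs.v *)
From HB Require Import structures.
From mathcomp Require Import all_boot all_order all_algebra.
From mathcomp Require Import boolp classical_sets functions cardinality.
From mathcomp Require Import reals.
From mathcomp Require Import complex.

Set Implicit Arguments.
Unset Strict Implicit.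
Unset Printing Implicit Defensive.

Import GRing.Theory.
Local Open Scope ring_scope.
Local Open Scope quotient_scope.

Definition restr (A B : nzRingType) (f : {rmorphism A -> B}) (M : lmodType B)
  : Type := M.

Section Restr.
Variables (A B : nzRingType) (f : {rmorphism A -> B}) (M : lmodType B).
HB.instance Definition _ := GRing.Zmodule.on (restr f M).
Let scale (a : A) (v : restr f M) : restr f M := f a *: (v : M).
Let scaleA a b v : scale a (scale b v) = scale (a * b) v.
Proof. by rewrite /scale rmorphM /= scalerA. Qed.
Let scale1 : left_id 1 scale.
Proof. by move=> v; rewrite /scale rmorph1 scale1r. Qed.
Let scaleDr : right_distributive scale +%R.
Proof. by move=> a u v; rewrite /scale scalerDr. Qed.
Let scaleDl v : {morph scale^~ v : a b / a + b}.
Proof. by move=> a b; rewrite /scale rmorphD /= scalerDl. Qed.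
HB.instance Definition _ := GRing.Zmodule_isLmodule.Build A (restr f M)
  scaleA scale1 scaleDr scaleDl.
End Restr.

Record submod (A : nzRingType) (M : lmodType A) := Submod {
  smem :> {pred M};
  smem_closed : submod_closed smem
}.

HB.instance Definition _ (A : nzRingType) (M : lmodType A) (S : submod M) :=
  GRing.isSubmodClosed.Build A M (smem S) (smem_closed S).

Definition sub (A : nzRingType) (M : lmodType A) (S : submod M) : Type :=
  {v : M | v \in smem S}.

Section Sub.
Variables (A : nzRingType) (M : lmodType A) (S : submod M).
HB.instance Definition _ := SubChoice.on (sub S).
HB.instance Definition _ := [SubChoice_isSubLmodule of sub S by <:].
End Sub.

Definition quot_rel (A : nzRingType) (M : lmodType A) (S : submod M) : rel M :=
  fun u v => u - v \in smem S.

Section Quot.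
Variables (A : nzRingType) (M : lmodType A) (S : submod M).
Lemma quot_rel_refl : reflexive (quot_rel S).
Proof. by move=> u; rewrite /quot_rel subrr rpred0. Qed.
Lemma quot_rel_sym : symmetric (quot_rel S).
Proof. by move=> u v; rewrite /quot_rel -rpredN opprB. Qed.
Lemma quot_rel_trans : transitive (quot_rel S).
Proof.
by move=> v u w uv vw; rewrite /quot_rel -(subrK v u) -addrA rpredD.
Qed.
Canonical quot_equiv := EquivRel (quot_rel S) quot_rel_refl quot_rel_sym
  quot_rel_trans.
End Quot.

Definition quot (A : nzRingType) (M : lmodType A) (S : submod M) : Type :=
  {eq_quot (quot_rel S)}.

Section QuotLmod.
Variables (A : nzRingType) (M : lmodType A) (S : submod M).
HB.instance Definition _ := Choice.on (quot S).
HB.instance Definition _ := EqQuotient.on (quot S).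
Local Notation Q := (quot S).
Let piE (u v : M) : (\pi_Q u = \pi_Q v) <-> (u - v \in smem S).
Proof. by split=> [/eqmodP|h]; [|apply/eqmodP]. Qed.
Let QW (P : Q -> Prop) : (forall u, P (\pi_Q u)) -> forall x, P x.
Proof. by move=> h x; rewrite -[x]reprK. Qed.
Let zero : Q := \pi_Q 0.
Let add (x y : Q) : Q := \pi_Q (repr x + repr y).
Let opp (x : Q) : Q := \pi_Q (- repr x).
Let scale (a : A) (x : Q) : Q := \pi_Q (a *: repr x).
Let reprP (u : M) : repr (\pi_Q u) - u \in smem S.
Proof. by apply/piE; rewrite reprK. Qed.
Let addE u v : add (\pi_Q u) (\pi_Q v) = \pi_Q (u + v).
Proof. by apply/piE; rewrite opprD addrACA rpredD ?reprP. Qed.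
Let oppE u : opp (\pi_Q u) = \pi_Q (- u).
Proof. by apply/piE; rewrite -opprD rpredN reprP. Qed.
Let scaleE a u : scale a (\pi_Q u) = \pi_Q (a *: u).
Proof. by apply/piE; rewrite -scalerBr rpredZ ?reprP. Qed.
Let addA : associative add.
Proof.
move=> x y z; elim/QW: x => u; elim/QW: y => v; elim/QW: z => w.
by rewrite !addE addrA.
Qed.
Let addC : commutative add.
Proof. by move=> x y; elim/QW: x => u; elim/QW: y => v; rewrite !addE addrC. Qed.
Let add0 : left_id zero add.
Proof. by elim/QW => u; rewrite addE add0r. Qed.
Let addN : left_inverse zero opp add.
Proof. by elim/QW => u; rewrite oppE addE addNr. Qed.
HB.instance Definition _ := GRing.isZmodule.Build Q addA addC add0 addN.
Let addpE u v : \pi_Q u + \pi_Q v = \pi_Q (u + v). Proof. exact: addE. Qed.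
Let scaleA a b v : scale a (scale b v) = scale (a * b) v.
Proof. by elim/QW: v => u; rewrite !scaleE scalerA. Qed.
Let scale1 : left_id 1 scale.
Proof. by elim/QW => u; rewrite scaleE scale1r. Qed.
Let scaleDr : right_distributive scale +%R.
Proof.
by move=> a x y; elim/QW: x => u; elim/QW: y => v; rewrite !(addpE, scaleE) scalerDr.
Qed.
Let scaleDl v : {morph scale^~ v : a b / a + b}.
Proof.
by move=> a b; elim/QW: v => u; rewrite !scaleE addpE scalerDl.
Qed.
HB.instance Definition _ := GRing.Zmodule_isLmodule.Build A Q
  scaleA scale1 scaleDr scaleDl.
End QuotLmod.

(* [presented P] is the B-module with generators X that is universal for a   *)
(* property P of maps from X to B-modules (P is meant to be preserved by     *)
(* composition with linear maps and detected by families of linear maps):    *)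
(* formal B-linear combinations of elements of X, two of them being equal    *)
(* when they have the same value under every map satisfying P.               *)
Section Presented.
Variables (B : comNzRingType) (X : choiceType).
Variable P : forall M : lmodType B, (X -> M) -> Prop.

Definition combination (M : lmodType B) (f : X -> M) (s : seq (B * X)) : M :=
  \sum_(x <- s) x.1 *: f x.2.

Definition presented_rel : rel (seq (B * X)) := fun s t =>
  `[< forall (M : lmodType B) (f : X -> M),
        P f -> combination f s = combination f t >].

Lemma presented_rel_refl : reflexive presented_rel.
Proof. by move=> s; apply/asboolP. Qed.
Lemma presented_rel_sym : symmetric presented_rel.
Proof.
by move=> s t; apply/asboolP/asboolP => h M f Pf; rewrite h.
Qed.
Lemma presented_rel_trans : transitive presented_rel.
Proof.
move=> t s u /asboolP st /asboolP tu.
by apply/asboolP => M f Pf; rewrite st // tu.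
Qed.
Canonical presented_equiv := EquivRel presented_rel presented_rel_refl
  presented_rel_sym presented_rel_trans.

Definition presented : Type := {eq_quot presented_rel}.
HB.instance Definition _ := Choice.on presented.
HB.instance Definition _ := EqQuotient.on presented.

Definition generator (x : X) : presented := \pi_presented [:: (1, x)].

Definition presented_lift (M : lmodType B) (f : X -> M) (t : presented) : M :=
  combination f (repr t).

Let scale_seq (b : B) (s : seq (B * X)) := [seq (b * x.1, x.2) | x <- s].
Let comb_cat (M : lmodType B) (f : X -> M) s t :
  combination f (s ++ t) = combination f s + combination f t.
Proof. exact: big_cat. Qed.
Let comb_scale (M : lmodType B) (f : X -> M) b s :
  combination f (scale_seq b s) = b *: combination f s.
Proof.
rewrite /combination big_map scaler_sumr.
by apply: eq_bigr => x _; rewrite scalerA.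
Qed.
Let piE (s t : seq (B * X)) : (\pi_presented s = \pi_presented t) <->
  (forall (M : lmodType B) (f : X -> M),
     P f -> combination f s = combination f t).
Proof. by split=> [/eqmodP/asboolP|h]; [|apply/eqmodP/asboolP]. Qed.
Let combP (M : lmodType B) (f : X -> M) s : P f ->
  combination f (repr (\pi_presented s)) = combination f s.
Proof. by move=> Pf; apply: (iffLR (piE _ _)) => //; rewrite reprK. Qed.
Let QW (R : presented -> Prop) : (forall s, R (\pi_presented s)) -> forall x, R x.
Proof. by move=> h x; rewrite -[x]reprK. Qed.
Let zero : presented := \pi_presented [::].
Let add (x y : presented) : presented := \pi_presented (repr x ++ repr y).
Let scale (b : B) (x : presented) : presented := \pi_presented (scale_seq b (repr x)).
Let opp (x : presented) : presented := scale (-1) x.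
Let addE s t : add (\pi_presented s) (\pi_presented t) = \pi_presented (s ++ t).
Proof. by apply/piE => M f Pf; rewrite !comb_cat !combP. Qed.
Let scaleE b s : scale b (\pi_presented s) = \pi_presented (scale_seq b s).
Proof. by apply/piE => M f Pf; rewrite !comb_scale !combP. Qed.
Let addA : associative add.
Proof.
move=> x y z; elim/QW: x => u; elim/QW: y => v; elim/QW: z => w.
by rewrite !addE catA.
Qed.
Let addC : commutative add.
Proof.
move=> x y; elim/QW: x => u; elim/QW: y => v; rewrite !addE.
by apply/piE => M f Pf; rewrite !comb_cat addrC.
Qed.
Let add0 : left_id zero add.
Proof. by elim/QW => u; rewrite addE. Qed.
Let addN : left_inverse zero opp add.
Proof.
elim/QW => u; rewrite /opp scaleE addE; apply/piE => M f Pf.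
by rewrite comb_cat comb_scale scaleN1r addNr /combination big_nil.
Qed.
HB.instance Definition _ := GRing.isZmodule.Build presented
  addA addC add0 addN.
Let addpE s t : \pi_presented s + \pi_presented t = \pi_presented (s ++ t).
Proof. exact: addE. Qed.
Let scaleA a b v : scale a (scale b v) = scale (a * b) v.
Proof.
elim/QW: v => u; rewrite !scaleE; apply/piE => M f Pf.
by rewrite !comb_scale scalerA.
Qed.
Let scale1 : left_id 1 scale.
Proof.
by elim/QW => u; rewrite scaleE; apply/piE => M f Pf; rewrite comb_scale scale1r.
Qed.
Let scaleDr : right_distributive scale +%R.
Proof.
move=> a; move=> x y; elim/QW: x => u; elim/QW: y => v; rewrite !(addpE, scaleE).
by apply/piE => M f Pf; rewrite !(comb_scale, comb_cat) scalerDr.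
Qed.
Let scaleDl v : {morph scale^~ v : a b / a + b}.
Proof.
move=> a b; elim/QW: v => u; rewrite !scaleE addpE.
by apply/piE => M f Pf; rewrite !(comb_scale, comb_cat) scalerDl.
Qed.
HB.instance Definition _ := GRing.Zmodule_isLmodule.Build B presented
  scaleA scale1 scaleDr scaleDl.
End Presented.

(* Tensor product over A of an A-module M and a B-module N, where B is an    *)
(* A-algebra through f; the result is a B-module through the factor N.       *)
Section Tensor.
Variables (A B : comNzRingType) (f : {rmorphism A -> B}).
Variables (M : lmodType A) (N : lmodType B).

Definition is_bilinear (Q : lmodType B) (g : M * N -> Q) : Prop :=
  [/\ forall u v n, g (u + v, n) = g (u, n) + g (v, n),
      forall u n p, g (u, n + p) = g (u, n) + g (u, p),
      forall a u n, g (a *: u, n) = g (u, f a *: n)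
    & forall b u n, g (u, b *: n) = b *: g (u, n)].

Definition tensor : Type := presented is_bilinear.
HB.instance Definition _ := GRing.Lmodule.on tensor.

Definition tens (u : M) (n : N) : tensor := generator is_bilinear (u, n).

(* Only meaningful for g bilinear. *)
Definition tens_lift (Q : lmodType B) (g : M -> N -> Q) : tensor -> Q :=
  presented_lift (fun x => g x.1 x.2).
End Tensor.

Section ScaledSubmodule.
Variables (A : comNzRingType) (M : lmodType A).

Definition full_pred : {pred M} := predT.
Lemma full_closed : submod_closed full_pred. Proof. by []. Qed.
Definition full := Submod full_closed.

Variables (a : A) (S : submod M).
Definition scaled_pred : {pred M} :=
  fun v => `[< exists2 u, u \in smem S & v = a *: u >].
Lemma scaled_closed : submod_closed scaled_pred.
Proof.
split=> [|b u v /asboolP[u' Su ->] /asboolP[v' Sv ->]]; apply/asboolP.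
  by exists 0; rewrite ?rpred0 ?scaler0.
exists (b *: u' + v'); first by rewrite rpredD ?rpredZ.
by rewrite scalerDr !scalerA mulrC.
Qed.
Definition scaled := Submod scaled_closed.
End ScaledSubmodule.
Arguments full {A M}.
Arguments full_pred {A M}.

(* T seen inside the module S (meant for T contained in S). *)
Section SubIn.
Variables (A : nzRingType) (M : lmodType A) (S T : submod M).
Definition subin_pred : {pred sub S} := fun v => val v \in smem T.
Lemma subin_closed : submod_closed subin_pred.
Proof.
split=> [|a u v uT vT]; rewrite unfold_in /subin_pred ?raddf0 ?rpred0 //.
have -> : val (a *: u + v) = a *: val u + val v by [].
by rewrite rpredD ?rpredZ.
Qed.
Definition subin : submod (sub S) := Submod subin_closed.
End SubIn.

(* v as an element of the submodule S. The default value 0 is irrelevant:    *)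
(* this is only applied to elements v of S.                                  *)
Definition insub0 (A : nzRingType) (M : lmodType A) (S : submod M) (v : M)
  : sub S := insubd (0 : sub S) v.

Definition qclass (A : nzRingType) (M : lmodType A) (S : submod M) (v : M)
  : quot S := \pi_(quot S) v.

(* A module of length one is a simple module. *)
Definition length_one (A : nzRingType) (M : lmodType A) : Prop :=
  (exists v : M, v != 0) /\
  forall S : submod M, (forall v, v \in smem S -> v = 0) \/ smem S =1 predT.

Definition is_basis (A : nzRingType) (M : lmodType A) (n : nat) (b : 'I_n -> M)
  : Prop :=
  forall v : M, exists! c : {ffun 'I_n -> A}, v = \sum_i c i *: b i.

Section Hom.
Variables (A : comNzRingType) (M N : lmodType A).
Definition hom_pred : {pred M -> N} := fun f => `[< linear f >].
Lemma hom_closed : submod_closed hom_pred.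
Proof.
split=> [|a f g /asboolP lf /asboolP lg]; apply/asboolP => b u v.
  by rewrite -[LHS]/(0 : N) -[RHS]/(b *: (0 : N) + 0) scaler0 addr0.
rewrite -[LHS]/(a *: f (b *: u + v) + g (b *: u + v)).
rewrite -[RHS]/(b *: (a *: f u + g u) + (a *: f v + g v)).
by rewrite lf lg !scalerDr !scalerA (mulrC a) addrACA.
Qed.
Definition hom_submod := Submod hom_closed.
Definition hom : Type := sub hom_submod.
HB.instance Definition _ := GRing.Lmodule.on hom.
Definition hom_fun (f : hom) : M -> N := val f.
(* Only meaningful for f linear. *)
Definition to_hom (f : M -> N) : hom := insub0 hom_submod f.
End Hom.

Section PolynomialModules.
Variable k : fieldType.
Local Notation P := {poly k}.

(* The module over k[w] whose underlying k-vector space is that of M (on     *)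
(* which k acts through constant polynomials) and on which w acts as N.      *)
Definition endmod (M : lmodType P) (N : {linear M -> M}) : Type := M.

Section Endmod.
Variables (M : lmodType P) (N : {linear M -> M}).
HB.instance Definition _ := GRing.Zmodule.on (endmod N).
Let act (p : P) (v : endmod N) : endmod N :=
  \sum_(i < size p) (p`_i)%:P *: iter i N v.
Let actE n (p : P) v : (size p <= n)%N ->
  act p v = \sum_(i < n) (p`_i)%:P *: iter i N v.
Proof.
move=> le_pn; rewrite /act (big_ord_widen n (fun i => (p`_i)%:P *: iter i N v)) //.
rewrite big_mkcond /=; apply: eq_bigr => i _.
by case: ltnP => // /(nth_default 0) ->; rewrite scale0r.
Qed.
Let act1 : left_id 1 act.
Proof.
move=> v; rewrite (@actE 1) ?size_poly1 // big_ord1 /= coef1 scale1r //.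
Qed.
Let actDr : right_distributive act +%R.
Proof.
move=> p u v; rewrite /act -big_split; apply: eq_bigr => i _ /=.
by rewrite -scalerDr; congr (_ *: _); elim: (i : nat) => //= n ->; rewrite linearD.
Qed.
Let actDl v : {morph act^~ v : a b / a + b}.
Proof.
move=> a b /=; pose n := maxn (size a) (size b).
rewrite !(@actE n) ?leq_maxl ?leq_maxr ?size_polyD //.
rewrite -big_split; apply: eq_bigr => i _.
by rewrite /= coefD polyCD scalerDl.
Qed.
Let act_polyC c v : act c%:P v = c%:P *: (v : M).
Proof. by rewrite (@actE 1) ?size_polyC_leq1 // big_ord1 coefC. Qed.
Let actMX p v : act (p * 'X) v = act p (N v).
Proof.
rewrite (@actE (size p).+1) ?size_polyMX ?(actE _ (leqnn _)).
  rewrite big_ord_recl /= coefMX eqxx scale0r add0r.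
  by apply: eq_bigr => i _; rewrite coefMX /= -iterSr.
by apply: leq_trans (size_polyMleq _ _) _; rewrite size_polyX addn2.
Qed.
Let actCM c p v : act (c%:P * p) v = c%:P *: act p v.
Proof.
rewrite (@actE (size p)).
  rewrite (actE _ (leqnn (size p))) scaler_sumr; apply: eq_bigr => i _.
  by rewrite coefCM polyCM scalerA.
apply: leq_trans (size_polyMleq _ _) _; rewrite -subn1 leq_subLR leq_add2r.
exact: size_polyC_leq1.
Qed.
Let actN p v : act p (N v) = N (act p v).
Proof.
rewrite /act linear_sum; apply: eq_bigr => i _.
by rewrite linearZ /= -iterSr.
Qed.
Let actA a b v : act a (act b v) = act (a * b) v.
Proof.
elim/poly_ind: a v => [|p c IH] v; first by rewrite mul0r /act size_poly0 !big_ord0.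
rewrite actDl act_polyC actMX -actN IH mulrDl actDl actCM; congr (_ + _).
by rewrite -mulrA -commr_polyX mulrA actMX.
Qed.
HB.instance Definition _ := GRing.Zmodule_isLmodule.Build P (endmod N)
  actA act1 actDr actDl.
End Endmod.

(* The subquotient (w^a)/(w^b) of k[w], as a module over k[w]. *)
Definition Xideal (a : nat) : submod (P^o) := scaled ('X^a : P) full.
Definition Xsub (a b : nat) : submod (sub (Xideal a)) :=
  subin (Xideal a) (Xideal b).
Definition subquo (a b : nat) : Type := quot (Xsub a b).
HB.instance Definition _ a b := GRing.Lmodule.on (subquo a b).

(* The class of a multiple p of w^a, and a multiple of w^a representing x.   *)
Definition subquo_class (a b : nat) (p : P) : subquo a b :=
  qclass (Xsub a b) (insub0 (Xideal a) p).
Definition subquo_repr (a b : nat) (x : subquo a b) : P := val (repr x).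
End PolynomialModules.

(* k[[z]]; a series is the sequence of its coefficients. *)
Definition fps (k : fieldType) : Type := nat -> k.

Section PowerSeries.
Variable k : fieldType.
HB.instance Definition _ := GRing.Zmodule.copy (fps k) (nat -> k).
Implicit Types f g h : fps k.

Let one : fps k := fun n => (n == 0%N)%:R.
Let mul f g : fps k := fun n => \sum_(i < n.+1) f i * g (n - i)%N.
Let trunc N f : {poly k} := \poly_(i < N) f i.
Let mulE N f g n : (n < N)%N -> mul f g n = (trunc N f * trunc N g)`_n.
Proof.
move=> ltnN; rewrite coefM; apply: eq_bigr => i _; rewrite !coef_poly.
have lt1 : (i < N)%N by apply: leq_ltn_trans ltnN; rewrite -ltnS.
have lt2 : (n - i < N)%N by apply: leq_ltn_trans ltnN; rewrite leq_subr.
by rewrite lt1 lt2.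
Qed.
Let mul_truncl N f (q : {poly k}) n : (n < N)%N ->
  (trunc N f * q)`_n = \sum_(i < n.+1) f i * q`_(n - i).
Proof.
move=> ltnN; rewrite coefM; apply: eq_bigr => i _; rewrite coef_poly.
by rewrite (leq_ltn_trans _ ltnN) // -ltnS.
Qed.
Let mulC : commutative mul.
Proof. by move=> f g; apply/funext => n; rewrite !(@mulE n.+1) // mulrC. Qed.
Let mulA : associative mul.
Proof.
have E f g h n :
    mul f (mul g h) n = (trunc n.+1 f * (trunc n.+1 g * trunc n.+1 h))`_n.
  rewrite mul_truncl //; apply: eq_bigr => i _; congr (_ * _).
  by rewrite (@mulE n.+1) // ltnS leq_subr.
move=> f g h; apply/funext => n.
by rewrite E (mulC (mul f g)) E mulrA mulrC.
Qed.
Let mul1 : left_id one mul.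
Proof.
move=> f; apply/funext => n; rewrite /mul big_ord_recl /one eqxx mul1r subn0.
by rewrite big1 ?addr0 // => i _; rewrite mul0r.
Qed.
Let mulDl : left_distributive mul +%R.
Proof.
move=> f g h; apply/funext => n; rewrite -[RHS]/(mul f h n + mul g h n).
by rewrite /mul -big_split; apply: eq_bigr => i _; exact: mulrDl.
Qed.
Let one_neq0 : one != 0.
Proof.
apply/eqP => /(congr1 (fun f : fps k => f 0%N)) /eqP; rewrite /one eqxx.
by rewrite -[X in _ == X]/(0 : k) oner_eq0.
Qed.
HB.instance Definition _ := GRing.Zmodule_isComNzRing.Build (fps k)
  mulA mulC mul1 mulDl one_neq0.

Definition fps_of_poly (p : {poly k}) : fps k := fun n => p`_n.

Definition euler f : fps k := fun n => n%:R * f n.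
Definition fps_deriv f : fps k := fun n => n.+1%:R * f n.+1.

Definition fps_subst (r : nat) f : fps k :=
  fun n => if (r %| n)%N then f (n %/ r)%N else 0.

Section Subst.
Variable r : nat.
Let substB : zmod_morphism (fps_subst r).
Proof.
move=> f g; apply/funext => n.
rewrite -[RHS]/(fps_subst r f n - fps_subst r g n) /fps_subst.
by case: ifP; rewrite // subr0.
Qed.
Let substM : monoid_morphism (fps_subst r).
Proof.
split=> [|f g]; apply/funext => n.
  rewrite /fps_subst -[LHS]/(if (r %| n)%N then one (n %/ r)%N else 0).
  rewrite -[RHS]/(one n) /one.
  case: (posnP r) => [->|r0].
    by rewrite dvd0n divn0; case: n.
  case: ifP => [/dvdnP[j ->]|]; first by rewrite mulnK // muln_eq0 (gtn_eqF r0) orbF.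
  by case: n => //; rewrite dvdn0.
rewrite -[RHS]/(mul (fps_subst r f) (fps_subst r g) n).
rewrite -[LHS]/(if (r %| n)%N then mul f g (n %/ r)%N else 0) /mul.
case: (posnP r) => [r0|r0].
  rewrite r0 dvd0n divn0 /fps_subst; case: n => [|n] /=.
    by rewrite !big_ord1 !subnn dvdnn divn0.
  rewrite big1 // => i _; rewrite !dvd0n !divn0.
  case: eqP => [->|_]; last by rewrite mul0r.
  by rewrite subn0 mulr0.
case: ifPn => [rn|ndvd]; last first.
  rewrite big1 // => i _; rewrite /fps_subst.
  have [ri|] := boolP (r %| i)%N; last by rewrite mul0r.
  by rewrite dvdn_subl ?(negPf ndvd) ?mulr0 // -ltnS.
case/dvdnP: rn => j ->; rewrite mulnK //; symmetry.
rewrite (bigID (fun i : 'I_(j * r).+1 => r %| i)%N) /= [X in _ + X]big1 ?addr0.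
  have lt (i : 'I_j.+1) : (i * r < (j * r).+1)%N.
    by rewrite ltnS leq_mul2r -ltnS ltn_ord orbT.
  rewrite (reindex_onto (fun i : 'I_j.+1 => Ordinal (lt i))
    (fun i : 'I_(j * r).+1 => inord (i %/ r))) /=; last first.
    move=> i ri; apply: val_inj; rewrite /= inordK ?divnK //.
    by rewrite ltnS leq_divLR // -ltnS.
  apply: eq_big => [i|i _].
    by rewrite dvdn_mull // mulnK // inord_val eqxx.
  by rewrite /fps_subst -mulnBl !dvdn_mull // !mulnK.
by move=> i ri; rewrite /fps_subst (negPf ri) mul0r.
Qed.
HB.instance Definition _ := GRing.isZmodMorphism.Build (fps k) (fps k)
  (fps_subst r) substB.
HB.instance Definition _ := GRing.isMonoidMorphism.Build (fps k) (fps k)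
  (fps_subst r) substM.
End Subst.
End PowerSeries.

(* A smooth projective curve over an algebraically closed field k is given   *)
(* by its function field K, a finitely generated extension iota : k -> K of  *)
(* transcendence degree one; its points are the discrete valuation rings of  *)
(* K/k, and the local ring at a point is the valuation ring itself. (Their   *)
(* residue field is k automatically, since k is algebraically closed.)       *)
Section Curve.
Variables (k K : fieldType) (iota : {rmorphism k -> K}).

Definition function_field : Prop :=
  exists t : K,
    (forall p : {poly k}, root (map_poly iota p) t -> p = 0) /\
    exists (n : nat) (b : 'I_n -> K), forall f : K,
      exists2 q : {poly k}, q != 0 & exists p : 'I_n -> {poly k},
        (map_poly iota q).[t] * f = \sum_i (map_poly iota (p i)).[t] * b i.

Definition maximal_ideal (O : K -> bool) : K -> bool :=
  fun f => (f \in O) && ((f == 0) || (f^-1 \notin O)).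

Record point := Point {
  val_ring :> K -> bool;
  val_ring_closed : subring_closed val_ring;
  val_ring_const : forall c : k, iota c \in val_ring;
  val_ring_dvr : exists2 t : K, t != 0 /\ t \in maximal_ideal val_ring &
    forall f : K, f != 0 -> exists (n : int) (u : K),
      [/\ u \in val_ring, u^-1 \in val_ring & f = t ^ n * u];
  val_ring_residue : forall f : K, f \in val_ring ->
    exists c : k, f - iota c \in maximal_ideal val_ring
}.

HB.instance Definition _ (x : point) :=
  GRing.isSubringClosed.Build K (val_ring x) (val_ring_closed x).

Definition local_ring (x : point) : Type := {f : K | f \in val_ring x}.
HB.instance Definition _ (x : point) := SubChoice.on (local_ring x).
HB.instance Definition _ (x : point) :=
  [SubChoice_isSubComNzRing of local_ring x by <:].

Definition to_K (x : point) : {rmorphism local_ring x -> K} := \val.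

Record uniformizer (x : point) := Uniformizer {
  unif :> local_ring x;
  unif_gen : forall f : local_ring x,
    to_K x f \in maximal_ideal x <-> exists g, f = unif * g
}.

Section LocalRing.
Variable x : point.

Definition local_const (c : k) : local_ring x := Sub (iota c) (val_ring_const x c).
Let constB : zmod_morphism local_const.
Proof. by move=> a b; apply: val_inj; rewrite /= rmorphB. Qed.
Let constM : monoid_morphism local_const.
Proof. by split=> [|a b]; apply: val_inj; rewrite /= ?rmorph1 ?rmorphM. Qed.
HB.instance Definition _ := GRing.isZmodMorphism.Build k (local_ring x)
  local_const constB.
HB.instance Definition _ := GRing.isMonoidMorphism.Build k (local_ring x)
  local_const constM.

Variable z : uniformizer x.

Definition eval_unif : {rmorphism {poly k} -> local_ring x} :=
  horner_morph (fun c : k => mulrC (unif z) (local_const c)).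

Lemma unif_neq0 : unif z != 0.
Proof.
apply/eqP => z0; have [t [t0 tm] _] := val_ring_dvr x.
have tO : t \in val_ring x by case/andP: tm.
have [/(_ tm)[g]] := unif_gen z (Sub t tO); rewrite z0 mul0r.
by move/(congr1 val) => /= tE; rewrite tE eqxx in t0.
Qed.

Lemma expansion_exists (f : local_ring x) :
  exists p : k * local_ring x, f = local_const p.1 + unif z * p.2.
Proof.
have [c cP] := val_ring_residue (valP f).
have [/(_ cP)[g gE] _] := unif_gen z (f - local_const c).
by exists (c, g); rewrite /= -gE addrC subrK.
Qed.

Lemma expansion_unique (c c' : k) (g g' : local_ring x) :
  local_const c + unif z * g = local_const c' + unif z * g' ->
  c = c' /\ g = g'.
Proof.
move=> E; have E' : local_const (c - c') = unif z * (g' - g).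
  have Ec : local_const c = local_const c' + unif z * g' - unif z * g.
    by rewrite -E addrK.
  by rewrite raddfB /= Ec mulrBr -!addrA addrC !addrA subrK.
have cE : c = c'.
  apply/eqP; rewrite -subr_eq0; apply/negP => /negP c0.
  have [_ /(_ (ex_intro _ _ E'))] := unif_gen z (local_const (c - c')).
  case/andP => _; rewrite /= fmorph_eq0 (negPf c0) /= -fmorphV.
  by rewrite val_ring_const.
split=> //; move/eqP: E'; rewrite cE subrr raddf0 eq_sym.
move/eqP/(congr1 val) => /= /eqP; rewrite mulf_eq0 => /orP[z0|].
  by have := unif_neq0; rewrite -val_eqE /= z0.
by rewrite subr_eq0 => /eqP/val_inj ->.
Qed.

Definition expansion (f : local_ring x) : k * local_ring x :=
  projT1 (cid (expansion_exists f)).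

Lemma expansionP f : f = local_const (expansion f).1 + unif z * (expansion f).2.
Proof. by rewrite /expansion; case: cid. Qed.

Lemma expansionE f c g : f = local_const c + unif z * g -> expansion f = (c, g).
Proof.
rewrite {1}(expansionP f) => /expansion_unique[].
by case: (expansion f) => /= ? ? -> ->.
Qed.

(* The expansion of f as a power series in z, which identifies the           *)
(* completion of the local ring with k[[z]].                                 *)
Definition taylor (f : local_ring x) : fps k :=
  fun n => (expansion (iter n (fun g => (expansion g).2) f)).1.

Let taylorS f n : taylor f n.+1 = taylor (expansion f).2 n.
Proof. by rewrite /taylor iterSr. Qed.

Let taylorB : zmod_morphism taylor.
Proof.
move=> f g; apply/funext => n; rewrite -[RHS]/(taylor f n - taylor g n).
have E f' g' : expansion (f' - g') =
    ((expansion f').1 - (expansion g').1, (expansion f').2 - (expansion g').2).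
  apply: expansionE; rewrite {1}(expansionP f') {1}(expansionP g').
  by rewrite raddfB mulrBr opprD addrACA.
elim: n f g => [|n IH] f g; first by rewrite /taylor /= E.
by rewrite !taylorS E IH.
Qed.

Let taylorD f g n : taylor (f + g) n = taylor f n + taylor g n.
Proof.
have t0 : taylor 0 = 0 by rewrite -(subrr 0) taylorB subrr.
have tN h : taylor (- h) = - taylor h by rewrite -sub0r taylorB t0 sub0r.
by rewrite -{1}(opprK g) taylorB tN opprK.
Qed.

Let taylor_const c n : taylor (local_const c) n = c *+ (n == 0%N).
Proof.
have E c' : expansion (local_const c') = (c', 0).
  by apply: expansionE; rewrite mulr0 addr0.
case: n => [|n]; first by rewrite /taylor /= E.
rewrite taylorS E /= mulr0n; elim: n => [|n IH].
  by rewrite /taylor /= -(raddf0 local_const) E.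
by rewrite taylorS -[X in (expansion X).2](raddf0 local_const) E.
Qed.

Let taylorM : monoid_morphism taylor.
Proof.
split=> [|f g]; apply/funext => n.
  by rewrite -(rmorph1 local_const) taylor_const; case: n.
rewrite -[RHS]/(\sum_(i < n.+1) taylor f i * taylor g (n - i)%N).
have E f' g' : expansion (f' * g') = ((expansion f').1 * (expansion g').1,
    local_const (expansion f').1 * (expansion g').2 + (expansion f').2 * g').
  apply: expansionE; rewrite {1}(expansionP f') mulrDl -mulrA.
  rewrite {1}(expansionP g') mulrDr -rmorphM -addrA; congr (_ + _).
  by rewrite mulrDr mulrCA.
have C c h j : taylor (local_const c * h) j = c * taylor h j.
  have EC h' : expansion (local_const c * h') =
      (c * (expansion h').1, local_const c * (expansion h').2).
    apply: expansionE; rewrite {1}(expansionP h') mulrDr rmorphM.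
    by rewrite mulrCA.
  elim: j h => [|j IH] h; first by rewrite /taylor /= EC.
  by rewrite !taylorS EC IH.
elim: n f g => [|n IH] f g; first by rewrite big_ord1 /taylor /= E.
rewrite taylorS E taylorD C IH [RHS]big_ord_recl subn0 (taylorS g).
by congr (_ + _); apply: eq_bigr => i _; rewrite (taylorS f) subSS.
Qed.
HB.instance Definition _ := GRing.isZmodMorphism.Build (local_ring x) (fps k)
  taylor taylorB.
HB.instance Definition _ := GRing.isMonoidMorphism.Build (local_ring x) (fps k)
  taylor taylorM.
End LocalRing.

Definition is_derivation (M : lmodType K) (delta : K -> M) : Prop :=
  [/\ forall f g, delta (f + g) = delta f + delta g,
      forall f g, delta (f * g) = f *: delta g + g *: delta f
    & forall c, delta (iota c) = 0].

Definition kahler : Type := presented is_derivation.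
HB.instance Definition _ := GRing.Lmodule.on kahler.
Definition diff (f : K) : kahler := generator is_derivation f.

Record divisor := Divisor {
  mult :> point -> int;
  mult_finite : finite_set [set x : point | mult x != 0]
}.

(* The stalk of Omega^1(D) at x: the forms f t^(-D(x)) dt with f in O_x, for *)
(* a local parameter t; this does not depend on t.                           *)
Definition differential_stalk (D : divisor) (x : point) (omega : kahler) : Prop :=
  forall t : uniformizer x, exists f : local_ring x,
    omega = (to_K x f * to_K x (unif t) ^ (- D x)) *: diff (to_K x (unif t)).

Definition is_span (x : point) (r : nat) (V : lmodType K) (b : 'I_r -> V)
    (L : submod (restr (to_K x) V)) : Prop :=
  forall v : V, v \in smem L <->
    exists c : 'I_r -> local_ring x, v = \sum_i to_K x (c i) *: b i.

(* A vector bundle of rank r: its generic fibre, an r-dimensional vector     *)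
(* space over K, together with its stalks, which are free O_x-submodules     *)
(* generated by a K-basis; a fixed basis generates almost all the stalks.    *)
Record bundle (r : nat) := Bundle {
  generic_fibre : lmodType K;
  lattice : forall x : point, submod (restr (to_K x) generic_fibre);
  lattice_free : forall x, exists2 b : 'I_r -> generic_fibre,
    is_basis b & is_span b (lattice x);
  lattice_coherent : exists2 b : 'I_r -> generic_fibre,
    is_basis b & finite_set [set x : point | ~ is_span b (lattice x)]
}.

Definition stalk (r : nat) (E : bundle r) (x : point) : Type := sub (lattice E x).
HB.instance Definition _ r (E : bundle r) x :=
  GRing.Lmodule.on (stalk E x).

Record connection (r : nat) (E : bundle r) (D : divisor) := Connection {
  conn :> generic_fibre E ->
    tensor (idfun : {rmorphism K -> K}) (generic_fibre E) kahler;
  connD : forall u v, conn (u + v) = conn u + conn v;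
  conn_leibniz : forall f v, conn (f *: v) = f *: conn v + tens _ v (diff f);
  conn_poles : forall x v, v \in smem (lattice E x) ->
    exists2 s : seq (generic_fibre E * kahler),
      (forall p, p \in s ->
         p.1 \in smem (lattice E x) /\ differential_stalk D x p.2)
      & conn v = \sum_(p <- s) tens _ p.1 p.2
}.

Section Local.
Variables (r : nat) (E : bundle r) (D : divisor) (nabla : connection E D).
Variables (x : point) (z : uniformizer x) (m : nat).

(* With D(x) = m, the stalk of Omega^1(D) at x is free on dz/z^m; [nabla_z]  *)
(* is nabla followed by this trivialization: nabla e = nabla_z e (x) dz/z^m. *)
Definition nabla_z (e : stalk E x) : stalk E x :=
  xget 0 [set u : stalk E x |
    nabla (val e) =
      tens _ (val u : generic_fibre E) (to_K x (unif z) ^- m *: diff (to_K x (unif z)))].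

(* The O_mx-module E|_mx = E_x / z^m E_x; it is regarded as a module over    *)
(* k[z], killed by z^m, where O_mx = k[z]/(z^m).                             *)
Definition zm_multiples : submod (restr (eval_unif z) (stalk E x)) :=
  scaled ('X^m : {poly k}) full.
Definition fibre_mx : Type := quot zm_multiples.
HB.instance Definition _ := GRing.Lmodule.on fibre_mx.

Definition nabla_mx (v : fibre_mx) : fibre_mx :=
  qclass zm_multiples (nabla_z (repr v)).

Definition completion : Type :=
  tensor (taylor z : {rmorphism local_ring x -> fps k}) (stalk E x) ((fps k)^o).
HB.instance Definition _ := GRing.Lmodule.on completion.

(* nh is the extension of nabla to the completion, trivialized by dz/z^m. *)
Definition is_completed_connection (nh : completion -> completion) : Prop :=
  (forall u v, nh (u + v) = nh u + nh v) /\
  forall (e : stalk E x) (f : (fps k)^o),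
    nh (tens _ e f) =
      tens _ (nabla_z e) f
      + tens _ e (fps_of_poly 'X^m * fps_deriv f : (fps k)^o).
End Local.
End Curve.

(* nu(w) = nu_0(z) + nu_1(z) w + ... + nu_(r-1)(z) w^(r-1), for z = w^r; the *)
(* forms nu_i(z) and nu(w) are written in units of dz/z^m.                   *)
Definition nu_w (k : fieldType) (r : nat) (nu : nat -> {poly k}) : {poly k} :=
  \sum_(i < r) (nu i \Po 'X^r) * 'X^i.

(* nabla_nu on k[[w]], in units of dz/z^m:                                    *)
(* df = (1/r) (w df/dw) dz/z = (1/r) z^(m-1) (w df/dw) dz/z^m.                *)
Definition nabla_nu (k : fieldType) (r m : nat) (nu : nat -> {poly k})
    (f : fps k) : fps k :=
  fps_of_poly ((r%:R^-1)%:P * 'X^(r * m.-1)) * euler f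
  + fps_of_poly (nu_w r nu) * f.

(* The completion of (E, nabla) at x is isomorphic to (k[[w]], nabla_nu),    *)
(* where k[[w]] is a module over k[[z]] through z = w^r.                     *)
Definition generic_ramified (k K : fieldType) (iota : {rmorphism k -> K})
    (r : nat) (E : bundle iota r) (D : divisor iota) (nabla : connection E D)
    (x : point iota) (z : uniformizer x) (m : nat) (nu : nat -> {poly k}) : Prop :=
  exists nh : completion E z -> completion E z,
    is_completed_connection nabla m nh /\
    exists Phi : {linear completion E z ->
                  restr (fps_subst r : {rmorphism fps k -> fps k}) (fps k)^o},
      bijective Phi /\ forall u, Phi (nh u) = nabla_nu r m nu (Phi u).

(* Modules over O_mx = k[z]/(z^m), resp. over R = k[w]/(w^(mr-r+1)), are     *)
(* modules over k[z], resp. k[w], killed by z^m, resp. w^(mr-r+1); tensor    *)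
(* products and linear maps over these rings are the same over k[z], k[w].   *)
(* An equality of linear maps out of a tensor product is stated on pure      *)
(* tensors. Families indexed by 0 <= j <= r-1 are indexed by nat; their      *)
(* values for j >= r are irrelevant.                                         *)
Section RamifiedStructures.
Variables (k : fieldType) (r m : nat) (nu : nat -> {poly k}).
(* E|_mx and nabla|_mx in units of dz/z^m. *)
Variables (M : lmodType {poly k}) (A : M -> M).
Local Notation P := {poly k}.
Local Notation N := (m * r - r).+1.

(* k[z] -> k[w], z |-> w^r *)
Definition z_to_w : {rmorphism P -> P} := comp_poly ('X^r : P).

Definition Omx : lmodType P := subquo k 0 m.
Definition Rw : lmodType P := subquo k 0 N.

(* nu(w) + (j/r) dz/z in units of dz/z^m *)
Definition nu_shift (j : nat) : P :=
  nu_w r nu + (j%:R / r%:R)%:P * 'X^(r * m.-1).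

Record filtration := Filtration {
  fil :> nat -> submod M;
  fil_0 : smem (fil 0) =1 predT;
  fil_r : smem (fil r) =1 smem (scaled ('X : P) (fil 0));
  fil_sub : forall j, (j < r)%N -> {subset smem (fil j.+1) <= smem (fil j)};
  fil_length : forall j, (j < r)%N -> length_one (quot (subin (fil j) (fil j.+1)));
  fil_conn : forall j, (j < r)%N -> forall v, v \in smem (fil j) ->
    A v \in smem (fil j)
}.

Section Filtration.
Variable V : filtration.

Definition fil_A (j : nat) (v : sub (V j)) : sub (V j) := insub0 (V j) (A (val v)).

Definition fil_incl (j : nat) (v : sub (V j.+1)) : sub (V j) :=
  insub0 (V j) (val v).

(* (z)/(z^(m+1)) x V_0 -> V_(r-1), (p, v) |-> p v, the bilinear form of the  *)
(* map on the tensor product induced by the inclusion of z V_0 in V_(r-1).   *)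
Definition fil_z (p : subquo k 1 m.+1) (v : sub (V 0)) : sub (V r.-1) :=
  insub0 (V r.-1) (subquo_repr p *: val v).
End Filtration.

(* (w^a)/(w^b) (x) L -> wL (or L), p (x) l |-> p l *)
Definition mult_map (a b : nat) (L : lmodType P) :
  tensor (idfun : {rmorphism P -> P}) (subquo k a b) L -> L :=
  tens_lift (fun p l => subquo_repr p *: l).

(* (w)/(w^(N+1)) (x) (w^j)/(w^(N+j)) (x) L -> (w^(j+1))/(w^(N+j+1)) (x) L *)
Definition twist_map (j : nat) (L : lmodType P) (p : subquo k 1 N.+1) :
  tensor (idfun : {rmorphism P -> P}) (subquo k j (N + j)) L ->
  tensor (idfun : {rmorphism P -> P}) (subquo k j.+1 (N + j.+1)) L :=
  tens_lift (fun q l =>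
    tens _ (subquo_class j.+1 (N + j.+1) (subquo_repr p * subquo_repr q)) l).

(* Given psi_(j+1) : L_(j+1) -> (w)/(w^(mr-r+2)) (x) L_j, the composite      *)
(* psi_1 o ... o psi_j : L_j -> (w^j)/(w^(mr-r+1+j)) (x) L_0.                *)
Fixpoint psi_chain (L : nat -> lmodType P)
    (psi : forall j, L j.+1 ->
       tensor (idfun : {rmorphism P -> P}) (subquo k 1 N.+1) (L j))
    (j : nat) : L j ->
      tensor (idfun : {rmorphism P -> P}) (subquo k j (N + j)) (L 0) :=
  match j with
  | 0 => fun l => tens _ (subquo_class 0 (N + 0) 1) l
  | j'.+1 => fun l =>
      tens_lift (fun p l' => twist_map p (psi_chain psi l')) (psi j' l)
  end.

(* A generic nu-ramified structure. The maps L_j -> wL_(j-1) and the maps    *)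
(* psi_j are indexed by j-1.                                                 *)
Record generic_structure := GenericStructure {
  gs_fil :> filtration;
  gs_L : nat -> lmodType P;
  gs_pi : forall j, {linear tensor z_to_w (sub (gs_fil j)) Rw -> gs_L j};
  gs_phi : forall j,
    {linear gs_L j.+1 -> sub (scaled ('X : P) (full : submod (gs_L j)))};
  gs_phir :
    {linear tensor (idfun : {rmorphism P -> P}) (subquo k r (m * r).+1) (gs_L 0)
     -> sub (scaled ('X : P) (full : submod (gs_L r.-1)))};
  gs_L_free : forall j, (j < r)%N ->
    exists f : {linear Rw -> gs_L j}, bijective f;
  gs_pi_surj : forall j, (j < r)%N -> forall l, exists t, gs_pi j t = l;
  gs_pi_V_surj : forall j, (j < r)%N -> forall l, exists v : sub (gs_fil j),
    gs_pi j (tens _ v (subquo_class 0 N 1)) = l;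
  gs_pi_conn : forall j, (j < r)%N -> forall (v : sub (gs_fil j)) (f : Rw),
    gs_pi j (tens _ (fil_A v) f) = nu_shift j *: gs_pi j (tens _ v f);
  gs_phi_surj : forall j, (j.+1 < r)%N -> forall l, exists t, gs_phi j t = l;
  gs_phir_surj : forall l, exists t, gs_phir t = l;
  gs_phi_pi : forall j, (j.+1 < r)%N ->
    forall (v : sub (gs_fil j.+1)) (f : Rw),
      val (gs_phi j (gs_pi j.+1 (tens _ v f))) = gs_pi j (tens _ (fil_incl v) f);
  gs_phir_pi : forall (p : subquo k 1 m.+1) (v : sub (gs_fil 0)) (f : Rw),
    val (gs_phir (tens _ (subquo_class r (m * r).+1 (z_to_w (subquo_repr p)))
                         (gs_pi 0 (tens _ v f))))
    = gs_pi r.-1 (tens _ (fil_z p v) f);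
  gs_psi : exists psi : forall j, {linear gs_L j.+1 ->
      tensor (idfun : {rmorphism P -> P}) (subquo k 1 N.+1) (gs_L j)},
    [/\ forall j, (j.+1 < r)%N -> bijective (psi j),
        forall j, (j.+1 < r)%N -> forall l, mult_map (psi j l) = val (gs_phi j l)
      & forall (p : subquo k r (m * r).+1) (l : gs_L 0),
          psi_chain psi (val (gs_phir (tens _ p l)))
          = tens _ (subquo_class r.-1 (N + r.-1) (subquo_repr p)) l]
}.

(* The duals below are indexed so that W_j = Hom(Vb_(r-j-1), O_mx) is        *)
(* [Wb (r-j-1)]; a pair of indices (i, j) with i + j + 1 = r stands for      *)
(* (i, r-i-1).                                                               *)
Section Reduction.
Variable V : filtration.

(* Vb_j = V_j / z^(m-1) V_(j+1) *)
Definition Vb_sub (j : nat) : submod (sub (V j)) :=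
  subin (V j) (scaled ('X^(m.-1) : P) (V j.+1)).
Definition Vb (j : nat) : lmodType P := quot (Vb_sub j).
Definition Vb_class (j : nat) (v : sub (V j)) : Vb j := qclass (Vb_sub j) v.

Definition Vb_incl (j : nat) (v : Vb j.+1) : Vb j := Vb_class (fil_incl (repr v)).

(* (z)/(z^(m+1)) x Vb_0 -> Vb_(r-1) *)
Definition Vb_z (p : subquo k 1 m.+1) (v : Vb 0) : Vb r.-1 :=
  Vb_class (fil_z p (repr v)).

Definition Wb (j : nat) : lmodType P := hom (Vb j) Omx.

(* The dual of Vb_(j+1) -> Vb_j, that is, W_(r-j-1) -> W_(r-j-2). *)
Definition Wb_incl (j : nat) (xi : Wb j) : Wb j.+1 :=
  to_hom (fun v : Vb j.+1 => hom_fun xi (Vb_incl v) : Omx).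

(* (z)/(z^(m+1)) x W_0 -> W_(r-1): tensoring the dual                        *)
(* Vb_(r-1)^* -> ((z)/(z^(m+1)) (x) Vb_0)^* with (z)/(z^(m+1)) and           *)
(* contracting the two factors (z)/(z^(m+1)).                                *)
Definition Wb_z (p : subquo k 1 m.+1) (xi : Wb r.-1) : Wb 0 :=
  to_hom (fun v : Vb 0 => hom_fun xi (Vb_z p v) : Omx).
End Reduction.

Definition bilinear_form (U W Q : lmodType P) (b : U -> W -> Q) : Prop :=
  (forall u, linear (b u)) /\ (forall w, linear (b^~ w)).

Record factorized_structure := FactorizedStructure {
  fs_fil :> filtration;
  (* theta_i : W_i x W_j -> O_mx and the induced W_i -> Hom(W_j, O_mx) = Vb_i, *)
  (* for i + j + 1 = r                                                       *)
  fs_vtheta : forall i j, Wb fs_fil j -> Wb fs_fil i -> Omx;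
  fs_theta : forall i j, {linear Wb fs_fil j -> Vb fs_fil i};
  fs_vkappa : forall i j, Vb fs_fil i -> Vb fs_fil j -> Omx;
  fs_kappa : forall i j, {linear Vb fs_fil i -> Wb fs_fil j};
  fs_vtheta_bilinear : forall i j, (i + j).+1 = r ->
    bilinear_form (@fs_vtheta i j);
  fs_vtheta_sym : forall i j, (i + j).+1 = r -> forall u v,
    @fs_vtheta i j u v = @fs_vtheta j i v u;
  fs_thetaE : forall i j, (i + j).+1 = r ->
    forall (u : Wb fs_fil j) (xi : Wb fs_fil i),
      hom_fun xi (fs_theta i j u) = @fs_vtheta i j u xi;
  fs_theta_bij : forall i j, (i + j).+1 = r -> bijective (fs_theta i j);
  fs_theta_incl : forall i j, (i + j).+2 = r -> forall u : Wb fs_fil j,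
    fs_theta i j.+1 (Wb_incl u) = Vb_incl (fs_theta i.+1 j u);
  fs_theta_z : forall (p : subquo k 1 m.+1) (u : Wb fs_fil r.-1),
    fs_theta r.-1 0 (Wb_z p u) = Vb_z p (fs_theta 0 r.-1 u);
  fs_vkappa_bilinear : forall i j, (i + j).+1 = r ->
    bilinear_form (@fs_vkappa i j);
  fs_vkappa_sym : forall i j, (i + j).+1 = r -> forall u v,
    @fs_vkappa i j u v = @fs_vkappa j i v u;
  fs_kappaE : forall i j, (i + j).+1 = r ->
    forall (u : Vb fs_fil i) (v : Vb fs_fil j),
      hom_fun (fs_kappa i j u) v = @fs_vkappa i j u v;
  fs_kappa_incl : forall i j, (i + j).+2 = r -> forall u : Vb fs_fil i.+1,
    fs_kappa i j.+1 (Vb_incl u) = Wb_incl (fs_kappa i.+1 j u);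
  fs_kappa_z : forall (p : subquo k 1 m.+1) (u : Vb fs_fil 0),
    fs_kappa r.-1 0 (Vb_z p u) = Wb_z p (fs_kappa 0 r.-1 u);
  fs_N : forall j, {linear Vb fs_fil j -> Vb fs_fil j} :=
    fun j => fs_theta j (r - j.+1) \o fs_kappa j (r - j.+1);
  fs_N_r : forall j, (j < r)%N -> forall v, iter r (fs_N j) v = 'X *: v;
  fs_N_nilp : forall j, (j < r)%N -> forall v, iter N (fs_N j) v = 0;
  fs_N_inj : forall j, (j < r)%N -> forall f : P,
    (forall v : endmod (fs_N j), f *: v = 0) -> 'X^N %| f;
  fs_conn : forall j, (j < r)%N -> forall v : sub (fs_fil j),
    Vb_class (fil_A v) = nu_shift j *: (Vb_class v : endmod (fs_N j));
  fs_psi : exists psi : forall j, {linear endmod (fs_N j.+1) ->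
      tensor (idfun : {rmorphism P -> P}) (subquo k 1 N.+1) (endmod (fs_N j))},
    [/\ forall j, (j.+1 < r)%N -> bijective (psi j),
        forall j, (j.+1 < r)%N -> forall v, mult_map (psi j v) = Vb_incl v
      & forall (p : subquo k 1 m.+1) (v : Vb fs_fil 0),
          psi_chain (L := fun j => endmod (fs_N j)) psi (Vb_z p v)
          = tens _ (subquo_class r.-1 (N + r.-1) (z_to_w (subquo_repr p)))
                   (v : endmod (fs_N 0))]
}.
End RamifiedStructures.

(* Main.v *)
(* All three conditions are equivalent to the existence of an "adapted"       *)
(* identification: a k[z]-linear isomorphism of E|_mx with k[w]/(w^(mr))      *)
(* which matches nabla with nabla_nu up to terms raising the w-adic order by  *)
(* N = mr - r + 1.                                                            *)
(*                                                                            *)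
(* Given one, V_j is the image of (w^j), each V_j / z^(m-1) V_(j+1) is a copy *)
(* of R = k[w]/(w^N), and (f, g) |-> (the part of fg with w-exponents         *)
(* divisible by r) identifies R with its O_mx-dual; this gives a generic and  *)
(* a factorized structure, where theta is the identity and kappa is           *)
(* multiplication by w. Conversely, either structure gives maps from the V_j  *)
(* to R that are compatible with the inclusions V_(j+1) in V_j, and lifting   *)
(* 1 to each V_j gives the images of the w^j in E|_mx.                        *)
(*                                                                            *)
(* Truncating an isomorphism of completions modulo z^m gives an adapted       *)
(* identification. Conversely, lift one to a basis of the stalk; in it the    *)
(* completed connection is nabla_nu + b, where b raises the w-adic order by   *)
(* more than r(m - 1) and commutes with z. A k[[z]]-linear gauge              *)
(* transformation 1 + ... removing b is found by recursion on the weight: in  *)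
(* each weight nu_1 <> 0 fixes its coefficients up to a constant, and that    *)
(* constant is fixed, in characteristic 0, by the residue term d/dz, which    *)
(* makes the equation r(m - 1) weights further solvable. The derivation d/dz  *)
(* of k(C) is read off Taylor expansions; it preserves the local ring because *)
(* elements of k(C) are algebraic over k(z), by counting monomials.           *)

Require Import Defs.
From HB Require Import structures.
From mathcomp Require Import all_boot all_order all_algebra.
From mathcomp Require Import boolp classical_sets functions.
From mathcomp Require Import reals complex.
From mathcomp Require Import ring lra zify.
Import Defs.

Set Implicit Arguments.
Unset Strict Implicit.
Unset Printing Implicit Defensive.

Import GRing.Theory.
Local Open Scope ring_scope.
Local Open Scope quotient_scope.

(** * Tensor products and quotients *)

(** Every condition is compared with an [adapted] identification [eps] of E|_mx with k[w]/(w^(mr)),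
    linear over k[z] for z = w^r, in which nabla sends w^j q to w^j (nu + (j/r) dz/z) q up to
    multiples of w^(N+j), N = mr - r + 1. This error is exactly the room needed to ignore the
    derivative of q ([nabla_nu_poly]).

    In either structure the maps psi identify all the quotients of the V_k with one cyclic module
    k[w]/(w^N), so that the inclusions of V_(k+1) in V_k, and z from V_0 to V_(r-1), become
    multiplication by w ([adapted_from_psi]). Lifts e_k in V_k of a single generator then behave
    like w^k: they generate E|_mx because V_k/V_(k+1) is simple, and torsion in E|_mx excludes
    further relations ([adapted_from_quotients]). Conversely the filtration by the images of (w^k)
    carries both structures ([generic_from_adapted], [factorized_from_adapted]); the second one
    rests on the self-duality of R under a trace form ([residue_perfect]).

    An isomorphism of completions reduces modulo z^m to an adapted identification
    ([adapted_from_generic_ramified]). In the other direction Nakayama's lemma lifts the eps(w^j) to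
    a basis of the stalk ([eps_lift_basis]), in which the connection is nabla_nu + b with b linear
    over k[[z]] and raising the order by at least N. The gauge equation removing b ([gauge_exists])
    has in each weight the leading part nu_1 (a(i+1) - a(i)), a difference operator on functions of
    i modulo r. Its kernel is the constants and its only obstruction is the sum over a period; the
    free constant of a given weight is used to cancel the obstruction r(m-1) weights later, through
    the residue term of nabla_nu, which is invertible there in characteristic 0.

    To relate nabla to power series one needs d/dz on the local ring, compatible with Taylor
    expansions and with all derivations of K; it comes from differentiating a polynomial relation
    between z and g ([derivative_exists]). *)

Lemma linear_exists (A : nzRingType) (U V : lmodType A) (f : U -> V) :
  linear f -> exists F : {linear U -> V}, F =1 f.
Proof.
move=> lf; pose F := GRing.isLinear.Build A U V _ f lf.
by exists (HB.pack_for {linear U -> V} f F).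
Qed.

Section LinearProp.
Variables (A : nzRingType) (U V : lmodType A) (f : U -> V).
Hypothesis lf : linear f.

Lemma lin0 : f 0 = 0.
Proof. by have [F <-] := linear_exists lf; rewrite linear0. Qed.
Lemma linD u v : f (u + v) = f u + f v.
Proof. by rewrite -[u]scale1r lf !scale1r. Qed.
Lemma linZ a u : f (a *: u) = a *: f u.
Proof. by rewrite -[a *: u]addr0 lf lin0 addr0. Qed.
Lemma linB u v : f (u - v) = f u - f v.
Proof. by rewrite linD -scaleN1r linZ scaleN1r. Qed.
Lemma lin_sum I (s : seq I) (F : I -> U) :
  f (\sum_(i <- s) F i) = \sum_(i <- s) f (F i).
Proof.
by elim: s => [|i s IH]; rewrite ?big_nil ?lin0 // !big_cons linD IH.
Qed.
End LinearProp.

Lemma scaler_swap (A : comNzRingType) (V : lmodType A) (a b : A) (v : V) :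
  a *: (b *: v) = b *: (a *: v).
Proof. by rewrite !scalerA mulrC. Qed.

(** The homomorphism theorem. Maps out of quotients and submodules parametrized by k[w] are
    constructed with it. *)
Lemma linear_factor (A : nzRingType) (X U V : lmodType A)
    (c : {linear X -> U}) (d : {linear X -> V}) :
  (forall u, exists x, u = c x) -> (forall x, c x = 0 -> d x = 0) ->
  exists F : {linear U -> V}, forall x, F (c x) = d x.
Proof.
move=> c_surj ker; pose f u := d (projT1 (cid (c_surj u))).
have fE x : f (c x) = d x.
  rewrite /f; case: cid => y /= /eqP; rewrite eq_sym -subr_eq0 -raddfB => /eqP.
  by move/ker/eqP; rewrite raddfB subr_eq0 => /eqP.
have lf : linear f.
  move=> a u v; have [x ->] := c_surj u; have [y ->] := c_surj v.
  by rewrite -linearP !fE linearP.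
by have [F FE] := linear_exists lf; exists F => x; rewrite FE fE.
Qed.

Section Presented.
Variables (B : comNzRingType) (X : choiceType).
Variable P : forall M : lmodType B, (X -> M) -> Prop.
Local Notation T := (presented P).

Lemma presented_lift_pi (M : lmodType B) (f : X -> M) s : P f ->
  presented_lift f (\pi_T s) = combination f s.
Proof.
move=> Pf; rewrite /presented_lift.
have /eqmodP/asboolP : \pi_T (repr (\pi_T s)) = \pi_T s by rewrite reprK.
exact.
Qed.

(** Equality in a presented module is agreement under all admissible maps, so these maps separate
    points; identities between tensors and between differentials are checked this way. *)
Lemma presented_ext (x y : T) :
  (forall (M : lmodType B) (f : X -> M), P f ->
     presented_lift f x = presented_lift f y) -> x = y.
Proof.
move=> h; rewrite -[x]reprK -[y]reprK; apply/eqmodP/asboolP => M f Pf.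
exact: h.
Qed.

Lemma presented_lift_linear (M : lmodType B) (f : X -> M) : P f ->
  linear (presented_lift f : T -> M).
Proof.
move=> Pf b x y.
have cat s t : combination f (s ++ t) = combination f s + combination f t.
  exact: big_cat.
have scale c s : combination f [seq (c * x.1, x.2) | x <- s]
    = c *: combination f s.
  rewrite /combination big_map scaler_sumr.
  by apply: eq_bigr => p _; rewrite scalerA.
have lD u v : presented_lift f (u + v : T) =
    presented_lift f u + presented_lift f v.
  rewrite -[X in presented_lift f X]/(\pi_T (repr u ++ repr v)).
  by rewrite presented_lift_pi // cat.
have lZ c u : presented_lift f (c *: u : T) = c *: presented_lift f u.
  rewrite -[X in presented_lift f X]/(\pi_T [seq (c * x.1, x.2) | x <- repr u]).
  by rewrite presented_lift_pi // scale.
by rewrite lD lZ.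
Qed.

Lemma presented_lift_generator (M : lmodType B) (f : X -> M) x : P f ->
  presented_lift f (generator P x) = f x.
Proof.
move=> Pf; rewrite presented_lift_pi //.
by rewrite /combination big_seq1 scale1r.
Qed.

Lemma presented_pi_sum (s : seq (B * X)) :
  \pi_T s = \sum_(p <- s) p.1 *: generator P p.2.
Proof.
apply: presented_ext => M f Pf; rewrite presented_lift_pi //.
have [F FE] := linear_exists (presented_lift_linear Pf).
rewrite -FE linear_sum; apply: eq_bigr => p _.
by rewrite linearZZ FE presented_lift_generator.
Qed.

Lemma presented_span (t : T) :
  exists s : seq (B * X), t = \sum_(p <- s) p.1 *: generator P p.2.
Proof. by exists (repr t); rewrite -presented_pi_sum reprK. Qed.
End Presented.

Section Tensor.
Variables (A B : comNzRingType) (f : {rmorphism A -> B}).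
Variables (M : lmodType A) (N : lmodType B).
Local Notation T := (tensor f M N).

Lemma tens_liftE (Q : lmodType B) (g : M -> N -> Q) u n :
  is_bilinear f (fun x => g x.1 x.2) -> tens_lift g (tens f u n) = g u n.
Proof. by move=> bg; rewrite /tens_lift /tens presented_lift_generator. Qed.

Lemma tens_lift_linear (Q : lmodType B) (g : M -> N -> Q) :
  is_bilinear f (fun x => g x.1 x.2) -> linear (tens_lift g : T -> Q).
Proof. by move=> bg; apply: presented_lift_linear. Qed.

Lemma tens_bilinear : is_bilinear f (fun x => tens f x.1 x.2 : T).
Proof.
have key (Q : lmodType B) (h : M * N -> Q) : is_bilinear f h ->
    exists2 F : {linear T -> Q}, (F =1 presented_lift h)
      & forall u n, F (tens f u n) = h (u, n).
  move=> bh; have [F FE] := linear_exists (presented_lift_linear bh).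
  by exists F => // u n; rewrite FE presented_lift_generator.
split=> [u v n|u n p|a u n|b u n] /=; apply: presented_ext => Q h bh;
  have [F lE FE] := key _ _ bh; rewrite -!lE; case: bh => h1 h2 h3 h4.
- by rewrite raddfD /= !FE.
- by rewrite raddfD /= !FE.
- by rewrite !FE.
- by rewrite linearZ /= !FE.
Qed.

Implicit Types (a : A) (b : B) (u v : M) (n p : N).

Lemma tensDl u v n : tens f (u + v) n = tens f u n + tens f v n.
Proof. by case: tens_bilinear => /= h _ _ _; apply: h. Qed.
Lemma tensDr u n p : tens f u (n + p) = tens f u n + tens f u p.
Proof. by case: tens_bilinear => /= _ h _ _; apply: h. Qed.
Lemma tensZl a u n : tens f (a *: u) n = tens f u (f a *: n).
Proof. by case: tens_bilinear => /= _ _ h _; apply: h. Qed.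
Lemma tensZr b u n : tens f u (b *: n) = b *: tens f u n.
Proof. by case: tens_bilinear => /= _ _ _ h; apply: h. Qed.

Lemma tens_linear u : linear (tens f u : N -> T).
Proof. by move=> b n p; rewrite tensDr tensZr. Qed.
Lemma tens0l n : tens f (0 : M) n = 0.
Proof. by rewrite -(scale0r (0 : M)) tensZl raddf0 scale0r -(scale0r n) tensZr scale0r. Qed.

Lemma tens_suml I (s : seq I) (F : I -> M) n :
  tens f (\sum_(i <- s) F i) n = \sum_(i <- s) tens f (F i) n.
Proof.
by elim: s => [|i s IH]; rewrite ?big_nil ?tens0l // !big_cons tensDl IH.
Qed.

Lemma tens_span (t : T) : exists s : seq (M * N), t = \sum_(x <- s) tens f x.1 x.2.
Proof.
have [s ->] := presented_span t; exists [seq (x.2.1, x.1 *: x.2.2) | x <- s].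
rewrite big_map; apply: eq_bigr => -[b [u n]] _ /=.
by rewrite tensZr.
Qed.

Lemma tens_ext (Q : lmodType B) (F G : T -> Q) : linear F -> linear G ->
  (forall u n, F (tens f u n) = G (tens f u n)) -> F =1 G.
Proof.
move=> lF lG FG t; have [s ->] := tens_span t.
have [F' FE] := linear_exists lF; have [G' GE] := linear_exists lG.
rewrite -FE -GE !linear_sum; apply: eq_bigr => x _.
by rewrite FE GE; apply: FG.
Qed.

Lemma tens_lift_exists (Q : lmodType B) (g : M -> N -> Q) :
  is_bilinear f (fun x => g x.1 x.2) ->
  exists2 F : {linear T -> Q}, (F : T -> Q) =1 tens_lift g
    & forall u n, F (tens f u n) = g u n.
Proof.
move=> bg; have [F FE] := linear_exists (tens_lift_linear bg).
by exists F => // u n; rewrite FE tens_liftE.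
Qed.
End Tensor.

Section Quotient.
Variables (A : nzRingType) (M : lmodType A) (S : submod M).
Implicit Types u v : M.

Lemma qclassP u v : qclass S u = qclass S v <-> u - v \in smem S.
Proof. by split=> [/eqmodP|h]; [|apply/eqmodP]. Qed.

Lemma qclass_repr (x : quot S) : qclass S (repr x) = x.
Proof. exact: reprK. Qed.

Lemma repr_qclass u : repr (qclass S u) - u \in smem S.
Proof. by apply/qclassP; rewrite qclass_repr. Qed.

Lemma qclass_linear : linear (qclass S : M -> quot S).
Proof.
move=> a u v.
have D u' v' : qclass S u' + qclass S v' = qclass S (u' + v').
  rewrite -[LHS]/(qclass S (repr (qclass S u') + repr (qclass S v'))).
  by apply/qclassP; rewrite opprD addrACA rpredD ?repr_qclass.
have -> : a *: qclass S u = qclass S (a *: u).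
  rewrite -[LHS]/(qclass S (a *: repr (qclass S u))).
  by apply/qclassP; rewrite -scalerBr rpredZ ?repr_qclass.
by rewrite D.
Qed.
HB.instance Definition _ := GRing.isLinear.Build A M (quot S) *:%R (qclass S)
  qclass_linear.

Lemma qclass_eq0 u : qclass S u = 0 <-> u \in smem S.
Proof. by rewrite -(raddf0 (qclass S)); split=> [/qclassP|h]; [|apply/qclassP]; rewrite subr0. Qed.

Lemma qclass_surj (x : quot S) : exists u, x = qclass S u.
Proof. by exists (repr x); rewrite qclass_repr. Qed.
End Quotient.

Section SubVal.
Variables (A : nzRingType) (M : lmodType A) (S : submod M).
Implicit Types u v : sub S.
Lemma subvalD u v : val (u + v) = val u + val v. Proof. by []. Qed.
Lemma subvalB u v : val (u - v) = val u - val v. Proof. by []. Qed.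
Lemma subvalZ a u : val (a *: u) = a *: val u. Proof. by []. Qed.
Lemma subvalP v : val v \in smem S. Proof. exact: (valP v). Qed.
End SubVal.

Lemma insub0K (A : nzRingType) (M : lmodType A) (S : submod M) (v : M) :
  v \in smem S -> val (insub0 S v) = v.
Proof. by move=> Sv; rewrite /insub0 insubdK. Qed.

Lemma insub0_val (A : nzRingType) (M : lmodType A) (S : submod M) (v : sub S) :
  insub0 S (val v) = v.
Proof. by apply: val_inj; rewrite insub0K //; apply: (valP v). Qed.

Lemma scaledP (A : comNzRingType) (M : lmodType A) (a : A) (S : submod M) v :
  reflect (exists2 u, u \in smem S & v = a *: u) (v \in smem (scaled a S)).
Proof. exact: asboolP. Qed.

Section Line.
Variables (A : nzRingType) (M : lmodType A) (w : M).
Definition line_pred : {pred M} := fun v => `[< exists a, v = a *: w >].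
Lemma line_closed : submod_closed line_pred.
Proof.
split=> [|a u v /asboolP[b ->] /asboolP[c ->]]; apply/asboolP.
  by exists 0; rewrite scale0r.
by exists (a * b + c); rewrite scalerDl scalerA.
Qed.

Definition line := Submod line_closed.
End Line.

Lemma length_one_gen (A : nzRingType) (M : lmodType A) (w v : M) :
  length_one M -> w <> 0 -> exists a, v = a *: w.
Proof.
case=> _ /(_ (line w)) [w0 w_neq0|all _].
  by case: w_neq0; apply: w0; apply/asboolP; exists 1; rewrite scale1r.
exact/asboolP/all.
Qed.

(** * Subquotients of k[w] and tensor products with them *)

Section Subquotient.
Variable k : fieldType.
Local Notation P := {poly k}.
Variables a b : nat.
Implicit Types p q : P.

Lemma dvdp_Xn_drop (n : nat) p : 'X^n %| p -> p = drop_poly n p * 'X^n.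
Proof. by case/dvdpP=> q ->; rewrite drop_polyMXn_id. Qed.

Lemma dvdp_XnP (n : nat) p :
  reflect (forall i, (i < n)%N -> p`_i = 0) ('X^n %| p).
Proof.
apply: (iffP idP) => [/dvdpP[q ->] i ni|h]; first by rewrite coefMXn ni.
apply/dvdpP; exists (drop_poly n p); apply/polyP=> i; rewrite coefMXn.
by case: ltnP => [/h //|ni]; rewrite coef_drop_poly subnK.
Qed.

Lemma XidealE (n : nat) p : (p \in smem (Xideal k n)) = ('X^n %| p).
Proof.
apply/scaledP/idP => [[u _ ->]|/dvdpP[q ->]]; first exact: dvdp_mulr.
by exists q; rewrite // mulrC.
Qed.

Lemma subquo_reprP (x : subquo k a b) : 'X^a %| subquo_repr x.
Proof. by rewrite -XidealE; apply: (valP (repr x)). Qed.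

Lemma subquo_reprK (x : subquo k a b) : subquo_class a b (subquo_repr x) = x.
Proof. by rewrite /subquo_class /subquo_repr insub0_val qclass_repr. Qed.

Lemma subquo_classP p q : 'X^a %| p -> 'X^a %| q ->
  subquo_class a b p = subquo_class a b q <-> 'X^b %| p - q.
Proof.
move=> ap aq; rewrite /subquo_class qclassP -XidealE.
have <- : val (insub0 (Xideal k a) p - insub0 (Xideal k a) q) = p - q.
  by rewrite subvalB !insub0K ?XidealE.
by [].
Qed.

Lemma subquo_classK p : 'X^a %| p ->
  'X^b %| subquo_repr (subquo_class a b p) - p.
Proof.
by move=> ap; apply/subquo_classP; rewrite ?subquo_reprK ?subquo_reprP.
Qed.

Lemma subquo_classD p q : 'X^a %| p -> 'X^a %| q ->
  subquo_class a b (p + q) = subquo_class a b p + subquo_class a b q.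
Proof.
move=> ap aq; rewrite /subquo_class -raddfD /=; congr qclass.
by apply: val_inj; rewrite subvalD !insub0K ?XidealE ?dvdp_add.
Qed.

Lemma subquo_classZ c p : 'X^a %| p ->
  subquo_class a b (c * p) = c *: subquo_class a b p.
Proof.
move=> ap; rewrite /subquo_class -linearZ; congr qclass.
by apply: val_inj; rewrite subvalZ !insub0K ?XidealE ?dvdp_mull.
Qed.
End Subquotient.

Section Untwist.
Variable k : fieldType.
Local Notation P := {poly k}.
Local Notation id_P := (idfun : {rmorphism P -> P}).

Definition kills (p : P) (L : lmodType P) := forall l : L, p *: l = 0.

Lemma drop_poly_dvd (a b : nat) (p q : P) : (a <= b)%N ->
  'X^b %| p - q -> 'X^(b - a) %| drop_poly a p - drop_poly a q.
Proof.
move=> ab /dvdpP[h E].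
have -> : drop_poly a p - drop_poly a q = drop_poly a (p - q).
  by rewrite -scaleN1r -drop_polyZ -drop_polyD scaleN1r.
rewrite E -{2}(subnK ab) exprD mulrA drop_polyMXn_id.
exact: dvdp_mull.
Qed.

Lemma drop_polyMr (a : nat) (p q : P) : 'X^a %| q ->
  drop_poly a (p * q) = p * drop_poly a q.
Proof. by move/dvdp_Xn_drop => {1}->; rewrite mulrA drop_polyMXn_id. Qed.

(** Division of the first factor by w^j. For c = N + j and L killed by w^N it is the inverse of the
    isomorphism l |-> w^j (x) l. *)
Definition untwist (j c : nat) (L : lmodType P) :
    tensor id_P (subquo k j c) L -> L :=
  tens_lift (fun p l => drop_poly j (subquo_repr p) *: l).

Variables (N : nat) (L : lmodType P).
Hypothesis L_killed : kills 'X^N L.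

Lemma kills_dvd (p : P) (l : L) : 'X^N %| p -> p *: l = 0.
Proof. by case/dvdpP=> q ->; rewrite -scalerA L_killed scaler0. Qed.

Lemma kills_eq (p q : P) (l : L) : 'X^N %| p - q -> p *: l = q *: l.
Proof. by move=> pq; apply/eqP; rewrite -subr_eq0 -scalerBl kills_dvd. Qed.

Variables j c : nat.
Hypothesis cE : c = (N + j)%N.

Lemma untwist_rep (x : subquo k j c) (p : P) (l : L) :
  'X^j %| p -> x = subquo_class j c p ->
  drop_poly j (subquo_repr x) *: l = drop_poly j p *: l.
Proof.
move=> jp ->; apply: kills_eq.
have jc : (j <= c)%N by rewrite cE leq_addl.
by have := drop_poly_dvd jc (subquo_classK c jp); rewrite cE addnK.
Qed.

Lemma untwist_bilinear : is_bilinear id_P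
  (fun x : subquo k j c * L => drop_poly j (subquo_repr x.1) *: x.2).
Proof.
split=> [u v n|u n p|a u n|b u n] /=.
- rewrite (@untwist_rep _ (subquo_repr u + subquo_repr v)).
  + by rewrite drop_polyD scalerDl.
  + by rewrite dvdp_add ?subquo_reprP.
  + by rewrite subquo_classD ?subquo_reprP // !subquo_reprK.
- by rewrite scalerDr.
- rewrite (@untwist_rep _ (a * subquo_repr u)).
  + by rewrite drop_polyMr ?subquo_reprP // scalerA mulrC.
  + by rewrite dvdp_mull ?subquo_reprP.
  + by rewrite subquo_classZ ?subquo_reprP // subquo_reprK.
- by rewrite !scalerA mulrC.
Qed.

Lemma untwist_linear : linear (@untwist j c L).
Proof. exact: tens_lift_linear (untwist_bilinear). Qed.

Lemma untwistE (x : subquo k j c) (l : L) :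
  untwist (tens id_P x l) = drop_poly j (subquo_repr x) *: l.
Proof. exact: tens_liftE (untwist_bilinear). Qed.

Lemma untwist_class (p : P) (l : L) : 'X^j %| p ->
  untwist (tens id_P (subquo_class j c p) l) = drop_poly j p *: l.
Proof. by move=> jp; rewrite untwistE (untwist_rep _ jp). Qed.

Lemma tens_generator (x : subquo k j c) (l : L) :
  tens id_P x l =
  tens id_P (subquo_class j c 'X^j) (drop_poly j (subquo_repr x) *: l).
Proof.
rewrite -[drop_poly _ _ in RHS]/(id_P _) -tensZl -subquo_classZ ?dvdpp //.
by rewrite -dvdp_Xn_drop ?subquo_reprP // subquo_reprK.
Qed.

Lemma untwistK :
  cancel (@untwist j c L) (tens id_P (subquo_class j c 'X^j)).
Proof.
apply: (@tens_ext _ _ _ _ _ _ (fun t => tens id_P _ (untwist t)) idfun) => //.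
  by move=> a u v; rewrite untwist_linear tensDr tensZr.
by move=> x l; rewrite untwistE -tens_generator.
Qed.

Lemma tens_untwistK :
  cancel (tens id_P (subquo_class j c 'X^j)) (@untwist j c L).
Proof.
move=> l; rewrite untwist_class ?dvdpp //.
by rewrite -['X^j]mul1r drop_polyMXn_id scale1r.
Qed.
End Untwist.
Arguments untwist {k j c L}.

(** * Untwisting the composite of the maps psi *)

Section PsiChain.
Variables (k : fieldType) (r m : nat).
Local Notation P := {poly k}.
Local Notation N := (m * r - r).+1.
Local Notation id_P := (idfun : {rmorphism P -> P}).

Section Twist.
Variables (j : nat) (L : lmodType P).

Definition twist_gen (p : subquo k 1 N.+1) (q : subquo k j (N + j)) (l : L) :=
  tens id_P (subquo_class j.+1 (N + j.+1) (subquo_repr p * subquo_repr q)) l.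

Lemma dvdp_XnM (a b c : nat) (p q : P) : c = (a + b)%N ->
  'X^a %| p -> 'X^b %| q -> 'X^c %| p * q.
Proof. by move=> -> ap bq; rewrite exprD dvdp_mul. Qed.

Lemma dvdp_XSn (p q : P) : 'X^1 %| p -> 'X^j %| q -> 'X^(j.+1) %| p * q.
Proof. by apply: dvdp_XnM; rewrite add1n. Qed.

(** Independence of representatives: p is known modulo w^(N+1) and q modulo w^(N+j), while w divides
    p and w^j divides q, so the product is known modulo w^(N+j+1). *)
Lemma twist_gen_rep p (q : subquo k j (N + j)) (p' q' : P) (l : L) :
  'X^1 %| p' -> 'X^j %| q' -> p = subquo_class 1 N.+1 p' ->
  q = subquo_class j (N + j) q' ->
  twist_gen p q l = tens id_P (subquo_class j.+1 (N + j.+1) (p' * q')) l.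
Proof.
move=> p1 qj -> ->; rewrite /twist_gen.
set p2 := subquo_repr _; set q2 := subquo_repr _.
have p2P : 'X^1 %| p2 by exact: subquo_reprP.
have q2P : 'X^j %| q2 by exact: subquo_reprP.
suff -> : subquo_class j.+1 (N + j.+1) (p2 * q2) =
          subquo_class j.+1 (N + j.+1) (p' * q') by [].
apply: (iffRL (subquo_classP _ _ _)); [exact: dvdp_XSn..|].
have -> : p2 * q2 - p' * q' = p2 * (q2 - q') + (p2 - p') * q' by ring.
apply: dvdp_add.
  apply: (dvdp_XnM _ p2P (subquo_classK _ qj)).
  by rewrite add1n addnS.
apply: (dvdp_XnM _ (subquo_classK _ p1) qj).
by rewrite addSn addnS.
Qed.

Lemma twist_gen_addl p (u v : subquo k j (N + j)) l :
  twist_gen p (u + v) l = twist_gen p u l + twist_gen p v l.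
Proof.
have pP := subquo_reprP p; have uP := subquo_reprP u; have vP := subquo_reprP v.
rewrite (@twist_gen_rep p (u + v) (subquo_repr p) (subquo_repr u + subquo_repr v) l pP).
- by rewrite mulrDr subquo_classD; [exact: tensDl|exact: dvdp_XSn..].
- exact: dvdp_add.
- by rewrite subquo_reprK.
- by rewrite subquo_classD // !subquo_reprK.
Qed.

Lemma twist_gen_scale p a (u : subquo k j (N + j)) l :
  twist_gen p (a *: u) l = a *: twist_gen p u l.
Proof.
have pP := subquo_reprP p; have uP := subquo_reprP u.
rewrite (@twist_gen_rep p (a *: u) (subquo_repr p) (a * subquo_repr u) l pP).
- by rewrite mulrCA subquo_classZ; [rewrite tensZl tensZr|exact: dvdp_XSn].
- exact: dvdp_mull.
- by rewrite subquo_reprK.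
- by rewrite subquo_classZ // subquo_reprK.
Qed.

Lemma twist_gen_linear_l (u : subquo k j (N + j)) l :
  linear (fun p => twist_gen p u l).
Proof.
move=> a p q /=.
have pP := subquo_reprP p; have qP := subquo_reprP q; have uP := subquo_reprP u.
rewrite (@twist_gen_rep (a *: p + q) u (a * subquo_repr p + subquo_repr q)
  (subquo_repr u) l).
- rewrite mulrDl -mulrA subquo_classD; [|exact/dvdp_mull/dvdp_XSn|exact: dvdp_XSn].
  by rewrite subquo_classZ; [rewrite tensDl tensZl tensZr|exact: dvdp_XSn].
- by apply: dvdp_add => //; exact: dvdp_mull.
- by [].
- rewrite subquo_classD //; last exact: dvdp_mull.
  by rewrite subquo_classZ // !subquo_reprK.
- by rewrite subquo_reprK.
Qed.

Lemma twist_bilinear p : is_bilinear id_P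
  (fun x : subquo k j (N + j) * L => twist_gen p x.1 x.2).
Proof.
split=> [u v n|u n p'|a u n|b u n] /=.
- exact: twist_gen_addl.
- exact: tensDr.
- by rewrite twist_gen_scale [in RHS]/twist_gen tensZr.
- exact: tensZr.
Qed.

Lemma twist_map_linear p : linear (@twist_map k r m j L p).
Proof. exact: tens_lift_linear (twist_bilinear p). Qed.

Lemma twist_mapE p q (l : L) : twist_map p (tens id_P q l) = twist_gen p q l.
Proof. exact: tens_liftE (twist_bilinear p). Qed.

Lemma twist_map_linear_l t : linear (fun p => @twist_map k r m j L p t).
Proof.
move=> a p p' /=; move: t; apply: tens_ext => [|b u v|q l].
- exact: twist_map_linear.
- rewrite !(twist_map_linear _ b u v) scalerDr !scalerA addrACA mulrC.
  by rewrite -!scalerA -scalerDr.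
- by rewrite !twist_mapE; exact: twist_gen_linear_l.
Qed.
End Twist.

Lemma untwist_twist j (L : lmodType P) (p : subquo k 1 N.+1)
    (t : tensor id_P (subquo k j (N + j)) L) : kills 'X^N L ->
  untwist (twist_map p t) = drop_poly 1 (subquo_repr p) *: untwist t.
Proof.
move=> LN; move: t; have uL j' c e := @untwist_linear k N L LN j' c e.
apply: (@tens_ext _ _ _ _ _ _ (fun t => untwist (twist_map p t))
  (fun t => drop_poly 1 (subquo_repr p) *: untwist t)) => [a u v|a u v|q l].
- rewrite (twist_map_linear p a u v).
  exact: (uL j.+1 _ erefl a (twist_map p u) (twist_map p v)).
- by rewrite (uL j _ erefl a u v) scalerDr !scalerA mulrC.
have pP := subquo_reprP p; have qP := subquo_reprP q.
rewrite twist_mapE /twist_gen (untwist_class LN erefl _ (dvdp_XSn pP qP)).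
rewrite (untwistE LN erefl) scalerA; congr (_ *: _).
rewrite {1}(dvdp_Xn_drop pP) {1}(dvdp_Xn_drop qP).
by rewrite mulrACA -exprD add1n drop_polyMXn_id.
Qed.

Fixpoint rho_chain (L : nat -> lmodType P) (rho : forall j, L j.+1 -> L j)
    (j : nat) : L j -> L 0%N :=
  match j with
  | 0 => fun l => l
  | j'.+1 => fun l => rho_chain rho (rho j' l)
  end.

Lemma rho_chain_linear (L : nat -> lmodType P)
    (rho : forall j, L j.+1 -> L j) n : (forall j, (j < n)%N -> linear (rho j)) ->
  linear (@rho_chain L rho n).
Proof.
elim: n => [//|n IH] lin a u v /=.
by rewrite lin ?IH // => j jn; apply: lin; rewrite ltnS ltnW.
Qed.

Lemma rho_chain_surj (L : nat -> lmodType P)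
    (rho : forall j, L j.+1 -> L j) n :
  (forall j, (j < n)%N -> forall l, exists l', rho j l' = l) ->
  forall l, exists l', @rho_chain L rho n l' = l.
Proof.
elim: n => [|n IH] surj l /=; first by exists l.
have [l1 <-] := IH (fun j jn => surj j (ltnW jn)) l.
by have [l2 <-] := surj n (ltnSn n) l1; exists l2.
Qed.

Section Chain.
Variable L : nat -> lmodType P.
Variable psi : forall j, {linear L j.+1 ->
  tensor id_P (subquo k 1 N.+1) (L j)}.

Lemma twist_chain_bilinear j : linear (@psi_chain k r m L psi j) ->
  is_bilinear id_P (fun x : subquo k 1 N.+1 * L j =>
    twist_map x.1 (psi_chain psi x.2)).
Proof.
move=> lin.
have tl p := @twist_map_linear j (L 0%N) p.
have tr t := @twist_map_linear_l j (L 0%N) t.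
split=> [p p' l|p l l'|b p l|b p l] /=.
- exact: (linD (tr (psi_chain psi l)) p p').
- by rewrite (linD lin l l'); exact: (linD (tl p)).
- rewrite (linZ lin b l) (linZ (tr (psi_chain psi l)) b p).
  by rewrite (linZ (tl p) b _).
- by rewrite (linZ lin b l) (linZ (tl p) b _).
Qed.

Lemma psi_chain_linear j : linear (@psi_chain k r m L psi j).
Proof.
elim: j => [|j IH] a u v; first by rewrite /= tensDr tensZr.
rewrite [LHS]/= linearP; apply: tens_lift_linear.
exact: twist_chain_bilinear.
Qed.

(** Dividing by w^j at the end amounts to dividing by w at every stage. The composite of the psi
    thus becomes an ordinary composite of maps L_(i+1) -> L_i without tensor products. *)
Lemma untwist_psi_chain j (l : L j) :
  (forall i, (i <= j)%N -> kills 'X^N (L i)) ->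
  untwist (psi_chain psi l) = rho_chain (fun i l => untwist (psi i l)) l.
Proof.
elim: j l => [|j IH] l LN.
  rewrite [LHS]/= (untwist_class (LN 0%N (leqnn 0)) erefl) ?expr0 ?dvd1p //.
  by rewrite drop_poly0l scale1r.
have LN' i : (i <= j)%N -> kills 'X^N (L i) by move=> ij; apply/LN/leqW.
rewrite [LHS]/= [RHS]/=; move: (psi j l).
have N1 : N.+1 = (N + 1)%N by rewrite addn1.
have uL := @untwist_linear k N (L 0%N) (LN 0%N isT) j.+1 _ erefl.
have uL1 := @untwist_linear k N (L j) (LN' j (leqnn j)) 1 N.+1 N1.
have bil := twist_chain_bilinear (@psi_chain_linear j).
have tL := tens_lift_linear (g := fun p l => twist_map p (psi_chain psi l)) bil.
have rL : linear (@rho_chain L (fun i l => untwist (psi i l)) j).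
  apply: rho_chain_linear => i ij a u v; rewrite linearP.
  by apply: (untwist_linear (LN i (leqW (ltnW ij))) (_ : _ = N + 1)%N); rewrite addn1.
apply: (@tens_ext _ _ _ _ _ _ (fun t => untwist (tens_lift _ t))
  (fun t => @rho_chain L (fun i l => untwist (psi i l)) j (untwist t))) => [a u v|a u v|p l'].
- by rewrite (tL a u v) (uL a _ _).
- by rewrite (uL1 a u v) (rL a _ _).
rewrite (tens_liftE (g := fun p l => twist_map p (psi_chain psi l)) _ _ bil) untwist_twist ?IH //; last exact: LN.
rewrite (untwistE (LN' j (leqnn j)) N1).
by rewrite (linZ rL).
Qed.
End Chain.
End PsiChain.

(** * Adapted identifications *)

Section Decimation.
Variables (k : fieldType) (r : nat).
Hypothesis r_gt0 : (0 < r)%N.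
Local Notation P := {poly k}.
Local Notation zw := (z_to_w k r).

(* [q = \sum_(j < r) zw (tau j q) * 'X^j] *)
Definition tau (j : nat) (q : P) : P := \poly_(i < size q) q`_(r * i + j).

Lemma coef_tau j q i : (tau j q)`_i = q`_(r * i + j).
Proof.
rewrite coef_poly; case: ltnP => // sz; rewrite nth_default //.
by apply: leq_trans sz _; rewrite (leq_trans _ (leq_addr _ _)) // leq_pmull.
Qed.

Lemma zw_C c : zw c%:P = c%:P.
Proof. exact: comp_polyC. Qed.

Lemma zw_X : zw 'X = 'X^r.
Proof. exact: comp_polyX. Qed.

Lemma zw_Xn n : zw 'X^n = 'X^(r * n).
Proof. by rewrite rmorphXn /= zw_X exprM. Qed.

Lemma tau_additive j p q : tau j (p + q) = tau j p + tau j q.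
Proof. by apply/polyP=> i; rewrite coefD !coef_tau coefD. Qed.

Lemma tau_zw j (p q : P) : (j < r)%N -> tau j (zw p * q) = p * tau j q.
Proof.
move=> jr; elim/poly_ind: p q => [|p c IH] q.
  rewrite rmorph0 !mul0r.
  by apply/polyP=> i; rewrite coef_tau !coef0.
rewrite rmorphD rmorphM /= zw_X zw_C mulrDl mulrDl tau_additive -!mulrA IH.
congr (_ * _ + _); apply/polyP=> i; last by rewrite coef_tau !coefCM coef_tau.
rewrite coef_tau mulrC coefMXn mulrC coefMX; case: i => [|i] /=.
  by rewrite muln0 add0n jr.
rewrite ltnNge (leq_trans _ (leq_addr _ _)) /= ?leq_pmulr // coef_tau.
by rewrite mulnS -addnA addKn.
Qed.

Lemma tau_Xn j n : (j < r)%N ->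
  tau j 'X^n = if (n %% r)%N == j then 'X^(n %/ r)%N else 0.
Proof.
move=> jr; rewrite {1}(divn_eq n r) exprD mulnC -zw_Xn tau_zw //.
have -> : tau j 'X^(n %% r)%N = ((n %% r)%N == j)%:R%:P.
  apply/polyP=> i; rewrite coef_tau coefXn coefC.
  case: i => [|i] /=; first by rewrite muln0 add0n eq_sym.
  rewrite (gtn_eqF _) // (leq_trans (ltn_pmod n r_gt0)) //.
  by rewrite mulnS -addnA leq_addr.
by case: eqP => _; rewrite ?mulr1 ?mulr0.
Qed.
End Decimation.

Section Adapted.
Variables (k : fieldType) (r m : nat) (nu : nat -> {poly k}).
Local Notation P := {poly k}.
Local Notation N := (m * r - r).+1.
Local Notation zw := (z_to_w k r).
Local Notation Pz := (restr zw (P^o : lmodType P)).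
Variables (M : lmodType P) (A : M -> M).

(* An identification of M with k[w]/(w^(mr)) which matches A with nabla_nu   *)
(* up to terms raising the w-adic order by N = mr - r + 1.                   *)
Definition adapted (eps : {linear Pz -> M}) : Prop :=
  [/\ forall v, exists q : P, v = eps q,
      forall q : P, eps q = 0 <-> 'X^(m * r) %| q
    & forall j (q : P), (j < r)%N -> exists h : P,
        A (eps ('X^j * q)) = eps ('X^j * (nu_shift r m nu j * q + 'X^N * h))].

Lemma epsZ (eps : {linear Pz -> M}) (p q : P) : eps (zw p * q) = p *: eps q.
Proof. exact: (linearZZ eps p (q : Pz)). Qed.

Lemma epsCX (eps : {linear Pz -> M}) (j : nat) (q : P) :
  eps ('X^j * q) = \sum_(i < size q) (q`_i)%:P *: eps 'X^(j + i).
Proof.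
rewrite -{1}[q]coefK poly_def mulr_sumr linear_sum; apply: eq_bigr => i _.
rewrite -epsZ zw_C; congr (eps _).
by rewrite -mul_polyC mulrCA -exprD.
Qed.

Section FromQuotients.
Hypothesis r_gt0 : (0 < r)%N.
Hypothesis M_killed : forall v : M, 'X^m *: v = 0.
Hypothesis M_torsion : forall i (v : M), (i < m)%N -> 'X^i *: v = 0 ->
  exists u, v = 'X *: u.
Variables (V : filtration r A) (L : lmodType P) (l : L) (Pi : nat -> M -> L).
Local Notation in_V j v := (v \in smem (V j)).
Hypothesis l_gen : forall x : L, exists f : P, x = f *: l.
Hypothesis l_ann : forall f : P, f *: l = 0 -> 'X^N %| f.
Hypothesis PiD : forall j, (j < r)%N -> forall u v : M, in_V j u -> in_V j v ->
  Pi j (u + v) = Pi j u + Pi j v.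
Hypothesis PiZ : forall j, (j < r)%N -> forall (p : P) (v : M), in_V j v ->
  Pi j (p *: v) = zw p *: Pi j v.
Hypothesis Pi_gen : forall j, (j < r)%N -> exists2 v, in_V j v & Pi j v = l.
Hypothesis Pi_incl : forall j, (j.+1 < r)%N -> forall v, in_V j.+1 v ->
  Pi j v = 'X *: Pi j.+1 v.
Hypothesis Pi_z : forall v, Pi r.-1 ('X *: v) = 'X *: Pi 0%N v.
Hypothesis Pi_conn : forall j, (j < r)%N -> forall v, in_V j v ->
  Pi j (A v) = nu_shift r m nu j *: Pi j v.

Let V0 v : in_V 0%N v.
Proof. by have h : (v \in smem (V 0%N)) = predT v := fil_0 V v; rewrite h. Qed.

Let V_r v : in_V r v <-> exists u, v = 'X *: u.
Proof.
have -> : (v \in smem (V r)) = (v \in smem (scaled ('X : P) (V 0%N))).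
  exact: (fil_r V v).
split=> [/scaledP[u _ ->]|[u ->]].
  by exists u.
by apply/scaledP; exists u => //; exact: V0.
Qed.

Let V_sub i j v : (i <= j <= r)%N -> in_V j v -> in_V i v.
Proof.
case/andP; elim: j => [|j IH]; first by rewrite leqn0 => /eqP->.
rewrite leq_eqVlt => /orP[/eqP->//|ij] jr Vv.
by apply: IH => //; [exact: ltnW|exact: (fil_sub jr Vv)].
Qed.

Let Pi_sub i j v : (i <= j < r)%N -> in_V j v -> Pi i v = 'X^(j - i) *: Pi j v.
Proof.
case/andP; elim: j => [|j IH].
  by rewrite leqn0 => /eqP->; rewrite subnn expr0 scale1r.
rewrite leq_eqVlt => /orP[/eqP<-|ij] jr Vv; first by rewrite subnn expr0 scale1r.
rewrite IH //; [|exact: ltnW|exact: (fil_sub (ltnW jr) Vv)].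
by rewrite Pi_incl // scalerA -exprSr subSn.
Qed.

Let Pi_r j v : (j < r)%N -> Pi j ('X *: v) = 'X^(r - j) *: Pi 0%N v.
Proof.
move=> jr; have r1 : r.-1.+1 = r by rewrite prednK.
have jr1 : (j <= r.-1)%N by rewrite -ltnS r1.
rewrite (@Pi_sub j r.-1); [|by rewrite jr1 -{2}r1 /=|].
  by rewrite Pi_z scalerA -exprSr -subSn // r1.
apply: (@V_sub _ r); first by rewrite leq_pred leqnn.
by apply/V_r; exists v.
Qed.

(** The constant term is 1 and N > 0; as w^N generates the annihilator of l, this says that l is not
    in wL. *)
Let unit_not_X (p : P) : ~ 'X^N %| 1 - 'X * p.
Proof.
move/dvdp_XnP/(_ 0%N isT)/eqP.
by rewrite coefB coef1 coefXM subr0 /= oner_eq0.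
Qed.

(** A lift to V_j of the generator l, destined to be the image of w^j; the default 0 only fills the
    indices j >= r. *)
Let e j : M := if (j < r)%N =P true is ReflectT jr then
  projT1 (cid2 (Pi_gen jr)) else 0.
Let eP j : (j < r)%N -> in_V j (e j) /\ Pi j (e j) = l.
Proof. by move=> jr; rewrite /e; case: eqP => // p; case: cid2. Qed.

Let eps_fun (q : Pz) : M := \sum_(j < r) tau r j q *: e j.
Let eps_linear : linear eps_fun.
Proof.
move=> a u v; rewrite /eps_fun scaler_sumr -big_split; apply: eq_bigr => j _ /=.
by rewrite -[a *: u]/(zw a * u) tau_additive // tau_zw // scalerDl scalerA.
Qed.

Let eps_Xn (f : Pz -> M) (fE : f =1 eps_fun) n :
  f 'X^n = 'X^(n %/ r)%N *: e (n %% r)%N.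
Proof.
have nr : (n %% r < r)%N by rewrite ltn_pmod.
rewrite fE /eps_fun (bigD1 (Ordinal nr)) //= tau_Xn // eqxx big1 ?addr0 //.
move=> j jn; rewrite tau_Xn // ifN ?scale0r //.
by apply: contraNneq jn => jE; apply/eqP/val_inj.
Qed.

Let Pi_succ v j : (j < r)%N -> in_V j.+1 v ->
  exists f : P, Pi j v = 'X *: (f *: l).
Proof.
move=> jr; have [j1r|] := ltnP j.+1 r => [Vv|rj].
  by have [f fE] := l_gen (Pi j.+1 v); exists f; rewrite Pi_incl // fE.
have jE : j.+1 = r by apply/eqP; rewrite eqn_leq jr.
rewrite jE => /V_r[u ->]; have [f fE] := l_gen (Pi 0%N u).
by exists f; rewrite Pi_r // -jE subSnn expr1 fE.
Qed.

(** Sending w^(rq+j) to z^q e_j, the map Pi_j reads off q l from eps(w^j q). Hence Pi_j detects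
    polynomials modulo w^N, which gives the kernel and the shape of A, while surjectivity comes from
    the simplicity of V_j/V_(j+1). *)
Lemma adapted_from_quotients : exists eps, adapted eps.
Proof.
have [eps epsE] := linear_exists eps_linear; exists eps.
have Xn n : eps 'X^n = 'X^(n %/ r)%N *: e (n %% r)%N by exact: eps_Xn.
have Xj j : (j < r)%N -> eps 'X^j = e j.
  by move=> jr; rewrite Xn divn_small // modn_small // expr0 scale1r.
(* Let s = n mod r. If j <= s the inclusions V_s in V_j suffice; otherwise n >= r, and one factor z
   is spent to go through zV_0 = V_r. *)
have VX j n : (j < r)%N -> (j <= n)%N ->
    in_V j (eps 'X^n) /\ Pi j (eps 'X^n) = 'X^(n - j) *: l.
  move=> jr jn; rewrite Xn; set s := (n %% r)%N.
  have sr : (s < r)%N by rewrite ltn_pmod.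
  have nE := divn_eq n r; have [Ve Pe] := eP sr.
  have [js|sj] := leqP j s.
    have Vje : in_V j (e s) by apply: V_sub Ve; rewrite js ltnW.
    split; first by rewrite rpredZ.
    rewrite PiZ // (@Pi_sub j s) ?js // Pe zw_Xn scalerA -exprD; congr ('X^ _ *: _).
    by rewrite {2}nE mulnC addnBA.
  have q0 : (0 < n %/ r)%N.
    by rewrite lt0n; apply: contraTneq jn => q0; rewrite -ltnNge nE q0.
  rewrite -(prednK q0) exprSr -scalerA.
  have Vze : in_V j ('X *: e s).
    apply: (@V_sub _ r); first by rewrite ltnW ?leqnn.
    by apply/V_r; exists (e s).
  split; first by rewrite rpredZ.
  rewrite PiZ // Pi_r // (@Pi_sub 0 s) // subn0 Pe zw_Xn !scalerA -!exprD.
  congr ('X^ _ *: _); have := nE; rewrite -/s -{1}(prednK q0) mulSn mulnC => nE'.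
  by move: nE' jr; lia.
have VP j q : (j < r)%N ->
    in_V j (eps ('X^j * q)) /\ Pi j (eps ('X^j * q)) = q *: l.
  move=> jr; rewrite epsCX.
  have -> : q *: l = \sum_(i < size q) (q`_i)%:P *: ('X^i *: l).
    rewrite -{1}[q]coefK poly_def scaler_suml; apply: eq_bigr => i _.
    by rewrite scalerA mul_polyC.
  have P0 : Pi j 0 = 0.
    have := PiD jr (rpred0 (V j)) (rpred0 (V j)).
    by rewrite addr0 -{1}[Pi j 0]addr0 => /addrI.
  elim/big_rec2: _ => [|i x y _ [Vy Py]]; first by rewrite rpred0 P0.
  have [Vi Pii] := VX j (j + i)%N jr (leq_addr _ _).
  split; first by rewrite rpredD ?rpredZ.
  by rewrite PiD ?rpredZ // PiZ // zw_C Py Pii addKn.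
have l_neq (p : P) : l <> 'X *: (p *: l).
  move=> lE; apply: (@unit_not_X p); apply: l_ann.
  by rewrite scalerBl scale1r -scalerA -lE subrr.
(* Pi_j maps V_(j+1) into wL, which does not contain l = Pi_j(e_j); so e_j is nonzero in the simple
   module V_j/V_(j+1) and generates it. *)
have step j v : (j < r)%N -> in_V j v ->
    exists p, in_V j.+1 (v - eps (zw p * 'X^j)).
  move=> jr Vv; have [Ve Pe] := eP jr.
  have E p u : in_V j u -> qclass (subin (V j) (V j.+1)) (insub0 (V j) u) =
      p *: qclass (subin (V j) (V j.+1)) (insub0 (V j) (e j)) ->
      in_V j.+1 (u - p *: e j).
    move=> Vu; rewrite -linearZ => /qclassP.
    by rewrite unfold_in /subin_pred subvalB subvalZ !insub0K.
  have [|p pE] := length_one_gen (qclass _ (insub0 (V j) v)) (fil_length V jr)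
      (w := qclass _ (insub0 (V j) (e j))).
    rewrite -(scale0r (qclass _ (insub0 (V j) (e j)))) => /E -/(_ Ve).
    rewrite scale0r subr0 => /(Pi_succ jr)[f fE].
    by apply: (l_neq f); rewrite -fE Pe.
  by exists p; rewrite epsZ Xj //; exact: E.
(* Descend from V_j to V_r = zV_0, splitting off one multiple of e_i at each level. *)
have step_r d j v : (j + d)%N = r -> in_V j v ->
    exists (q : P) u, v = eps ('X^j * q) + 'X *: u.
  elim: d j v => [|d IH] j v jd.
    rewrite addn0 in jd; rewrite jd => /V_r[u ->].
    by exists 0, u; rewrite mulr0 linear0 add0r.
  have jr : (j < r)%N by rewrite -jd -addSnnS leq_addr.
  move/(step j v jr) => [p /IH]; rewrite addSnnS => /(_ jd)[q [u uE]].
  exists (zw p + 'X * q), u; rewrite mulrDr linearD /= mulrA -exprSr.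
  by rewrite -addrA -uE [_ * zw p]mulrC addrC subrK.
have step_m a v : exists (q : P) u, v = eps q + 'X^a *: u.
  elim: a v => [|a IH] v; first by exists 0, v; rewrite linear0 add0r scale1r.
  have [q [u ->]] := IH v; have [q' [u' ->]] := step_r r 0%N u erefl (V0 u).
  exists (q + zw 'X^a * ('X^0 * q')), u'; rewrite scalerDr [eps (_ + _)]linearD epsZ.
  by rewrite addrA scalerA -exprSr.
have surj v : exists q : P, v = eps q.
  by have [q [u ->]] := step_m m v; exists q; rewrite M_killed addr0.
split=> // [q|j q jr].
- split=> [q0|/dvdpP[h ->]]; last first.
    by rewrite mulrC mulnC -zw_Xn epsZ M_killed.
  (* Raise the order of q one step at a time. If q = w^a u, torsion puts eps(w^(a mod r) u) in zM,
     whose image under Pi is in wL; so the constant term of u vanishes. *)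
  suff: forall a, (a <= m * r)%N -> 'X^a %| q by apply.
  elim=> [|a IH] am; first by rewrite expr0 dvd1p.
  have /dvdpP[u uE] := IH (ltnW am); have sr : (a %% r < r)%N by rewrite ltn_pmod.
  have aE : 'X^a = zw 'X^(a %/ r)%N * 'X^(a %% r)%N.
    by rewrite zw_Xn -exprD mulnC -divn_eq.
  have : 'X^(a %/ r)%N *: eps ('X^(a %% r)%N * u) = 0.
    by rewrite -epsZ mulrA -aE mulrC -uE.
  move/M_torsion; rewrite ltn_divLR // => /(_ am)[u' u'E].
  have [_] := VP (a %% r)%N u sr; rewrite u'E Pi_r //.
  have [f ->] := l_gen (Pi 0%N u') => fE.
  have : 'X^N %| u - 'X * ('X^((r - a %% r).-1) * f).
    apply: l_ann; rewrite scalerBl -fE mulrA -exprS prednK ?subn_gt0 //.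
    by rewrite scalerA subrr.
  move/dvdp_XnP/(_ 0%N isT); rewrite coefB coefXM subr0 /= => u0.
  rewrite uE exprS dvdp_mul //; rewrite -['X]expr1.
  by apply/dvdp_XnP; case.
- have [Vv Pv] := VP j q jr; have [q' [u uE]] := step_r (r - j)%N j
    (A (eps ('X^j * q))) (subnKC (ltnW jr)) (fil_conn jr Vv).
  have [q2 q2E] := surj u.
  have AE : A (eps ('X^j * q)) = eps ('X^j * (q' + 'X^(r - j) * q2)).
    rewrite uE q2E mulrDr linearD /= mulrA -exprD subnKC ?(ltnW jr) //.
    by rewrite -(zw_X k r) epsZ.
  (* Both the polynomial representing A(eps(w^j q)) and nu_shift j * q have the same action on l, so
     they agree modulo w^N. *)
  have [_] := VP j (q' + 'X^(r - j) * q2) jr; rewrite -AE Pi_conn // Pv scalerA.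
  move=> hE; have : 'X^N %| q' + 'X^(r - j) * q2 - nu_shift r m nu j * q.
    by apply: l_ann; rewrite scalerBl hE subrr.
  case/dvdpP=> h /eqP; rewrite subr_eq => /eqP hE2.
  by exists h; rewrite AE hE2 addrC [h * _]mulrC.
Qed.
End FromQuotients.
End Adapted.

(** * From either structure to an adapted identification *)

Section FromPsi.
Variables (k : fieldType) (r m : nat) (nu : nat -> {poly k}).
Local Notation P := {poly k}.
Local Notation N := (m * r - r).+1.
Local Notation zw := (z_to_w k r).
Local Notation id_P := (idfun : {rmorphism P -> P}).
Variables (M : lmodType P) (A : M -> M).
Hypothesis r_gt0 : (0 < r)%N.
Hypothesis m_gt0 : (0 < m)%N.
Hypothesis M_killed : forall v : M, 'X^m *: v = 0.
Hypothesis M_torsion : forall i (v : M), (i < m)%N -> 'X^i *: v = 0 ->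
  exists u, v = 'X *: u.

Lemma mult_map_untwist (L : lmodType P)
    (t : tensor id_P (subquo k 1 N.+1) L) : kills 'X^N L ->
  mult_map t = 'X *: untwist t.
Proof.
move=> LN; have N1 : N.+1 = (N + 1)%N by rewrite addn1.
have E (p : subquo k 1 N.+1) (x : L) :
    subquo_repr p *: x = 'X *: (drop_poly 1 (subquo_repr p) *: x).
  by rewrite {1}(dvdp_Xn_drop (subquo_reprP p)) expr1 mulrC scalerA.
have [b1 b2 b3 b4] := untwist_bilinear LN N1.
have bil : is_bilinear id_P
    (fun x : subquo k 1 N.+1 * L => subquo_repr x.1 *: x.2).
  split=> [u v n|u n p|a u n|b u n]; rewrite !E.
  - by rewrite (b1 u v n) scalerDr.
  - by rewrite (b2 u n p) scalerDr.
  - by rewrite (b3 a u n).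
  - by rewrite (b4 b u n); exact: scaler_swap.
have uL := untwist_linear LN N1.
pose g (p : subquo k 1 N.+1) (x : L) := subquo_repr p *: x.
have mL := tens_lift_linear (g := g) bil.
move: t; apply: (@tens_ext _ _ _ _ _ _ (@mult_map k 1 N.+1 L)
  (fun t => 'X *: untwist t)) => [|a u v|p x].
- exact: mL.
- by rewrite (uL a u v) scalerDr; congr (_ + _); exact: scaler_swap.
- by rewrite (untwistE LN N1) -E; exact: (tens_liftE (g := g) _ _ bil).
Qed.

Variable V : filtration r A.
Local Notation in_V j v := (v \in smem (V j)).
Variables (L : nat -> lmodType P) (pi : forall j, sub (V j) -> L j).
Variable psi : forall j, {linear L j.+1 ->
  tensor id_P (subquo k 1 N.+1) (L j)}.
Hypothesis L_killed : forall j, (j < r)%N -> kills 'X^N (L j).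
Hypothesis psi_bij : forall j, (j.+1 < r)%N -> bijective (psi j).
Hypothesis piD : forall j, (j < r)%N -> forall u v : sub (V j),
  pi (u + v) = pi u + pi v.
Hypothesis piZ : forall j, (j < r)%N -> forall (p : P) (v : sub (V j)),
  pi (p *: v) = zw p *: pi v.
Hypothesis pi_surj : forall j, (j < r)%N -> forall x : L j, exists v, pi v = x.
Hypothesis pi_incl : forall j, (j.+1 < r)%N -> forall v : sub (V j.+1),
  pi (fil_incl v) = mult_map (psi j (pi v)).
Hypothesis pi_z : forall v : sub (V 0%N), exists q : P,
  [/\ 'X^(r.-1) %| q, 'X^(m * r) %| q - 'X^r
    & psi_chain psi (pi (insub0 (V r.-1) ('X *: val v)))
      = tens id_P (subquo_class r.-1 (N + r.-1) q) (pi v)].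
Hypothesis pi_conn : forall j, (j < r)%N -> forall v : sub (V j),
  pi (fil_A v) = nu_shift r m nu j *: pi v.
Variable l : L 0%N.
Hypothesis l_gen : forall x : L 0%N, exists f : P, x = f *: l.
Hypothesis l_ann : forall f : P, f *: l = 0 -> 'X^N %| f.

Let rho j (x : L j.+1) : L j := untwist (psi j x).
Arguments rho : clear implicits.
Let N1 : N.+1 = (N + 1)%N. Proof. by rewrite addn1. Qed.

Let rho_linear j : (j < r)%N -> linear (rho j).
Proof.
by move=> jr a u v; rewrite /rho linearP; exact: (untwist_linear (L_killed jr) N1).
Qed.

Let rho_bij j : (j.+1 < r)%N -> bijective (rho j).
Proof.
move=> jr; have Lk := L_killed (ltnW jr); have [g gK Kg] := psi_bij jr.
exists (fun x => g (tens id_P (subquo_class 1 N.+1 'X^1) x)) => x.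
  by rewrite /rho (untwistK Lk N1) gK.
by rewrite /rho Kg (tens_untwistK Lk N1).
Qed.

Let chain j (x : L j) : L 0%N := rho_chain rho x.
Arguments chain : clear implicits.
Let chain_linear j : (j < r)%N -> linear (chain j).
Proof. by move=> jr; apply: rho_chain_linear => i ij; apply/rho_linear/(ltn_trans ij). Qed.

Let Pi j (v : M) : L 0%N := chain j (pi (insub0 (V j) v)).

Let insubD j u v : in_V j u -> in_V j v ->
  insub0 (V j) (u + v) = insub0 (V j) u + insub0 (V j) v.
Proof.
by move=> Vu Vv; apply: val_inj; rewrite subvalD !insub0K ?rpredD.
Qed.
Let insubZ j p v : in_V j v -> insub0 (V j) (p *: v) = p *: insub0 (V j) v.
Proof. by move=> Vv; apply: val_inj; rewrite subvalZ !insub0K ?rpredZ. Qed.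

(** The untwisted psi_j are isomorphisms rho_j : L_(j+1) -> L_j, and their composites carry every
    pi_j to the single module L_0. The canonical map L_(j+1) -> L_j is w rho_j, so inclusions become
    multiplication by w; the condition on the whole chain says the same of z : V_0 -> V_(r-1). *)
Lemma adapted_from_psi : exists eps, @adapted k r m nu M A eps.
Proof.
apply: (@adapted_from_quotients k r m nu M A r_gt0 M_killed M_torsion V (L 0%N)
  l Pi l_gen l_ann).
- by move=> j jr u v Vu Vv; rewrite /Pi insubD // piD // (linD (chain_linear jr)).
- by move=> j jr p v Vv; rewrite /Pi insubZ // piZ // (linZ (chain_linear jr)).
- move=> j jr; have [x xl] : exists x, chain j x = l.
    apply: rho_chain_surj => i ij y.
    have [g _ gK] := rho_bij (leq_ltn_trans ij jr).
    by exists (g y).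
  have [v vx] := pi_surj jr x; exists (val v); first exact: subvalP.
  by rewrite /Pi insub0_val vx.
- move=> j jr v Vv; rewrite /Pi.
  have -> : insub0 (V j) v = fil_incl (insub0 (V j.+1) v).
    by rewrite /fil_incl insub0K.
  rewrite pi_incl // (mult_map_untwist _ (L_killed (ltnW jr))).
  by rewrite (linZ (chain_linear (ltnW jr))).
- move=> v; have V0 : in_V 0%N v.
    by have h : (v \in smem (V 0%N)) = predT v := fil_0 V v; rewrite h.
  have [q [q1 qr qE]] := pi_z (insub0 (V 0%N) v).
  rewrite insub0K // in qE; have r1 : r.-1.+1 = r by rewrite prednK.
  have Lk i : (i <= r.-1)%N -> kills 'X^N (L i).
    by move=> ir; apply: L_killed; rewrite -r1.
  rewrite /Pi /chain /rho -(untwist_psi_chain psi _ Lk) qE.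
  rewrite (untwist_class (Lk 0%N (leq0n _)) erefl _ q1) /=.
  apply: (kills_eq (Lk 0%N (leq0n _))).
  (* Dividing q = w^r modulo w^(mr) by w^(r-1) leaves w modulo w^(mr-r+1) = w^N, which is all that
     acts on L_0. *)
  have le : (r.-1 <= m * r)%N by rewrite (leq_trans (leq_pred r)) // leq_pmull.
  have := drop_poly_dvd le qr.
  have -> : (m * r - r.-1 = N)%N.
    by have := leq_pmull r m_gt0; move: r1; lia.
  suff -> : drop_poly r.-1 'X^r = 'X :> P by [].
  by rewrite -[X in 'X^X]r1 exprS drop_polyMXn_id.
- move=> j jr v Vv; rewrite /Pi.
  have -> : insub0 (V j) (A v) = fil_A (insub0 (V j) v).
    by rewrite /fil_A insub0K.
  by rewrite pi_conn // (linZ (chain_linear jr)).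
Qed.
End FromPsi.

Section FromStructures.
Variables (k : fieldType) (r m : nat) (nu : nat -> {poly k}).
Local Notation P := {poly k}.
Local Notation N := (m * r - r).+1.
Local Notation zw := (z_to_w k r).
Local Notation id_P := (idfun : {rmorphism P -> P}).
Variables (M : lmodType P) (A : M -> M).
Hypothesis r_gt1 : (1 < r)%N.
Hypothesis m_gt0 : (0 < m)%N.
Hypothesis M_killed : forall v : M, 'X^m *: v = 0.
Hypothesis M_torsion : forall i (v : M), (i < m)%N -> 'X^i *: v = 0 ->
  exists u, v = 'X *: u.

Let r_gt0 : (0 < r)%N. Proof. exact: ltnW. Qed.

Local Notation cl := (subquo_class 0 N).

Lemma Rw_classE (p : P) : cl p = 0 <-> 'X^N %| p.
Proof.
have c0 : cl (0 : P) = 0.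
  have h := @subquo_classZ k 0 N 0 0 (dvd1p (0 : P)).
  by rewrite mul0r in h; rewrite h scale0r.
by rewrite -c0 (@subquo_classP k 0 N p 0 (dvd1p p) (dvd1p 0)) subr0.
Qed.

Lemma Rw_class_gen (x : Rw k r m) : x = subquo_repr x *: (cl 1 : Rw k r m).
Proof. by rewrite -subquo_classZ ?expr0 ?dvd1p // mulr1 subquo_reprK. Qed.

Lemma Rw_killed : kills 'X^N (Rw k r m).
Proof.
move=> x; rewrite (Rw_class_gen x) scalerA -subquo_classZ ?expr0 ?dvd1p //.
by apply/Rw_classE; rewrite mulr1 dvdp_mulr.
Qed.

Lemma zX_repr : 'X^(m.+1) %| subquo_repr (subquo_class 1 m.+1 'X : subquo k 1 m.+1) - 'X.
Proof. by apply: subquo_classK; rewrite expr1. Qed.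

Lemma z_to_w_dvd n (p : P) : 'X^n %| p -> 'X^(n * r) %| zw p.
Proof.
case/dvdpP=> q ->; rewrite rmorphM dvdp_mull //.
by rewrite zw_Xn mulnC.
Qed.

Lemma z_to_w_zX : 'X^((m * r).+1) %|
  zw (subquo_repr (subquo_class 1 m.+1 'X : subquo k 1 m.+1)) - 'X^r.
Proof.
rewrite -(zw_X k r) -rmorphB; apply: dvdp_trans (z_to_w_dvd zX_repr).
by apply: dvdp_exp2l; rewrite mulSn addnC -addn1 leq_add2l.
Qed.

Lemma fil_zX (V : filtration r A) (v : sub (V 0%N)) :
  fil_z (subquo_class 1 m.+1 'X : subquo k 1 m.+1) v
  = insub0 (V r.-1) ('X *: val v).
Proof.
congr insub0; apply: (kills_eq M_killed); apply: dvdp_trans zX_repr.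
exact: dvdp_exp2l.
Qed.

(** Restricting pi_k to V_k, that is to the tensors v (x) 1, provides the maps of
    [adapted_from_psi]; L_0 is cyclic because it is free of rank one over R. *)
Lemma adapted_from_generic : generic_structure r m nu A ->
  exists eps, @adapted k r m nu M A eps.
Proof.
move=> gs; pose V := gs_fil gs; have [psi [psi_bij psi_mult psi_z]] := gs_psi gs.
pose pi j (v : sub (V j)) : gs_L gs j := gs_pi gs j (tens zw v (cl 1)).
have Lk j : (j < r)%N -> kills 'X^N (gs_L gs j).
  move=> jr x; have [f [g fK gK]] := gs_L_free gs jr.
  by rewrite -(gK x) -linearZ Rw_killed linear0.
have [f [g fK gK]] := gs_L_free gs r_gt0.
apply: (@adapted_from_psi k r m nu M A r_gt0 m_gt0 M_killed M_torsion V
  (gs_L gs) pi psi Lk psi_bij _ _ _ _ _ _ (f (cl 1))).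
- by move=> j jr u v; rewrite /pi tensDl linearD.
- by move=> j jr p v; rewrite /pi tensZl tensZr linearZ.
- by move=> j jr x; exact: gs_pi_V_surj.
- by move=> j jr v; rewrite psi_mult // gs_phi_pi.
(* The chain condition is applied to the class of z, whose representative is z modulo z^(m+1), hence
   w^r modulo w^(mr+1). *)
- move=> v; pose p := subquo_class 1 m.+1 'X : subquo k 1 m.+1.
  have zp : 'X^r %| zw (subquo_repr p).
    by have := z_to_w_dvd (subquo_reprP p); rewrite mul1n.
  have := psi_z (subquo_class r (m * r).+1 (zw (subquo_repr p))) (pi 0%N v).
  rewrite gs_phir_pi fil_zX => ->.
  eexists; split; last by reflexivity.
    apply: (dvdp_trans _ (subquo_reprP _)); apply: dvdp_exp2l.
    exact: leq_pred.
  set q := subquo_repr _.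
  have -> : q - 'X^r = q - zw (subquo_repr p) + (zw (subquo_repr p) - 'X^r).
    by rewrite addrA subrK.
  apply: (dvdp_trans (dvdp_exp2l _ (leqnSn _))).
  by apply: dvdp_add; [exact: subquo_classK|exact: z_to_w_zX].
- by move=> j jr v; rewrite /pi gs_pi_conn.
- by move=> x; exists (subquo_repr (g x)); rewrite -linearZ -Rw_class_gen gK.
- move=> p; rewrite -linearZ -subquo_classZ ?expr0 ?dvd1p // mulr1 => /eqP.
  rewrite -(linear0 f) (inj_eq (can_inj fK)) => /eqP.
  by move/Rw_classE.
Qed.
End FromStructures.

Section Endmod.
Variables (k : fieldType) (M : lmodType {poly k}) (N : {linear M -> M}).
Local Notation P := {poly k}.
Local Notation EN := (endmod N).

Lemma endmodX (v : EN) : 'X *: v = N v.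
Proof.
rewrite -[LHS]/(\sum_(i < size ('X : P)) (('X : P)`_i)%:P *: iter i N v : M).
by rewrite size_polyX !big_ord_recl big_ord0 /= !coefX scale0r scale1r add0r addr0.
Qed.

Lemma endmodC c (v : EN) : c%:P *: v = (c%:P *: (v : M) : M).
Proof.
rewrite -[LHS]/(\sum_(i < size (c%:P : P)) ((c%:P : P)`_i)%:P *: iter i N v : M).
rewrite size_polyC; case: eqP => [->|_] /=; first by rewrite big_ord0 scale0r.
by rewrite big_ord1 /= coefC.
Qed.

Lemma endmodXn n (v : EN) : 'X^n *: v = iter n N v.
Proof.
elim: n => [|n IH]; first by rewrite expr0 scale1r.
by rewrite exprS -scalerA endmodX IH.
Qed.

Lemma endmod_zw r : (forall v, iter r N v = 'X *: v) -> forall p (v : EN),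
  z_to_w k r p *: v = (p *: (v : M) : M).
Proof.
move=> Nr p; elim/poly_ind: p => [|p c IH] v.
  by rewrite rmorph0 scale0r -[RHS]/(0 *: (v : M) : M) scale0r.
rewrite rmorphD rmorphM /= zw_X zw_C scalerDl -scalerA endmodXn Nr.
rewrite -[LHS]/(z_to_w k r p *: ('X *: (v : M) : EN) + (c%:P *: v : EN) : M).
rewrite IH endmodC scalerA.
exact: (esym (scalerDl (v : M) (p * 'X) c%:P)).
Qed.
End Endmod.

Section FromFactorized.
Variables (k : fieldType) (r m : nat) (nu : nat -> {poly k}).
Local Notation P := {poly k}.
Local Notation N := (m * r - r).+1.
Local Notation zw := (z_to_w k r).
Local Notation id_P := (idfun : {rmorphism P -> P}).
Variables (M : lmodType P) (A : M -> M).
Hypothesis r_gt1 : (1 < r)%N.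
Hypothesis m_gt0 : (0 < m)%N.
Hypothesis M_killed : forall v : M, 'X^m *: v = 0.

Let r_gt0 : (0 < r)%N. Proof. exact: ltnW. Qed.

Section Reduction.
Variable V : filtration r A.

Lemma fil_inclK j (v : sub (V j.+1)) : (j < r)%N -> val (fil_incl v) = val v.
Proof. by move=> jr; rewrite insub0K //; apply: (fil_sub jr); exact: subvalP. Qed.

Lemma Vb_classP j (u v : sub (V j)) :
  Vb_class m u = Vb_class m v <->
  val u - val v \in smem (scaled ('X^(m.-1) : P) (V j.+1)).
Proof. by rewrite qclassP. Qed.

Lemma Vb_incl_class j (v : sub (V j.+1)) : (j.+1 < r)%N ->
  Vb_incl (Vb_class m v) = Vb_class m (fil_incl v).
Proof.
move=> jr; apply/Vb_classP; rewrite !fil_inclK ?(ltnW jr) //.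
have /Vb_classP/scaledP[u Vu ->] := qclass_repr (Vb_class m v).
by apply/scaledP; exists u => //; exact: (fil_sub jr).
Qed.

Lemma Vb_z_class (p : subquo k 1 m.+1) (v : sub (V 0%N)) :
  Vb_z p (Vb_class m v) = Vb_class m (fil_z p v).
Proof.
congr Vb_class; congr insub0.
have /Vb_classP/scaledP[u _ /eqP] := qclass_repr (Vb_class m v).
rewrite subr_eq => /eqP ->; rewrite scalerDr scalerA.
rewrite (dvdp_Xn_drop (subquo_reprP p)) -mulrA -exprD add1n prednK //.
by rewrite -scalerA M_killed scaler0 add0r.
Qed.
End Reduction.

Hypothesis M_torsion : forall i (v : M), (i < m)%N -> 'X^i *: v = 0 ->
  exists u, v = 'X *: u.

(** Here L_k is the reduction of V_k with w acting as N_k. Its cyclicity for k = 0 has to be proved,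
    by Nakayama's lemma for the nilpotent w. *)
Lemma adapted_from_factorized : factorized_structure r m nu A ->
  exists eps, @adapted k r m nu M A eps.
Proof.
move=> fs; pose V := fs_fil fs; have [psi [psi_bij psi_mult psi_z]] := fs_psi fs.
pose L j : lmodType P := endmod (fs_N fs j).
pose pi j (v : sub (V j)) : L j := Vb_class m v.
have Lk j : (j < r)%N -> kills 'X^N (L j).
  by move=> jr x; rewrite endmodXn; exact: (fs_N_nilp jr).
have piZ j : (j < r)%N -> forall (p : P) (v : sub (V j)),
    pi j (p *: v) = zw p *: pi j v.
  move=> jr p v; rewrite (endmod_zw (fs_N_r jr)) /pi.
  exact: (linearZZ (qclass (Vb_sub m V j))).
have piD j (u v : sub (V j)) : pi j (u + v) = pi j u + pi j v.
  exact: (raddfD (qclass (Vb_sub m V j))).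
have pi_surj j (x : L j) : exists v, pi j v = x.
  by have [v ->] := qclass_surj (x : Vb m V j); exists v.
have pi_incl j : (j.+1 < r)%N -> forall v : sub (V j.+1),
    pi j (fil_incl v) = mult_map (psi j (pi j.+1 v)).
  by move=> jr v; rewrite psi_mult // /pi Vb_incl_class.
have simple := fil_length V r_gt0.
have [w0 w0_neq0] := simple.1; have [v0 v0E] := qclass_surj w0.
(* V_0 is spanned by v0 and V_1, and the image of V_1 lies in wL_0 by the factorization through psi;
   so L_0 = k[w] v0 + wL_0, and iterating N times reaches w^N L_0 = 0. *)
have gen (x : L 0%N) : exists f : P, x = f *: pi 0%N v0.
  suff step n (y : L 0%N) : exists f z, y = f *: pi 0%N v0 + 'X^n *: z.
    by have [f [z ->]] := step N x; exists f; rewrite Lk // addr0.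
  elim: n => [|n [f [z ->]]].
    by exists 0, y; rewrite scale0r scale1r add0r.
  have [v <-] := pi_surj 0%N z.
  have [p pE] := length_one_gen (qclass _ v) simple (elimN eqP w0_neq0).
  move: pE; rewrite v0E -linearZ => /qclassP Vv.
  have {}Vv : val (v - p *: v0) \in smem (V 1%N) by [].
  exists (f + 'X^n * zw p).
  exists (untwist (psi 0%N (pi 1%N (insub0 (V 1%N) (val (v - p *: v0)))))).
  set u := insub0 _ _.
  have vE : v = p *: v0 + fil_incl u.
    apply: val_inj; rewrite (subvalD (p *: v0) (fil_incl u)) (fil_inclK u r_gt0).
    by rewrite (insub0K Vv) subvalB addrC subrK.
  have piE : pi 0%N v = zw p *: pi 0%N v0 + 'X *: untwist (psi 0%N (pi 1%N u)).
    rewrite -(mult_map_untwist _ (Lk 0%N r_gt0)) -(pi_incl 0%N r_gt1).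
    by rewrite -(piZ _ r_gt0) -piD -vE.
  by rewrite piE scalerDr !scalerA -exprSr scalerDl addrA.
apply: (@adapted_from_psi k r m nu M A r_gt0 m_gt0 M_killed M_torsion V
  L pi psi Lk psi_bij _ piZ _ pi_incl _ _ (pi 0%N v0) gen).
- by move=> j _; exact: piD.
- by move=> j _; exact: pi_surj.
- move=> v; pose p := subquo_class 1 m.+1 'X : subquo k 1 m.+1.
  have zp : 'X^r %| zw (subquo_repr p).
    by have := z_to_w_dvd r (subquo_reprP p); rewrite mul1n.
  exists (zw (subquo_repr p)); split.
  + by apply: dvdp_trans zp; apply: dvdp_exp2l; exact: leq_pred.
  + have h := @z_to_w_zX k r m r_gt1. exact: (dvdp_trans (dvdp_exp2l _ (leqnSn _)) h).
  + by rewrite -psi_z Vb_z_class fil_zX.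
- by move=> j jr v; exact: (fs_conn jr).
(* An f annihilating the generator annihilates all of L_0, so the injectivity of R -> End
   applies. *)
- move=> f f0; apply: (fs_N_inj r_gt0) => x.
  have [g ->] := gen x.
  by rewrite [_ *: _](@scaler_swap _ (L 0%N)) f0 scaler0.
Qed.
End FromFactorized.

(** * The w-adic filtration of an adapted identification *)

Section AdaptedFiltration.
Variables (k : fieldType) (r m : nat) (nu : nat -> {poly k}).
Local Notation P := {poly k}.
Local Notation N := (m * r - r).+1.
Local Notation zw := (z_to_w k r).
Local Notation Pz := (restr zw (P^o : lmodType P)).
Variables (M : lmodType P) (A : M -> M) (eps : {linear Pz -> M}).
Hypothesis r_gt0 : (0 < r)%N.
Hypothesis m_gt0 : (0 < m)%N.
Hypothesis eps_adapted : @adapted k r m nu M A eps.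

Definition image_pred (j : nat) : {pred M} :=
  fun v => `[< exists q : P, v = eps ('X^j * q) >].

Lemma image_closed j : submod_closed (image_pred j).
Proof.
split=> [|a u v /asboolP[p ->] /asboolP[q ->]]; apply/asboolP.
  by exists 0; rewrite mulr0 linear0.
exists (zw a * p + q); rewrite mulrDr linearD mulrCA.
by rewrite (epsZ eps a).
Qed.

Definition image_sub j := Submod (image_closed j).

Lemma imageP j v :
  reflect (exists q : P, v = eps ('X^j * q)) (v \in smem (image_sub j)).
Proof. exact: asboolP. Qed.

Lemma image_in j (q : P) : eps ('X^j * q) \in smem (image_sub j).
Proof. by apply/imageP; exists q. Qed.

Lemma eps_ker (q : P) : eps q = 0 <-> 'X^(m * r) %| q.
Proof. by case: eps_adapted. Qed.

Lemma eps_eq (p q : P) : eps p = eps q <-> 'X^(m * r) %| p - q.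
Proof.
rewrite -eps_ker [eps (p - q)](linearB eps).
by split=> [->|/eqP]; rewrite ?subrr // subr_eq0 => /eqP.
Qed.

Lemma r_le_mr : (r <= m * r)%N. Proof. by rewrite leq_pmull. Qed.

Lemma dvdp_XnM2l (a b : nat) (q : P) : (a <= b)%N ->
  'X^b %| 'X^a * q <-> 'X^(b - a) %| q.
Proof.
move=> ab; rewrite -{1}(subnKC ab) exprD dvdp_mul2l //.
by rewrite expf_neq0 // polyX_eq0.
Qed.

Lemma image_0 : smem (image_sub 0) =1 predT.
Proof.
move=> v; have [surj _ _] := eps_adapted; have [q ->] := surj v.
by apply/asboolP; exists q; rewrite expr0 mul1r.
Qed.

Lemma image_r : smem (image_sub r) =1 smem (scaled ('X : P) (image_sub 0)).
Proof.
move=> v; apply/idP/idP => [/asboolP[q ->]|/asboolP[u /imageP[q ->] ->]].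
  apply/asboolP; exists (eps ('X^0 * q)); first exact: image_in.
  by rewrite -epsZ zw_X expr0 mul1r.
by apply/asboolP; exists q; rewrite -epsZ zw_X expr0 mul1r.
Qed.

Lemma image_subset j : {subset smem (image_sub j.+1) <= smem (image_sub j)}.
Proof.
move=> v /imageP[q ->]; apply/imageP; exists ('X * q).
by rewrite exprSr mulrA.
Qed.

Lemma image_conn j : (j < r)%N -> forall v, v \in smem (image_sub j) ->
  A v \in smem (image_sub j).
Proof.
move=> jr v /imageP[q ->]; have [_ _ conn] := eps_adapted.
by have [h ->] := conn j q jr; exact: image_in.
Qed.

(** The coordinate q on V_j is taken relative to w^j, so that the inclusion of V_(j+1) in V_j is
    multiplication by w on coordinates. *)
Definition ceps (j : nat) (q : Pz) : sub (image_sub j) :=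
  insub0 (image_sub j) (eps ('X^j * (q : P))).

Lemma val_ceps j (q : P) : val (ceps j q) = eps ('X^j * q).
Proof. by rewrite insub0K // image_in. Qed.

Lemma ceps_linear j : linear (ceps j).
Proof.
move=> a u v; apply: val_inj.
rewrite subvalD subvalZ !val_ceps.
rewrite -[a *: u]/(zw a * u) mulrDr [LHS](linearD eps) mulrCA.
by rewrite (epsZ eps a).
Qed.

Lemma ceps_surj j (v : sub (image_sub j)) : exists q, v = ceps j q.
Proof.
have /imageP[q qE] := subvalP v.
by exists q; apply: val_inj; rewrite val_ceps.
Qed.

(** The class of eps(w^j q) in V_j/V_(j+1) vanishes exactly when w divides q, so the constant
    coefficient identifies this quotient with the ground field. *)
Lemma image_length j : (j < r)%N ->
  length_one (quot (subin (image_sub j) (image_sub j.+1))).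
Proof.
move=> jr; pose c q := qclass (subin (image_sub j) (image_sub j.+1)) (ceps j q).
have jmr : (j < m * r)%N := leq_trans jr r_le_mr.
have cE (q : P) : c q = 0 <-> 'X %| q.
  rewrite qclass_eq0 [X in is_true X]unfold_in /subin_pred val_ceps.
  split=> [/imageP[h /eps_eq]|/dvdpP[h ->]]; last first.
    by apply/imageP; exists h; rewrite [h * _]mulrC mulrA -exprSr.
  rewrite exprSr -mulrA -mulrBr (dvdp_XnM2l _ (ltnW jmr)) => d.
  rewrite -(subrK ('X * h) q) dvdp_add ?dvdp_mulIl //.
  apply: dvdp_trans d; rewrite -{1}['X]expr1 dvdp_exp2l // subn_gt0 //.
have clin : linear (c : Pz -> _).
  by move=> a u v; rewrite /c ceps_linear linearP.
split.
  exists (c 1); apply/eqP => /cE; rewrite -['X]expr1 => /dvdp_XnP/(_ 0%N isT).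
  by move/eqP; rewrite coef1 oner_eq0.
move=> S; have [[x [Sx x0]]|nex] := pselect (exists x, x \in smem S /\ x <> 0).
  right=> y; have [v] := qclass_surj x; have [q ->] := ceps_surj v => xE.
  have [u ->] := qclass_surj y; have [p ->] := ceps_surj u.
  have q0 : q`_0 != 0.
    apply/eqP => q0; apply: x0; rewrite xE; apply/cE.
    by rewrite -['X]expr1; apply/dvdp_XnP; case.
  have -> : qclass (subin (image_sub j) (image_sub j.+1)) (ceps j p)
      = (p`_0 / q`_0)%:P *: x.
    apply/eqP; rewrite -subr_eq0 xE -(linZ clin) -(linB clin).
    apply/eqP/cE; rewrite -['X]expr1; apply/dvdp_XnP; case=> // _.
    rewrite -[_ *: q]/(zw (p`_0 / q`_0)%:P * q) zw_C coefB coefCM.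
    by rewrite divfK // subrr.
  by change (is_true ((p`_0 / q`_0)%:P *: x \in smem S)); rewrite rpredZ.
by left=> v Sv; apply: contrapT => v0; apply: nex; exists v.
Qed.

Definition image_filtration : filtration r A :=
  Filtration image_0 image_r (fun j _ => @image_subset j) image_length image_conn.

Lemma image_incl j (q : P) : (j < r)%N ->
  @fil_incl k r M A image_filtration j (ceps j.+1 q) = ceps j ('X * q).
Proof.
by move=> jr; congr insub0; rewrite val_ceps exprSr -mulrA.
Qed.

Lemma image_A j (q : P) : (j < r)%N -> exists h : P,
  @fil_A k r M A image_filtration j (ceps j q)
  = ceps j (nu_shift r m nu j * q + 'X^N * h).
Proof.
move=> jr; have [_ _ conn] := eps_adapted.
have [h hE] := conn j q jr; exists h.
by congr insub0; rewrite val_ceps hE.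
Qed.

(** In coordinates relative to w^(r-1), multiplication by p(w^r) is multiplication by w times
    p(w^r)/w^r. *)
Lemma image_z (p : subquo k 1 m.+1) (q : P) :
  @fil_z k r m M A image_filtration p (ceps 0 q)
  = ceps r.-1 ('X * drop_poly r (zw (subquo_repr p)) * q).
Proof.
congr insub0; rewrite val_ceps expr0 mul1r -epsZ; congr (eps _).
have := z_to_w_dvd r (subquo_reprP p); rewrite mul1n => zp.
have Xr : 'X^r = 'X^(r.-1) * 'X :> P by rewrite -exprSr prednK.
rewrite {1}(dvdp_Xn_drop zp) Xr; move: (drop_poly _ _) => d; ring.
Qed.
End AdaptedFiltration.

(** * Structures from an adapted identification *)

Lemma tens_linear_exists (A B : comNzRingType) (f : {rmorphism A -> B}) (M : lmodType A)
    (N L : lmodType B) (u : M) (s : {linear L -> N}) :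
  exists F : {linear L -> tensor f M N}, forall l, F l = tens f u (s l).
Proof.
have [G GE] := linear_exists (tens_linear (N := N) f u).
by exists (G \o s : {linear L -> _}) => l; exact: GE.
Qed.

Section PsiFromSigma.
Variables (k : fieldType) (r m : nat).
Local Notation P := {poly k}.
Local Notation N := (m * r - r).+1.
Local Notation id_P := (idfun : {rmorphism P -> P}).
Variables (L : nat -> lmodType P) (n : nat).
Variable sigma : forall j, {linear L j.+1 -> L j}.
Hypothesis L_killed : forall j, (j < n)%N -> kills 'X^N (L j).

Lemma rho_chain_eq (rho rho' : forall j, L j.+1 -> L j) j (l : L j) :
  (forall i, (i < j)%N -> rho i =1 rho' i) ->
  rho_chain rho l = rho_chain rho' l.
Proof.
elim: j l => [//|j IH] l E /=; rewrite E //.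
by apply: IH => i ij; apply: E; exact: ltnW.
Qed.

(** Take psi_j(l) = w (x) sigma_j(l), whose untwisting is sigma_j. Since untwisting is injective,
    the chain condition can be checked on the composite of the sigma_j. *)
Lemma psi_from_sigma : exists psi : forall j, {linear L j.+1 ->
    tensor id_P (subquo k 1 N.+1) (L j)},
  [/\ forall j, (j < n)%N -> bijective (sigma j) -> bijective (psi j),
      forall j, (j < n)%N -> forall l, mult_map (psi j l) = 'X *: sigma j l
    & forall j (q : P) (l : L j) l', (j < n)%N -> 'X^j %| q ->
        rho_chain (fun i => sigma i) l = drop_poly j q *: l' ->
        psi_chain psi l = tens id_P (subquo_class j (N + j) q) l'].
Proof.
have N1 : N.+1 = (N + 1)%N by rewrite addn1.
have ex j : exists F : {linear L j.+1 -> tensor id_P (subquo k 1 N.+1) (L j)},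
    forall l, F l = tens id_P (subquo_class 1 N.+1 'X^1) (sigma j l).
  exact: tens_linear_exists.
pose psi j := projT1 (cid (ex j)).
have psiE j l : psi j l = tens id_P (subquo_class 1 N.+1 'X^1) (sigma j l).
  exact: (projT2 (cid (ex j))).
have uE j l : (j < n)%N -> untwist (psi j l) = sigma j l.
  by move=> jn; rewrite psiE (tens_untwistK (L_killed jn) N1).
exists psi; split=> [j jn [g gK Kg]|j jn l|j q l l' jn jq E].
- pose h (t : tensor id_P (subquo k 1 N.+1) (L j)) := g (untwist t).
  have hK : cancel (psi j) h by move=> x; rewrite /h uE // gK.
  have Kh : cancel h (psi j).
    move=> t; rewrite /h psiE Kg.
    exact: (untwistK (L_killed jn) N1).
  exact: Bijective hK Kh.
- by rewrite (mult_map_untwist _ (L_killed jn)) uE.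
have L0 := L_killed (leq_ltn_trans (leq0n j) jn).
apply: (can_inj (untwistK L0 erefl)).
rewrite (untwist_class L0 erefl _ jq) -E untwist_psi_chain.
  by apply: rho_chain_eq => i ij x; rewrite uE // (ltn_trans ij).
by move=> i ij; apply: L_killed; exact: leq_ltn_trans jn.
Qed.
End PsiFromSigma.

Section ToGeneric.
Variables (k : fieldType) (r m : nat) (nu : nat -> {poly k}).
Local Notation P := {poly k}.
Local Notation N := (m * r - r).+1.
Local Notation zw := (z_to_w k r).
Local Notation id_P := (idfun : {rmorphism P -> P}).
Local Notation Pz := (restr zw (P^o : lmodType P)).
Variables (M : lmodType P) (A : M -> M) (eps : {linear Pz -> M}).
Hypothesis r_gt0 : (0 < r)%N.
Hypothesis m_gt0 : (0 < m)%N.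
Hypothesis eps_adapted : @adapted k r m nu M A eps.

Local Notation V := (image_filtration m_gt0 eps_adapted).
Local Notation cl := (subquo_class 0 N).
Local Notation Rw := (Rw k r m).

Lemma subquo_repr_linear a b (c : P) (x y : subquo k a b) :
  'X^b %| subquo_repr (c *: x + y) - (c * subquo_repr x + subquo_repr y).
Proof.
have xP := subquo_reprP x; have yP := subquo_reprP y.
have cxP : 'X^a %| c * subquo_repr x by apply: dvdp_mull.
apply/(@subquo_classP k a b); rewrite ?subquo_reprP ?dvdp_add //.
by rewrite subquo_reprK subquo_classD // subquo_classZ // !subquo_reprK.
Qed.

Lemma repr_act_linear (L : lmodType P) (x : L) : kills 'X^N L ->
  linear (fun f : Rw => subquo_repr f *: x).
Proof.
move=> LN c f g /=; rewrite (kills_eq LN x (subquo_repr_linear c f g)).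
by rewrite scalerDl scalerA.
Qed.

(** The coordinate q of an element of V_j is determined modulo w^(mr-j), and mr - j >= N because j <
    r; so it has a class in R. *)
Lemma generic_pi_exists j : (j < r)%N ->
  exists F : {linear tensor zw (sub (V j)) Rw -> Rw},
    forall (q : P) (f : Rw), F (tens zw (ceps eps j q) f) = q *: f.
Proof.
move=> jr; have [c cE] := linear_exists (@ceps_linear k r M eps j).
have dlin : linear ((fun q : Pz => cl (q : P)) : Pz -> restr zw Rw).
  move=> a p q; rewrite -[a *: p]/(zw a * p).
  rewrite subquo_classD ?expr0 ?dvd1p // subquo_classZ ?expr0 ?dvd1p //.
have [d dE] := linear_exists dlin.
have [|q|F FE] := linear_factor (c := c) (d := d).
- by move=> v; have [q ->] := ceps_surj v; exists q; rewrite cE.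
- rewrite cE dE => /(congr1 val); rewrite val_ceps => /(eps_ker eps_adapted).
  rewrite dvdp_XnM2l; last by rewrite (leq_trans (ltnW jr)) // leq_pmull.
  move=> h; apply/Rw_classE; apply: dvdp_trans h; apply: dvdp_exp2l.
  by have := leq_pmull r m_gt0; lia.
have bil : is_bilinear zw
    (fun x : sub (V j) * Rw => subquo_repr x.2 *: (F x.1 : Rw)).
  have rl (v : sub (V j)) := @repr_act_linear Rw (F v) (@Rw_killed k r m).
  split=> [u v n|u n p|a u n|b u n] /=.
  - by rewrite linearD scalerDr.
  - exact: (linD (rl u)).
  - rewrite (linZ (rl u)) linearZ; exact: scaler_swap.
  - exact: (linZ (rl u)).
pose g (v : sub (V j)) (f : Rw) : Rw := subquo_repr f *: (F v : Rw).
have [G _ GE] := tens_lift_exists (g := g) bil.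
exists G => q f; rewrite GE /g -cE FE dE.
rewrite -[LHS]subquo_classZ ?expr0 ?dvd1p //.
by rewrite mulrC subquo_classZ ?expr0 ?dvd1p // subquo_reprK.
Qed.

Lemma rho_chain_id j (x : Rw) :
  @rho_chain k (fun=> Rw) (fun _ => idfun) j x = x.
Proof. by elim: j x => [//|j IH] x /=. Qed.

Lemma bij_idfun (L : lmodType P) : bijective (idfun : {linear L -> L}).
Proof. by exists id. Qed.

Lemma mulX_exists (L : lmodType P) :
  exists F : {linear L -> sub (scaled ('X : P) (full : submod L))},
    forall x, val (F x) = 'X *: x.
Proof.
have inX (x : L) : 'X *: x \in smem (scaled ('X : P) (full : submod L)).
  by apply/scaledP; exists x.
have [|F FE] := @linear_exists _ L _ (fun x => insub0 (scaled ('X : P) full) ('X *: x)).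
  move=> a x y; apply: val_inj; rewrite subvalD subvalZ !insub0K //.
  by rewrite scalerDr; congr (_ + _); exact: scaler_swap.
by exists F => x; rewrite FE insub0K.
Qed.

(** All L_k are R itself: pi_k sends eps(w^k q) (x) f to qf, phi_k is multiplication by w, and psi_k
    is l |-> w (x) l. *)
Lemma generic_from_adapted : inhabited (generic_structure r m nu A).
Proof.
have N1 : N.+1 = (N + 1)%N by rewrite addn1.
have Nr : (m * r).+1 = (N + r)%N.
  by rewrite addSn subnK // leq_pmull.
have Nr1 : (N + r.-1 = m * r)%N by have := leq_pmull r m_gt0; lia.
have Rk := @Rw_killed k r m.
have pi_ex j : exists F : {linear tensor zw (sub (V j)) Rw -> Rw},
    (j < r)%N -> forall (q : P) (f : Rw), F (tens zw (ceps eps j q) f) = q *: f.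
  have [jr|jr] := boolP (j < r)%N; last by exists \0%R.
  by have [F FE] := generic_pi_exists jr; exists F.
pose pi j := projT1 (cid (pi_ex j)).
have piE j : (j < r)%N -> forall (q : P) (f : Rw),
    pi j (tens zw (ceps eps j q) f) = q *: f.
  exact: projT2 (cid (pi_ex j)).
have [phi phiE] := mulX_exists Rw.
have [U UE] := linear_exists (untwist_linear Rk Nr).
have [phir phirE] : exists F : {linear
    tensor id_P (subquo k r (m * r).+1) Rw ->
    sub (scaled ('X : P) (full : submod Rw))},
    forall t, val (F t) = 'X *: untwist t.
  by exists (phi \o U) => t; rewrite /= phiE UE.
have ceps1 j (x : Rw) : (j < r)%N ->
    pi j (tens zw (ceps eps j (subquo_repr x)) (cl 1)) = x.
  by move=> jr; rewrite piE // -Rw_class_gen.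
have dropr (p : P) : 'X^r %| p -> drop_poly r.-1 p = 'X * drop_poly r p.
  move=> rp; have Xr : 'X^r = 'X * 'X^(r.-1) :> P by rewrite -exprS prednK.
  by rewrite {1}(dvdp_Xn_drop rp) Xr mulrA drop_polyMXn_id mulrC.
have pi_conn j : (j < r)%N -> forall (v : sub (V j)) (f : Rw),
    pi j (tens zw (fil_A v) f) = nu_shift r m nu j *: pi j (tens zw v f).
  move=> jr v f; have [q ->] := ceps_surj v.
  have [h ->] := image_A m_gt0 eps_adapted q jr.
  rewrite !piE // scalerA; apply: (kills_eq Rk).
  by rewrite addrC addKr dvdp_mulIl.
have phi_pi j : (j.+1 < r)%N -> forall (v : sub (V j.+1)) (f : Rw),
    val (phi (pi j.+1 (tens zw v f))) = pi j (tens zw (fil_incl v) f).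
  move=> jr v f; have [q ->] := ceps_surj v.
  by rewrite image_incl ?(ltnW jr) // !piE ?(ltnW jr) // phiE scalerA.
have phir_pi (p : subquo k 1 m.+1) (v : sub (V 0%N)) (f : Rw) :
    val (phir (tens id_P (subquo_class r (m * r).+1 (zw (subquo_repr p)))
                         (pi 0%N (tens zw v f))))
    = pi r.-1 (tens zw (fil_z p v) f).
  have [q ->] := ceps_surj v.
  have zp : 'X^r %| zw (subquo_repr p).
    by have := z_to_w_dvd r (subquo_reprP p); rewrite mul1n.
  rewrite image_z // (piE 0%N r_gt0) (piE r.-1) ?prednK //.
  rewrite phirE.
  by rewrite (untwist_class Rk Nr _ zp) -!scalerA.
have [psi [psi_bij psi_mult psi_z]] :=
  psi_from_sigma (n := r) (fun _ => idfun : {linear Rw -> Rw}) (fun j _ => Rk).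
constructor.
apply: (@GenericStructure k r m nu M A V (fun=> Rw) pi (fun=> phi) phir _ _ _
  pi_conn _ _ phi_pi phir_pi).
- by move=> j jr; exists idfun; exact: bij_idfun.
- by move=> j jr x; eexists; exact: ceps1.
- by move=> j jr x; eexists; exact: ceps1.
- move=> j jr l; have /scaledP[u _ uE] := subvalP l.
  by exists u; apply: val_inj; rewrite phiE.
- move=> l; have /scaledP[u _ uE] := subvalP l.
  exists (tens id_P (subquo_class r (m * r).+1 'X^r) u); apply: val_inj.
  by rewrite phirE (tens_untwistK Rk Nr).
exists psi; split=> [j jr|j jr l|p l].
- by apply: psi_bij; [exact: ltnW|exact: bij_idfun].
- by rewrite psi_mult ?(ltnW jr) // phiE.
apply: psi_z; first by rewrite prednK.
  apply: dvdp_trans (subquo_reprP p); apply: dvdp_exp2l; exact: leq_pred.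
rewrite rho_chain_id phirE (untwistE Rk Nr) (dropr _ (subquo_reprP p)).
by rewrite -scalerA.
Qed.
End ToGeneric.

(** * Self-duality of R over O_mx *)

Section Pairing.
Variables (k : fieldType) (r m : nat).
Hypothesis r_gt0 : (0 < r)%N.
Hypothesis m_gt0 : (0 < m)%N.
Local Notation P := {poly k}.
Local Notation N := (m * r - r).+1.
Local Notation zw := (z_to_w k r).
Local Notation Pz := (restr zw (P^o : lmodType P)).

Lemma N_pred : N.-1 = (r * m.-1)%N.
Proof. by rewrite /= mulnC -{2}[r]muln1 -mulnBr subn1. Qed.

(** The terms with w-exponent divisible by r, as a polynomial in z modulo z^m; r times this is the
    trace from k[w] to k[z]. *)
Definition residue (h : Pz) : Omx k m := subquo_class 0 m (tau r 0 (h : P)).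

Lemma residue_linear : linear residue.
Proof.
move=> a u v; rewrite /residue -[a *: u]/(zw a * u) tau_additive // tau_zw //.
by rewrite subquo_classD ?expr0 ?dvd1p // subquo_classZ ?expr0 ?dvd1p.
Qed.

Lemma residue_eq0 (h : P) : residue h = 0 <-> 'X^m %| tau r 0 h.
Proof.
have c0 : subquo_class 0 m (0 : P) = 0.
  have e := @subquo_classZ k 0 m 0 0 (dvd1p (0 : P)).
  by rewrite mul0r in e; rewrite e scale0r.
by rewrite -c0 (@subquo_classP k 0 m _ 0 (dvd1p _) (dvd1p 0)) subr0.
Qed.

Lemma residue_ker (h : P) : 'X^N %| h -> residue h = 0.
Proof.
move/dvdp_XnP => h0; apply/residue_eq0/dvdp_XnP => i im.
rewrite coef_tau // addn0 h0 // ltnS -[(m * r - r)%N]/(N.-1) N_pred.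
by rewrite leq_pmul2l // -ltnS prednK.
Qed.

(** Since N - 1 = r(m-1), the coefficient of z^(m-1) in the residue of p w^(N-1-i) is the
    coefficient of w^i in p. *)
Lemma residue_nondegenerate (p : P) :
  (forall q : P, residue (p * q) = 0) -> 'X^N %| p.
Proof.
move=> h; apply/dvdp_XnP => i iN; move: iN; rewrite ltnS => iN.
have /residue_eq0/dvdp_XnP := h 'X^(N.-1 - i); move/(_ m.-1).
rewrite coef_tau // addn0 -N_pred coefMXn prednK // => /(_ (leqnn _)).
by rewrite ltnNge leq_subr /= subKn.
Qed.

(* [f] is determined by the top coefficients of the values [f 'X^n].         *)
Lemma residue_perfect (f : {linear Pz -> Omx k m}) :
  (forall q : P, 'X^N %| q -> f q = 0) ->
  exists p : P, forall q : P, f q = residue (p * q).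
Proof.
move=> f0; pose top (x : Omx k m) : k := (subquo_repr x)`_m.-1.
have topD a x y : top (a%:P *: x + y) = a * top x + top y.
  have /dvdp_XnP/(_ m.-1) := subquo_repr_linear a%:P x y.
  rewrite prednK // coefB => /(_ (leqnn _))/eqP; rewrite subr_eq0 => /eqP.
  by rewrite /top => ->; rewrite coefD coefCM.
have top0 : top 0 = 0.
  have /dvdp_XnP/(_ m.-1) := subquo_repr_linear 0 (0 : Omx k m) 0.
  rewrite prednK // scale0r mul0r !add0r subrr => /(_ (leqnn _)) _.
  have := topD 0 0 0; rewrite mul0r scale0r !add0r => _.
  by have := topD (-1) 0 0; rewrite scaler0 addr0 mulN1r addNr.
(* Multiplying by z^(m-1-i) moves the coefficient of z^i to the top, so [top] recovers an element of
   O_mx from its multiples. *)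
have top_inj x : (forall i, top ('X^i *: x) = 0) -> x = 0.
  move=> h; rewrite -[x]subquo_reprK.
  have -> : (0 : Omx k m) = subquo_class 0 m 0.
    have e := @subquo_classZ k 0 m 0 0 (dvd1p (0 : P)).
    by rewrite mul0r in e; rewrite e scale0r.
  apply/(@subquo_classP k 0 m _ 0 (dvd1p _) (dvd1p 0)); rewrite subr0.
  apply/dvdp_XnP => i im; have := h (m.-1 - i)%N; rewrite /top.
  have /dvdp_XnP/(_ m.-1) := subquo_repr_linear 'X^(m.-1 - i) x 0.
  rewrite prednK // addr0 => /(_ (leqnn _))/eqP.
  rewrite coefB subr_eq0 => /eqP ->; rewrite coefD coefXnM.
  have im' : (i <= m.-1)%N by rewrite -ltnS prednK.
  rewrite ltnNge leq_subr subKn //= -/(top 0) top0 addr0 //.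
(* The choice is forced: the coefficient of w^n in p is the top coefficient of the residue of p
   w^(N-1-n). *)
pose p : P := \poly_(n < N) top (f ('X^(N.-1 - n) : P)).
have [R RE] := linear_exists residue_linear.
exists p; pose g (q : Pz) : Omx k m := f q - residue (p * (q : P)).
have glin : linear g.
  move=> a u v; rewrite /g linearP -[a *: u]/(zw a * u) mulrDr mulrCA.
  rewrite (residue_linear a (p * u : P) (p * v : P)).
  by rewrite opprD addrACA scalerBr.
have gX n : top (g ('X^n : P)) = 0.
  have [nN|Nn] := ltnP n N; last first.
    rewrite /g f0 ?dvdp_exp2l // residue_ker ?dvdp_mull ?dvdp_exp2l //.
    by rewrite subrr.
  have -> : g ('X^n : P) = (-1)%:P *: residue (p * 'X^n) + f ('X^n : P).
    by rewrite /g addrC polyCN scaleN1r.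
  rewrite topD /top.
  have /dvdp_XnP/(_ m.-1) : 'X^m %|
      subquo_repr (residue (p * 'X^n)) - tau r 0 (p * 'X^n).
    by apply: subquo_classK; rewrite expr0 dvd1p.
  rewrite prednK // => /(_ (leqnn _))/eqP; rewrite coefB subr_eq0 => /eqP ->.
  rewrite coef_tau // addn0 -N_pred coefMXn ltnNge -ltnS nN /= coef_poly.
  by rewrite ltnS leq_subr subKn // mulN1r addNr.
have gtop (q : P) : top (g q) = 0.
  rewrite -[q]coefK poly_def (lin_sum glin).
  elim/big_ind: _ => // [x y x0 y0|i _].
    by rewrite -[x]scale1r topD x0 y0 mul1r addr0.
  have -> : g (q`_i *: ('X^i : P)) = (q`_i)%:P *: g ('X^i : P).
    rewrite -(linZ glin); congr g; rewrite -[RHS]/(zw (q`_i)%:P * 'X^i).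
    by rewrite zw_C mul_polyC.
  by rewrite -[_ *: _]addr0 topD gX top0 mulr0 addr0.
move=> q; apply/eqP; rewrite -subr_eq0; apply/eqP/top_inj => i.
by rewrite -/(g q) -(linZ glin) gtop.
Qed.
End Pairing.

Lemma factor_bijective (A : nzRingType) (X U V : lmodType A)
    (c : {linear X -> U}) (d : {linear X -> V}) (F : U -> V) :
  (forall u, exists x, u = c x) -> (forall v, exists x, v = d x) ->
  (forall x, d x = 0 -> c x = 0) -> (forall x, F (c x) = d x) -> bijective F.
Proof.
move=> c_surj d_surj ker FE; have [G GE] := linear_factor d_surj ker.
exists G => [u|v].
  by have [x ->] := c_surj u; rewrite FE GE.
by have [x ->] := d_surj v; rewrite GE FE.
Qed.

Lemma endmod_act (k : fieldType) (r : nat) (M : lmodType {poly k})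
    (N : {linear M -> M})
    (c : {linear restr (z_to_w k r) (({poly k})^o : lmodType {poly k}) -> M}) :
  (forall p : {poly k}, N (c p) = c ('X * p)) ->
  forall f p : {poly k}, f *: (c p : endmod N) = c (f * p).
Proof.
move=> NE; elim/poly_ind => [|f a IH] p.
  by rewrite scale0r mul0r linear0.
rewrite scalerDl -scalerA endmodX NE IH endmodC mulrDl -mulrA linearD.
congr (_ + _); rewrite -[RHS](congr1 c (congr1 ( *%R^~ p) (zw_C r a))).
exact: (esym (linearZZ c a%:P p)).
Qed.

Section Hom.
Variables (A : comNzRingType) (U W : lmodType A).

Lemma hom_fun_linear (f : Defs.hom U W) : linear (hom_fun f).
Proof. exact: (asboolP (linear (hom_fun f)) (subvalP f)). Qed.

Lemma to_homK (f : U -> W) : linear f -> hom_fun (to_hom f) = f.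
Proof. by move=> lf; apply: insub0K; apply/asboolP. Qed.

Lemma hom_ext (f g : Defs.hom U W) : hom_fun f =1 hom_fun g -> f = g.
Proof. by move=> fg; apply: val_inj; apply/funext. Qed.

Lemma hom_funP (a : A) (f g : Defs.hom U W) u :
  hom_fun (a *: f + g) u = a *: hom_fun f u + hom_fun g u.
Proof. by []. Qed.
End Hom.

(** * The factorized structure in polynomial coordinates *)

Section ToFactorized.
Variables (k : fieldType) (r m : nat) (nu : nat -> {poly k}).
Local Notation P := {poly k}.
Local Notation N := (m * r - r).+1.
Local Notation zw := (z_to_w k r).
Local Notation id_P := (idfun : {rmorphism P -> P}).
Local Notation Pz := (restr zw (P^o : lmodType P)).
Variables (M : lmodType P) (A : M -> M) (eps : {linear Pz -> M}).
Hypothesis r_gt1 : (1 < r)%N.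
Hypothesis m_gt0 : (0 < m)%N.
Hypothesis M_killed : forall v : M, 'X^m *: v = 0.
Hypothesis eps_adapted : @adapted k r m nu M A eps.
Let r_gt0 : (0 < r)%N. Proof. exact: ltnW. Qed.

Local Notation V := (image_filtration m_gt0 eps_adapted).
Local Notation Vb := (Vb m V).
Local Notation Wb := (Wb m V).
Local Notation res := (@residue k r m).

Lemma vpar_exists j : exists vpar : {linear Pz -> Vb j},
  forall q, vpar q = Vb_class m (ceps eps j q : sub (V j)).
Proof.
have lin : linear (fun q : Pz => Vb_class m (ceps eps j q : sub (V j)) : Vb j).
  by move=> a p q; rewrite ceps_linear [LHS]linearP.
by have [vpar vparE] := linear_exists lin; exists vpar.
Qed.

Definition vpar j : {linear Pz -> Vb j} := projT1 (cid (vpar_exists j)).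
Lemma vparE j (q : P) : vpar j q = Vb_class m (ceps eps j q : sub (V j)).
Proof. exact: (projT2 (cid (vpar_exists j)) q). Qed.

Lemma vpar_surj j (x : Vb j) : exists q, x = vpar j q.
Proof.
have [v ->] := qclass_surj x; have [q ->] := ceps_surj v.
by exists q; rewrite vparE.
Qed.

(** z^(m-1) V_(j+1) is the image of (w^(j+N)), and j + N <= mr; hence the reduction of V_j is a copy
    of R. *)
Lemma vpar_ker j (q : P) : (j < r)%N -> vpar j q = 0 <-> 'X^N %| q.
Proof.
move=> jr; have le : (r <= m * r)%N by rewrite leq_pmull.
have NjE : (m.-1 * r + j.+1 = j + N)%N.
  by rewrite -[N]prednK // N_pred mulnC addnC addSnnS.
have E (h : P) : 'X^(m.-1) *: eps ('X^(j.+1) * h) = eps ('X^j * ('X^N * h)).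
  by rewrite -epsZ zw_Xn mulnC !mulrA -!exprD NjE.
rewrite vparE qclass_eq0 [X in is_true X]unfold_in /subin_pred val_ceps.
split=> [/scaledP[u /imageP[h ->]]|/dvdpP[h ->]]; last first.
  apply/scaledP; exists (eps ('X^(j.+1) * h)); first exact: image_in.
  by rewrite E [h * _]mulrC.
rewrite E => /(eps_eq eps_adapted); rewrite -mulrBr dvdp_XnM2l; last first.
  exact: leq_trans (ltnW jr) le.
move=> d; rewrite -(subrK ('X^N * h) q) dvdp_add ?dvdp_mulIl //.
by apply: dvdp_trans d; apply: dvdp_exp2l; lia.
Qed.

Lemma vpar_incl j (q : P) : (j.+1 < r)%N -> Vb_incl (vpar j.+1 q) = vpar j ('X * q).
Proof.
move=> jr; rewrite !vparE Vb_incl_class // image_incl //; exact: ltnW.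
Qed.

(* w^(1 - r) p(w^r), for p in (z) *)
Definition zhat (p : subquo k 1 m.+1) : P := 'X * drop_poly r (zw (subquo_repr p)).

Lemma vpar_z (p : subquo k 1 m.+1) (q : P) : Vb_z p (vpar 0%N q) = vpar r.-1 (zhat p * q).
Proof. by rewrite !vparE Vb_z_class // image_z. Qed.

(** The pairing (p, q) |-> residue(pq) lets k[w] parametrize the dual as well; it is perfect, so the
    kernel is again (w^N) and every form is reached. *)
Lemma wpar_exists j : (j < r)%N -> exists wpar : {linear Pz -> Wb j},
  forall p q : P, hom_fun (wpar p) (vpar j q) = res (p * q).
Proof.
move=> jr.
have ex (p : P) : exists F : {linear Vb j -> Omx k m},
    forall q : P, F (vpar j q) = res (p * q).
  have lin : linear (fun q : Pz => res (p * (q : P)) : Omx k m).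
    move=> a u v; rewrite -[a *: u]/(zw a * u) mulrDr mulrCA.
    exact: (residue_linear m r_gt0).
  have [d dE] := linear_exists lin.
  have [|q /(vpar_ker _ jr) q0|F FE] := linear_factor (c := vpar j) (d := d).
  - exact: vpar_surj.
  - by rewrite dE (residue_ker r_gt0 m_gt0) // dvdp_mull.
  - by exists F => q; rewrite FE dE.
pose F p := projT1 (cid (ex p)).
have FE p q : F p (vpar j q) = res (p * q) by exact: (projT2 (cid (ex p)) q).
have hE (p : Pz) q : hom_fun (to_hom (F p) : Wb j) (vpar j q) = res (p * q).
  by rewrite to_homK => [|a u v]; rewrite ?linearP.
have lin : linear (fun p : Pz => to_hom (F p) : Wb j).
  move=> a u v; apply: hom_ext => x; have [q ->] := vpar_surj x.
  rewrite hom_funP; apply: etrans (hE _ q) _; apply: esym.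
  apply: etrans (congr2 (fun s t => a *: s + t) (hE u q) (hE v q)) _; apply: esym.
  have -> : (a *: u + v : P) * q = zw a * (u * q) + v * q by rewrite mulrA -mulrDl.
  exact: (residue_linear m r_gt0).
have [wpar wparE] := linear_exists lin.
by exists wpar => p q; rewrite wparE hE.
Qed.

Lemma wpar_ex j : exists wpar : {linear Pz -> Wb j},
  (j < r)%N -> forall p q : P, hom_fun (wpar p) (vpar j q) = res (p * q).
Proof.
have [jr|jr] := boolP (j < r)%N; last by exists \0%R.
by have [wpar wparE] := wpar_exists jr; exists wpar.
Qed.

Definition wpar j : {linear Pz -> Wb j} := projT1 (cid (wpar_ex j)).
Lemma wparE j (p q : P) : (j < r)%N -> hom_fun (wpar j p) (vpar j q) = res (p * q).
Proof. by move=> jr; exact: (projT2 (cid (wpar_ex j)) jr p q). Qed.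

Lemma wpar_ext j (xi xi' : Wb j) :
  (forall q : P, hom_fun xi (vpar j q) = hom_fun xi' (vpar j q)) -> xi = xi'.
Proof. by move=> h; apply: hom_ext => x; have [q ->] := vpar_surj x. Qed.

Lemma wpar_ker j (p : P) : (j < r)%N -> wpar j p = 0 <-> 'X^N %| p.
Proof.
move=> jr; split=> [D0|p0].
  apply: (residue_nondegenerate r_gt0 m_gt0) => q.
  by rewrite -(wparE p q jr) D0.
apply: wpar_ext => q; rewrite wparE // (residue_ker r_gt0 m_gt0) //.
by rewrite mulrC dvdp_mull.
Qed.

Lemma wpar_surj j (xi : Wb j) : (j < r)%N -> exists p, xi = wpar j p.
Proof.
move=> jr.
have lin : linear (fun q : Pz => hom_fun xi (vpar j q)).
  by move=> a u v; rewrite linearP; exact: hom_fun_linear.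
have [f fE] := linear_exists lin.
have [q q0|p pE] := residue_perfect r_gt0 m_gt0 (f := f).
  by rewrite fE; move/(vpar_ker _ jr): q0 => ->; exact: (lin0 (hom_fun_linear xi)).
by exists p; apply: wpar_ext => q; rewrite wparE // -pE fE.
Qed.

Lemma wpar_incl j (p : P) : (j.+1 < r)%N -> Wb_incl (wpar j p) = wpar j.+1 ('X * p).
Proof.
move=> jr; apply: wpar_ext => q; rewrite wparE // /Wb_incl to_homK.
  by rewrite vpar_incl // wparE ?(ltnW jr) // mulrCA mulrA.
move=> a u v; have [x ->] := vpar_surj u; have [y ->] := vpar_surj v.
rewrite -linearP !vpar_incl // -[_ *: x]/(zw a * x) mulrDr mulrCA.
by rewrite -[zw a * _]/(a *: ('X * x : Pz)) linearP; exact: hom_fun_linear.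
Qed.

Lemma wpar_z (p : subquo k 1 m.+1) (q : P) : Wb_z p (wpar r.-1 q) = wpar 0%N (zhat p * q).
Proof.
have r1 : (r.-1 < r)%N by rewrite prednK.
apply: wpar_ext => q'; rewrite wparE // /Wb_z to_homK.
  by rewrite vpar_z wparE // mulrCA mulrA.
move=> a u v; have [x ->] := vpar_surj u; have [y ->] := vpar_surj v.
rewrite -linearP !vpar_z -[_ *: x]/(zw a * x) mulrDr mulrCA.
by rewrite -[zw a * _]/(a *: (zhat p * x : Pz)) linearP; exact: hom_fun_linear.
Qed.

(** In the coordinates [wpar] and [vpar], theta is the identity and kappa is multiplication by w, so
    N_j is multiplication by w. Both bilinear forms are residues of products, and their symmetry is
    commutativity of k[w]. *)
Lemma theta_ex i j : exists F : {linear Wb j -> Vb i},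
  (i + j).+1 = r -> forall p : P, F (wpar j p) = vpar i p.
Proof.
have [ij|ij] := eqVneq (i + j).+1 r; last by exists \0%R => /eqP; rewrite (negPf ij).
have jr : (j < r)%N by rewrite -ij ltnS leq_addl.
have ir : (i < r)%N by rewrite -ij ltnS leq_addr.
have [u|p /(wpar_ker _ jr)/(vpar_ker _ ir) //|F FE] := linear_factor (c := wpar j) (d := vpar i).
  exact: wpar_surj.
by exists F.
Qed.

Definition theta i j : {linear Wb j -> Vb i} := projT1 (cid (theta_ex i j)).
Lemma thetaE i j (p : P) : (i + j).+1 = r -> theta i j (wpar j p) = vpar i p.
Proof. by move=> ij; exact: (projT2 (cid (theta_ex i j)) ij p). Qed.

Lemma kappa_ex i j : exists F : {linear Vb i -> Wb j},
  (i + j).+1 = r -> forall p : P, F (vpar i p) = wpar j ('X * p).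
Proof.
have [ij|ij] := eqVneq (i + j).+1 r; last by exists \0%R => /eqP; rewrite (negPf ij).
have jr : (j < r)%N by rewrite -ij ltnS leq_addl.
have ir : (i < r)%N by rewrite -ij ltnS leq_addr.
have lin : linear (fun p : Pz => wpar j ('X * (p : P))).
  by move=> a u v; rewrite -linearP -[a *: u]/(zw a * u) mulrDr mulrCA.
have [d dE] := linear_exists lin.
have [u|p /(vpar_ker _ ir) p0|F FE] := linear_factor (c := vpar i) (d := d).
- exact: vpar_surj.
- by rewrite dE; apply/(wpar_ker _ jr); rewrite dvdp_mull.
- by exists F => _ p; rewrite FE dE.
Qed.

Definition kappa i j : {linear Vb i -> Wb j} := projT1 (cid (kappa_ex i j)).
Lemma kappaE i j (p : P) : (i + j).+1 = r -> kappa i j (vpar i p) = wpar j ('X * p).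
Proof. by move=> ij; exact: (projT2 (cid (kappa_ex i j)) ij p). Qed.

Definition vtheta i j (u : Wb j) (xi : Wb i) : Omx k m := hom_fun xi (theta i j u).
Definition vkappa i j (u : Vb i) (v : Vb j) : Omx k m := hom_fun (kappa i j u) v.
Arguments vtheta : clear implicits.
Arguments vkappa : clear implicits.

Lemma vtheta_bilinear i j : (i + j).+1 = r -> bilinear_form (vtheta i j).
Proof.
move=> _; split=> [u a xi xi'|xi a u u']; first exact: hom_funP.
by rewrite /vtheta linearP; exact: hom_fun_linear.
Qed.

Lemma lt_l i j : (i + j).+1 = r -> (i < r)%N.
Proof. by move=> <-; rewrite ltnS leq_addr. Qed.
Lemma lt_r i j : (i + j).+1 = r -> (j < r)%N.
Proof. by move=> <-; rewrite ltnS leq_addl. Qed.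

Lemma vtheta_sym i j : (i + j).+1 = r -> forall u v,
  vtheta i j u v = vtheta j i v u.
Proof.
move=> ij u v; have [p ->] := wpar_surj u (lt_r ij).
have [q ->] := wpar_surj v (lt_l ij).
rewrite /vtheta thetaE // thetaE 1?addnC // wparE ?(lt_l ij) // wparE ?(lt_r ij) //.
by rewrite mulrC.
Qed.

Lemma theta_bij i j : (i + j).+1 = r -> bijective (theta i j).
Proof.
move=> ij; apply: (@factor_bijective _ _ _ _ (wpar j) (vpar i)) => [u|v|x|x].
- exact: wpar_surj (lt_r ij).
- exact: vpar_surj.
- by move/(vpar_ker _ (lt_l ij))/(wpar_ker _ (lt_r ij)).
- exact: thetaE.
Qed.

Lemma theta_incl i j : (i + j).+2 = r -> forall u : Wb j,
  theta i j.+1 (Wb_incl u) = Vb_incl (theta i.+1 j u).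
Proof.
move=> ij; have ij1 : (i + j.+1).+1 = r by rewrite addnS.
have ij2 : (i.+1 + j).+1 = r by rewrite addSn.
move=> u; have [p ->] := wpar_surj u (lt_r ij2).
by rewrite wpar_incl ?(lt_r ij1) // !thetaE // vpar_incl // (lt_l ij2).
Qed.

Lemma theta_z (p : subquo k 1 m.+1) (u : Wb r.-1) :
  theta r.-1 0 (Wb_z p u) = Vb_z p (theta 0 r.-1 u).
Proof.
have r1 : (0 + r.-1).+1 = r by rewrite prednK.
have r2 : (r.-1 + 0).+1 = r by rewrite addn0 prednK.
have [q ->] := wpar_surj u (lt_r r1).
by rewrite wpar_z (thetaE _ r2) (thetaE _ r1) vpar_z.
Qed.

Lemma vkappa_bilinear i j : (i + j).+1 = r -> bilinear_form (vkappa i j).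
Proof.
move=> _; split=> [u a v v'|v a u u']; first exact: hom_fun_linear.
by rewrite /vkappa linearP; exact: hom_funP.
Qed.

Lemma vkappa_sym i j : (i + j).+1 = r -> forall u v,
  vkappa i j u v = vkappa j i v u.
Proof.
move=> ij u v; have [p ->] := vpar_surj u; have [q ->] := vpar_surj v.
rewrite /vkappa kappaE // kappaE 1?addnC // wparE ?(lt_r ij) // wparE ?(lt_l ij) //.
by rewrite -!mulrA [p * q]mulrC.
Qed.

Lemma kappa_incl i j : (i + j).+2 = r -> forall u : Vb i.+1,
  kappa i j.+1 (Vb_incl u) = Wb_incl (kappa i.+1 j u).
Proof.
move=> ij; have ij1 : (i + j.+1).+1 = r by rewrite addnS.
have ij2 : (i.+1 + j).+1 = r by rewrite addSn.
move=> u; have [p ->] := vpar_surj u.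
by rewrite vpar_incl ?(lt_l ij2) // !kappaE // wpar_incl // (lt_r ij1).
Qed.

Lemma kappa_z (p : subquo k 1 m.+1) (u : Vb 0%N) :
  kappa r.-1 0 (Vb_z p u) = Wb_z p (kappa 0 r.-1 u).
Proof.
have r1 : (0 + r.-1).+1 = r by rewrite prednK.
have r2 : (r.-1 + 0).+1 = r by rewrite addn0 prednK.
have [q ->] := vpar_surj u.
by rewrite vpar_z (kappaE _ r2) (kappaE _ r1) wpar_z mulrCA.
Qed.

Definition Nj j : {linear Vb j -> Vb j} := theta j (r - j.+1) \o kappa j (r - j.+1).

Lemma NjE j (p : P) : (j < r)%N -> Nj j (vpar j p) = vpar j ('X * p).
Proof.
move=> jr; have ij : (j + (r - j.+1)).+1 = r by rewrite -addSn subnKC.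
by rewrite /Nj /= kappaE // thetaE.
Qed.

Lemma Nj_act j (f p : P) : (j < r)%N -> f *: (vpar j p : endmod (Nj j)) = vpar j (f * p).
Proof. by move=> jr; apply: endmod_act => q; exact: NjE. Qed.

Lemma Nj_iter j n (p : P) : (j < r)%N -> iter n (Nj j) (vpar j p) = vpar j ('X^n * p).
Proof. by move=> jr; rewrite -endmodXn Nj_act. Qed.

Lemma Nj_r j : (j < r)%N -> forall v, iter r (Nj j) v = 'X *: v.
Proof.
move=> jr v; have [p ->] := vpar_surj v.
by rewrite Nj_iter // -linearZZ -(zw_X k r).
Qed.

Lemma Nj_nilp j : (j < r)%N -> forall v, iter N (Nj j) v = 0.
Proof.
move=> jr v; have [p ->] := vpar_surj v.
by rewrite Nj_iter //; apply/(vpar_ker _ jr); rewrite dvdp_mulIl.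
Qed.

Lemma Nj_inj j : (j < r)%N -> forall f : P,
  (forall v : endmod (Nj j), f *: v = 0) -> 'X^N %| f.
Proof.
move=> jr f /(_ (vpar j 1)); rewrite Nj_act // mulr1.
by move/(vpar_ker _ jr).
Qed.

Lemma Nj_conn j : (j < r)%N -> forall v : sub (V j),
  Vb_class m (fil_A v) = nu_shift r m nu j *: (Vb_class m v : endmod (Nj j)).
Proof.
move=> jr v; have [q ->] := ceps_surj v.
have [h ->] := image_A m_gt0 eps_adapted q jr.
rewrite -!vparE Nj_act //; apply/eqP; rewrite -subr_eq0; apply/eqP.
rewrite -linearB; apply/(vpar_ker _ jr); rewrite addrC addKr.
exact: dvdp_mulIl.
Qed.

Local Notation L j := (endmod (Nj j) : lmodType P).

Lemma lpar_ex j : exists F : {linear P^o -> L j},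
  (j < r)%N -> forall p, F p = vpar j p.
Proof.
have [jr|jr] := boolP (j < r)%N; last by exists \0%R.
have lin : linear (fun p : P^o => vpar j p : L j).
  move=> a u v; rewrite -[a *: u]/(a * u) [LHS](linearD (vpar j)).
  by rewrite -(Nj_act a u jr).
by have [F FE] := linear_exists lin; exists F.
Qed.

Definition lpar j : {linear P^o -> L j} := projT1 (cid (lpar_ex j)).
Lemma lparE j (p : P) : (j < r)%N -> lpar j p = vpar j p.
Proof. by move=> jr; exact: (projT2 (cid (lpar_ex j)) jr p). Qed.
Lemma lpar_surj j (x : L j) : (j < r)%N -> exists p, x = lpar j p.
Proof. by move=> jr; have [q ->] := vpar_surj x; exists q; rewrite lparE. Qed.
Lemma lpar_ker j (p : P) : (j < r)%N -> lpar j p = 0 <-> 'X^N %| p.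
Proof. by move=> jr; rewrite lparE //; exact: vpar_ker. Qed.

(** The canonical map of reductions is multiplication by w on coordinates; [shift_down] is the
    isomorphism left after removing this w, from which psi is built. *)
Lemma shift_down_ex j : exists F : {linear L j.+1 -> L j},
  (j.+1 < r)%N -> forall p : P, F (lpar j.+1 p) = lpar j p.
Proof.
have [jr|jr] := boolP (j.+1 < r)%N; last by exists \0%R.
have [u|p /(lpar_ker _ jr)/(lpar_ker _ (ltnW jr)) //|F FE] :=
  linear_factor (c := lpar j.+1) (d := lpar j); first exact: lpar_surj.
by exists F.
Qed.

Definition shift_down j : {linear L j.+1 -> L j} := projT1 (cid (shift_down_ex j)).
Lemma shift_downE j (p : P) : (j.+1 < r)%N -> shift_down j (lpar j.+1 p) = lpar j p.
Proof. by move=> jr; exact: (projT2 (cid (shift_down_ex j)) jr p). Qed.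

Lemma shift_down_bij j : (j.+1 < r)%N -> bijective (shift_down j).
Proof.
move=> jr; apply: (@factor_bijective _ _ _ _ (lpar j.+1) (lpar j)) => [u|v|x|x].
- exact: lpar_surj.
- exact/lpar_surj/ltnW.
- by move/(lpar_ker _ (ltnW jr))/(lpar_ker _ jr).
- exact: shift_downE.
Qed.

Lemma shift_down_chain j (p : P) : (j < r)%N ->
  rho_chain (L := fun j => L j) (fun i => shift_down i) (lpar j p) = lpar 0%N p.
Proof. by elim: j => [//|j IH] jr; rewrite [LHS]/= shift_downE // IH // ltnW. Qed.

Lemma endmod_killed j : (j < r)%N -> kills 'X^N (L j).
Proof. by move=> jr x; rewrite endmodXn; exact: Nj_nilp. Qed.

Lemma psi_ex : exists psi : forall j, {linear L j.+1 ->
    tensor id_P (subquo k 1 N.+1) (L j)},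
  [/\ forall j, (j.+1 < r)%N -> bijective (psi j),
      forall j, (j.+1 < r)%N -> forall v, mult_map (psi j v) = Vb_incl v
    & forall (p : subquo k 1 m.+1) (v : Vb 0%N),
        psi_chain (L := fun j => L j) psi (Vb_z p v)
        = tens id_P (subquo_class r.-1 (N + r.-1) (zw (subquo_repr p)))
                    (v : L 0%N)].
Proof.
have [psi [psi_bij psi_mult psi_z]] :=
  psi_from_sigma (L := fun j => L j) shift_down endmod_killed.
exists psi; split=> [j jr|j jr v|p v].
- by apply: (psi_bij j (ltnW jr)); exact: shift_down_bij.
- have [q ->] := lpar_surj v jr.
  rewrite (psi_mult j (ltnW jr)) shift_downE // !lparE ?(ltnW jr) // vpar_incl //.
  exact: Nj_act (ltnW jr).
have [q ->] := lpar_surj v r_gt0; have r1 : (r.-1 < r)%N by rewrite prednK.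
have zp : 'X^r %| zw (subquo_repr p).
  by have := z_to_w_dvd r (subquo_reprP p); rewrite mul1n.
rewrite (lparE q r_gt0) vpar_z -(lparE _ r1).
apply: psi_z => //.
  by apply: dvdp_trans zp; apply: dvdp_exp2l; exact: leq_pred.
rewrite (shift_down_chain _ r1) -(lparE q r_gt0) -linearZ; congr (lpar 0%N _).
have Xr : 'X^r = 'X * 'X^(r.-1) :> P by rewrite -exprS prednK.
rewrite /zhat {2}(dvdp_Xn_drop zp) Xr mulrA drop_polyMXn_id [_ * 'X]mulrC.
by [].
Qed.

Lemma factorized_from_adapted : inhabited (factorized_structure r m nu A).
Proof.
constructor.
refine (@FactorizedStructure k r m nu M A V vtheta theta vkappa kappa
  vtheta_bilinear vtheta_sym _ theta_bij theta_incl
  theta_z vkappa_bilinear vkappa_sym _ kappa_incl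
  kappa_z _ _ _ _ _).
- by [].
- by [].
- exact Nj_r.
- exact Nj_nilp.
- exact Nj_inj.
- exact Nj_conn.
- exact psi_ex.
Qed.
End ToFactorized.

Lemma strong_recursion (T : Type) (x0 : T) (Psi : nat -> (nat -> T) -> T) :
  (forall n f g, (forall i, (i < n)%N -> f i = g i) -> Psi n f = Psi n g) ->
  exists x, forall n, x n = Psi n x.
Proof.
move=> Psi_ext.
(* [hist n] is a table of the solution whose entries below n are final. *)
pose fix hist n : nat -> T := if n is n'.+1 then
  fun d => if (d < n')%N then hist n' d else Psi n' (hist n') else fun=> x0.
have histS n d : (d < n)%N -> hist n d = Psi d (hist d).
  elim: n => // n IH; rewrite ltnS leq_eqVlt /= => /orP[/eqP->|dn].
    by rewrite ltnn.
  by rewrite dn IH.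
exists (fun n => Psi n (hist n)) => n; apply: Psi_ext => i ni.
exact: histS.
Qed.

Lemma sum_periodic (k : zmodType) (r s : nat) (g : nat -> k) :
  (forall i, g (i + r)%N = g i) ->
  \sum_(i < r) g (i + s)%N = \sum_(i < r) g i.
Proof.
move=> gP; elim: s => [|s <-]; first by apply: eq_bigr => i _; rewrite addn0.
case: r gP => [|r] gP; first by rewrite !big_ord0.
rewrite [LHS]big_ord_recr [RHS]big_ord_recl /= addrC; congr (_ + _).
  by rewrite add0n addnS -addSn addnC gP.
by apply: eq_bigr => i _; rewrite addnS.
Qed.

(** * Gauge transformations of k[[w]] *)

Section Kernels.
Variable k : fieldType.
Implicit Types (f g : fps k) (K L : nat -> nat -> k).

Lemma fpsM f g n : (f * g) n = \sum_(i < n.+1) f i * g (n - i)%N.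
Proof. by []. Qed.
Lemma fpsD f g n : (f + g) n = f n + g n. Proof. by []. Qed.

(* The operator w^j |-> \sum_d K d j w^(j + d). *)
Definition kernel_op K f : fps k := fun n => \sum_(j < n.+1) K (n - j)%N j * f j.

Definition kernel_comp K L d i := \sum_(s < d.+1) K (d - s)%N (i + s)%N * L s i.

Lemma sum_triangle (F : nat -> nat -> k) n :
  \sum_(j < n.+1) \sum_(i < j.+1) F j i =
  \sum_(i < n.+1) \sum_(s < (n - i).+1) F (i + s)%N i.
Proof.
transitivity (\sum_(j < n.+1) \sum_(i < n.+1 | (i <= j)%N) F j i).
  apply: eq_bigr => j _; rewrite (big_ord_widen _ (fun i => F j i) (ltn_ord j)).
  by apply: eq_bigl => i; rewrite ltnS.
rewrite (exchange_big_dep predT) //=; apply: eq_bigr => i _.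
rewrite -(big_mkord (fun j => (i <= j)%N) (fun j => F j i)).
have := @big_nat_widenl _ 0 +%R i 0 n.+1 predT (fun j => F j i) (leq0n i).
rewrite /= => <-.
rewrite -{1}[(i : nat)]add0n big_addn subSn ?leq_ord // big_mkord.
by apply: eq_bigr => s _; rewrite addnC.
Qed.

Lemma kernel_op_comp K L f :
  kernel_op K (kernel_op L f) = kernel_op (kernel_comp K L) f.
Proof.
apply/funext => n; rewrite /kernel_op /kernel_comp.
under eq_bigr => j _ do rewrite mulr_sumr.
rewrite (sum_triangle (fun j i => K (n - j)%N j * (L (j - i)%N i * f i))).
apply: eq_bigr => i _; rewrite mulr_suml; apply: eq_bigr => s _.
by rewrite addKn subnDA mulrA.
Qed.

Lemma kernel_opD K f g : kernel_op K (f + g) = kernel_op K f + kernel_op K g.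
Proof.
apply/funext => n; rewrite fpsD /kernel_op -big_split; apply: eq_bigr => i _.
by rewrite /= fpsD mulrDr.
Qed.

Lemma eq_kernel_op K L f : (forall d i, K d i = L d i) ->
  kernel_op K f = kernel_op L f.
Proof.
by move=> KL; apply/funext => n; apply: eq_bigr => i _; rewrite KL.
Qed.

Lemma mul_kernel g f : g * f = kernel_op (fun d _ => g d) f.
Proof.
by rewrite mulrC; apply/funext => n; apply: eq_bigr => i _; rewrite mulrC.
Qed.

(** Such an operator is lower triangular with unit diagonal, so it is inverted coefficient by
    coefficient. *)
Lemma kernel_op_bij K : (forall i, K 0%N i = 1) -> bijective (kernel_op K).
Proof.
move=> K1; have E f n :
    kernel_op K f n = \sum_(j < n) K (n - j)%N j * f j + f n.
  by rewrite /kernel_op big_ord_recr /= subnn K1 mul1r.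
have inj : injective (kernel_op K).
  move=> f g fg; apply/funext => n; elim/ltn_ind: n => n IH.
  have := congr1 (fun h : fps k => h n) fg; rewrite /= !E.
  have -> : \sum_(j < n) K (n - j)%N j * f j = \sum_(j < n) K (n - j)%N j * g j.
    by apply: eq_bigr => j _; rewrite IH.
  by move/addrI.
have surj h : exists f, kernel_op K f = h.
  have [|f fE] := strong_recursion (0 : k)
    (Psi := fun n f => h n - \sum_(j < n) K (n - j)%N j * f j).
    by move=> n f g fg; congr (_ - _); apply: eq_bigr => j _; rewrite fg.
  by exists f; apply/funext => n; rewrite E fE addrC subrK.
exists (fun h => projT1 (cid (surj h))) => h.
  by apply: inj; exact: (projT2 (cid (surj (kernel_op K h)))).
exact: (projT2 (cid (surj h))).
Qed.

(** Periodicity in the source exponent means commuting with w^r, which makes the operator linear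
    over k[[z]]. *)
Lemma kernel_op_subst (r : nat) K (g f : fps k) : (0 < r)%N ->
  (forall d i, K d (i + r)%N = K d i) ->
  kernel_op K (fps_subst r g * f) = fps_subst r g * kernel_op K f.
Proof.
move=> r_gt0 Kper; have Kmul d i q : K d (i + q * r)%N = K d i.
  by elim: q => [|q IH]; rewrite ?addn0 // mulSn addnCA addnC Kper.
rewrite !mul_kernel !kernel_op_comp; apply: eq_kernel_op => d i.
rewrite /kernel_comp (reindex_inj rev_ord_inj) /=; apply: eq_bigr => s _.
rewrite subSS subKn ?leq_ord // mulrC /fps_subst.
case: ifP => [/dvdnP[q ->]|_]; last by rewrite !mul0r.
by rewrite Kmul.
Qed.
End Kernels.

Section Gauge.
Variables (k : fieldType) (r n0 : nat).
Hypothesis natr_neq0 : forall n, (n.+1)%:R != 0 :> k.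
Hypothesis r_gt0 : (0 < r)%N.
Hypothesis n0_gt1 : (1 < n0)%N.
Hypothesis r_dvd : (r %| n0)%N.
Variables (v : nat -> k) (b : nat -> nat -> k).
Hypothesis v1 : v 1%N != 0.
Hypothesis b_per : forall d i, b d (i + r)%N = b d i.
Hypothesis b_high : forall d i, (d <= n0)%N -> b d i = 0.

(* nabla_nu, for nu = \sum_n v n w^n, with n0 = r (m - 1). *)
Definition conn_kernel (d i : nat) : k := v d + (i%:R / r%:R) *+ (d == n0).

(* The part of weight d + 2 of the intertwining equation involving [a s] for *)
(* s <= d determines the differences a_(d+1, i+1) - a_(d+1, i) ...           *)
Definition gauge_diff (a : nat -> nat -> k) (d i : nat) : k :=
  \sum_(s < d.+1) - (v s.+2 * (a (d - s)%N (i + s.+2)%N - a (d - s)%N i)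
                     + a (d - s)%N (i + s.+2)%N * b s.+2 i)
  + ((d.+2 - n0)%:R / r%:R * a (d.+2 - n0)%N i) *+ (n0 <= d.+2)%N.

(* ... while solvability in weight d + 1 + n0 determines their mean.         *)
Definition gauge_mean (a : nat -> nat -> k) (d : nat) : k :=
  (\sum_(i < r) \sum_(s < d.+1) a (d - s)%N (i + (n0 + s.+1))%N * b (n0 + s.+1)%N i)
  / d.+1%:R.

(** Partial sums of the prescribed differences, normalized so that the mean over a period is
    [gauge_mean]. *)
Definition gauge_step (a : nat -> nat -> k) (d i : nat) : k :=
  let S i := (v 1%N)^-1 * \sum_(j < i) gauge_diff a d j in
  gauge_mean a d + S i - (\sum_(j < r) S j) / r%:R.

Lemma r_neq0 : r%:R != 0 :> k.
Proof. by case: r r_gt0 => // n _; exact: natr_neq0. Qed.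

(** Weight by weight the equation prescribes v_1 (a_(d+1)(i+1) - a_(d+1)(i)). A solution periodic in
    i exists when the right-hand sides sum to 0 over a period. There the terms in v_s telescope, and
    what remains, the b terms and the residue term, cancels by the earlier choice of a mean. *)
Lemma gauge_exists : exists a : nat -> nat -> k,
  [/\ forall i, a 0%N i = 1, forall d i, a d (i + r)%N = a d i
    & forall d i, kernel_comp a (fun s j => conn_kernel s j + b s j) d i
                  = kernel_comp conn_kernel a d i].
Proof.
have [|a aE] := strong_recursion (fun=> 0 : k)
    (Psi := fun n a => if n is d.+1 then gauge_step a d else fun=> 1).
  case=> // d f g fg; have E s : (s <= d)%N -> f s = g s by move=> sd; apply: fg.
  have Ed j : gauge_diff f d j = gauge_diff g d j.
    rewrite /gauge_diff; congr (_ + _).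
      by apply: eq_bigr => s _; rewrite E // leq_subr.
    (* The residue term involves only the index d + 2 - n0, which is at most d because n0 > 1. *)
    by case: leqP => // nd; rewrite E // leq_subLR; lia.
  have Em : gauge_mean f d = gauge_mean g d.
    congr (_ / _); apply: eq_bigr => i _; apply: eq_bigr => s _.
    by rewrite E // leq_subr.
  apply/funext => i; rewrite /gauge_step Em.
  have ES j : \sum_(j' < j) gauge_diff f d j' = \sum_(j' < j) gauge_diff g d j'.
    by apply: eq_bigr.
  by rewrite ES; congr (_ - _ / _); apply: eq_bigr => j _; rewrite ES.
have a0 i : a 0%N i = 1 by rewrite aE.
have aS d i : a d.+1 i = gauge_step a d i by rewrite aE.
have adiff d i : v 1%N * (a d.+1 i.+1 - a d.+1 i) = gauge_diff a d i.
  rewrite !aS /gauge_step big_ord_recr /=.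
  set S := \sum_(j < i) _; set S' := \sum_(j < r) _.
  have -> : gauge_mean a d + (v 1%N)^-1 * (S + gauge_diff a d i) - S' / r%:R
    - (gauge_mean a d + (v 1%N)^-1 * S - S' / r%:R)
    = (v 1%N)^-1 * gauge_diff a d i by ring.
  by rewrite mulVKf.
have amean d : d.+1%:R / r%:R * \sum_(i < r) a d.+1 i =
    \sum_(i < r) \sum_(s < d.+1)
      a (d - s)%N (i + (n0 + s.+1))%N * b (n0 + s.+1)%N i.
  have -> : \sum_(i < r) a d.+1 i = r%:R * gauge_mean a d.
    under eq_bigr => i _ do rewrite aS /gauge_step.
    rewrite sumrB big_split /= !sumr_const card_ord.
    rewrite -[X in _ - X]mulr_natr divfK ?r_neq0 // addrK.
    by rewrite mulr_natl.
  rewrite mulrA divfK ?r_neq0 // /gauge_mean mulrC divfK //.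
(* As b vanishes up to weight n0, only coefficients of a of index below e - n0 meet it; so the mean
   of a_(e-n0) is still free to balance this sum. *)
have bsum e i : \sum_(s < e.+1) a (e - s)%N (i + s)%N * b s i
    = \sum_(s < e - n0) a (e - n0 - s.+1)%N (i + (n0 + s.+1))%N * b (n0 + s.+1)%N i.
  have [en|ne] := leqP e n0.
    rewrite (eqP en) big_ord0 big1 // => s _; rewrite b_high ?mulr0 //.
    by apply: leq_trans en; rewrite -ltnS.
  rewrite -(big_mkord predT (fun s => a (e - s)%N (i + s)%N * b s i)).
  rewrite (big_cat_nat (n := n0.+1)) //=; last by rewrite ltnS ltnW.
  rewrite big_nat_cond big1 ?add0r => [|s /andP[/andP[_ sn] _]]; last first.
    by rewrite b_high ?mulr0.
  rewrite -{1}[n0.+1]add0n big_addn subSS big_mkord; apply: eq_bigr => s _.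
  have -> : (s + n0.+1 = n0 + s.+1)%N by rewrite addnC addSnnS.
  by rewrite subnDA.
have a_per d : forall i, a d (i + r)%N = a d i.
  elim/ltn_ind: d => -[|d] IH i; first by rewrite !a0.
  have F_per j : gauge_diff a d (j + r) = gauge_diff a d j.
    rewrite /gauge_diff; congr (_ + _); last first.
      by case: leqP => // nd; rewrite IH //; lia.
    apply: eq_bigr => s _; have sd : (d - s < d.+1)%N by rewrite ltnS leq_subr.
    by rewrite b_per addnAC !IH.
  (* The solvability condition in weight d + 2, arranged by the mean chosen for index d + 2 - n0. *)
  have Fsum : \sum_(j < r) gauge_diff a d j = 0.
    rewrite /gauge_diff big_split exchange_big /=.
    under eq_bigr => s _ do rewrite sumrN big_split -mulr_sumr sumrB /=.
    have E s : (s < d.+1)%N ->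
        \sum_(j < r) a (d - s)%N (j + s.+2)%N - \sum_(j < r) a (d - s)%N j = 0.
      move=> sd; rewrite sum_periodic ?subrr // => j.
      by apply: IH; rewrite ltnS leq_subr.
    under eq_bigr => s _ do rewrite E // mulr0 add0r.
    rewrite sumrN exchange_big /=.
    have bE j : \sum_(s < d.+1) a (d - s)%N (j + s.+2)%N * b s.+2 j
        = \sum_(s < d.+3) a (d.+2 - s)%N (j + s)%N * b s j.
      rewrite [RHS]big_ord_recl [X in _ + X]big_ord_recl.
      rewrite [b 0%N _]b_high // [b (lift _ _) _]b_high; last by exact: ltnW.
      by rewrite !mulr0 !add0r; apply: eq_bigr => s _.
    under eq_bigr => j _ do rewrite bE bsum.
    case: leqP => [nd|dn]; last first.
      rewrite [X in _ + X]big1 // addr0 big1 ?oppr0 // => j _.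
      have -> : (d.+2 - n0 = 0)%N by apply/eqP; rewrite subn_eq0 ltnW.
      by rewrite big_ord0.
    rewrite -mulr_sumr; case dE : (d.+2 - n0)%N => [|d'].
      rewrite mul0r mul0r addr0 big1 ?oppr0 // => j _.
      by rewrite big_ord0.
    by rewrite amean addNr.
  rewrite !aS /gauge_step; congr (_ + _ * _ - _).
  rewrite addnC big_split_ord /= Fsum add0r; apply: eq_bigr => j _.
  by rewrite addnC F_per.
exists a; split=> // e i; rewrite /kernel_comp.
rewrite [RHS](reindex_inj rev_ord_inj) /=.
apply/eqP; rewrite -subr_eq0 -sumrB; apply/eqP.
have a_perq d j q : a d (j + q * r)%N = a d j.
  by elim: q => [|q IHq]; rewrite ?addn0 // mulSn addnCA addnC a_per.
(* n0 is a multiple of the period r, so the two contributions i/r and (i + e - n0)/r of the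
   derivative combine into a single term. *)
transitivity (\sum_(s < e.+1) (v s * (a (e - s)%N (i + s)%N - a (e - s)%N i)
    + a (e - s)%N (i + s)%N * b s i
    - ((e - n0)%:R / r%:R * a (e - n0)%N i) *+ (s == n0 :> nat))).
  apply: eq_bigr => s _; rewrite subSS subKn ?leq_ord // /conn_kernel.
  case: eqP => [->|_]; last by rewrite !mulr0n; ring.
  have /dvdnP[q ->] := r_dvd; rewrite a_perq !mulr1n natrD.
  by have := r_neq0 => ?; field.
(* Weights 0 and 1 hold because a_0 = 1 and b starts above n0 > 1. In weight d + 2 the term s = 0
   vanishes and s = 1 is the difference given by [adiff]. *)
case: e => [|[|d]].
- rewrite big_ord1 addn0 subrr mulr0 add0r b_high // mulr0 add0r.
  by rewrite eq_sym gtn_eqF ?mulr0n ?oppr0 // ltnW.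
- rewrite !big_ord_recl big_ord0 /= addn0 subrr !a0 subrr !mulr0 !add0r.
  rewrite !b_high ?mulr0 ?(ltnW n0_gt1) // !add0r addr0.
  by rewrite !ltn_eqF ?(ltnW n0_gt1) // !mulr0n !oppr0 addr0.
rewrite [LHS]big_ord_recl [X in _ + X]big_ord_recl /=.
rewrite addn0 subrr mulr0 b_high // mulr0 !add0r ltn_eqF ?(ltnW n0_gt1) //.
rewrite mulr0n oppr0 add0r /bump /= subSS subn0 addn1 adiff.
rewrite [b 1%N _]b_high ?(ltnW n0_gt1) // mulr0 addr0 ltn_eqF // mulr0n subr0.
rewrite /gauge_diff big_split /= sumrN -!addrA.
set T := _ / _ * a (d.+2 - n0)%N i.
have -> : \sum_(s < d.+1) - (T *+ (1 + (1 + s) == n0)%N) = - (T *+ (n0 <= d.+2)).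
  case: leqP => [nd|dn].
    have n2 : (n0 - 2 < d.+1)%N by lia.
    rewrite (bigD1 (Ordinal n2)) //= big1 ?addr0 => [|s sn].
      by rewrite (_ : (1 + (1 + (n0 - 2)))%N == n0) //; lia.
    case: eqP => [sn0|_]; last by rewrite mulr0n oppr0.
    by case/negP: sn; apply/eqP/val_inj => /=; lia.
  rewrite mulr0n oppr0 big1 // => s _; rewrite ltn_eqF ?mulr0n ?oppr0 //.
  by have := ltn_ord s; lia.
by rewrite [X in - _ + X]addrC subrK; exact: addNr.
Qed.
End Gauge.

(** * Derivations of a function field *)

Section AlgebraicRelation.
Variables (k K : fieldType) (iota : {rmorphism k -> K}).
Local Notation P := {poly k}.

Lemma nontrivial_kernel (I J : finType) (W : I -> J -> k) : (#|J| < #|I|)%N ->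
  exists v : I -> k, (exists i, v i != 0) /\ forall j, \sum_i v i * W i j = 0.
Proof.
move=> JI; pose A : 'M[k]_(#|I|, #|J|) := \matrix_(a, c) W (enum_val a) (enum_val c).
have : kermx A != 0.
  rewrite kermx_eq0 /row_free; apply: contraTneq JI => rk.
  by rewrite -leqNgt -rk rank_leq_col.
case/rowV0Pn=> v /sub_kermxP vA v0.
exists (fun i => v 0 (enum_rank i)); split.
  case/rV0Pn: v0 => a va; exists (enum_val a); rewrite enum_valK //.
move=> j; have := congr1 (fun B : 'rV_(#|J|) => B 0 (enum_rank j)) vA.
rewrite !mxE => E; rewrite -[RHS]E (reindex (@enum_val I I)) /=.
  by apply: eq_bigr => a _; rewrite mxE enum_valK enum_rankK.
by exists enum_rank => a _; rewrite ?enum_valK ?enum_rankK.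
Qed.

Section Fixed.
Variables (ev : {rmorphism P -> K}) (n : nat) (b : 'I_n -> K).
Hypothesis ev_C : forall c : k, ev c%:P = iota c.
Hypothesis ev_inj : forall p, ev p = 0 -> p = 0.
Hypothesis b_span : forall f : K, exists2 q : P, q != 0 &
  exists p : 'I_n -> P, ev q * f = \sum_i ev (p i) * b i.

Lemma common_denominator (T : finType) (F : T -> K) :
  exists2 q : P, q != 0 & exists p : T -> 'I_n -> P,
    forall l, ev q * F l = \sum_i ev (p l i) * b i.
Proof.
pose q l := projT1 (cid2 (b_span (F l))).
have q0 l : q l != 0 by rewrite /q; case: cid2.
have qp l : exists p : 'I_n -> P, ev (q l) * F l = \sum_i ev (p i) * b i.
  by rewrite /q; case: cid2.
exists (\prod_l q l); first by apply/prodf_neq0 => l _.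
exists (fun l i => (\prod_(l' | l' != l) q l') * projT1 (cid (qp l)) i) => l.
rewrite (bigD1 l) //= rmorphM mulrAC [LHS]mulrC.
case: cid => p /= ->; rewrite mulr_sumr; apply: eq_bigr => i _.
by rewrite rmorphM mulrA.
Qed.

Definition row_act (u : 'I_n -> P) (A : 'I_n -> 'I_n -> P) (l : 'I_n) : P :=
  \sum_i u i * A i l.

Lemma row_actE (u : 'I_n -> P) (A : 'I_n -> 'I_n -> P) (s x c : K) :
  (forall i, s * x * b i = \sum_l ev (A i l) * b l) ->
  \sum_i ev (u i) * b i = c ->
  \sum_l ev (row_act u A l) * b l = s * x * c.
Proof.
move=> AE <-; rewrite mulr_sumr.
under eq_bigr => l _ do rewrite rmorph_sum mulr_suml.
rewrite exchange_big /=; apply: eq_bigr => i _.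
by rewrite mulrCA AE mulr_sumr; apply: eq_bigr => l _; rewrite rmorphM mulrA.
Qed.

Lemma size_row_act (u : 'I_n -> P) (A : 'I_n -> 'I_n -> P) (c e : nat) :
  (forall i, (size (u i) <= e.+1)%N) -> (forall i l, (size (A i l) <= c.+1)%N) ->
  forall l, (size (row_act u A l) <= (e + c).+1)%N.
Proof.
move=> ue Ac l; apply: (leq_trans (size_sum _ _ _)); apply/bigmax_leqP => i _.
apply: leq_trans (size_polyMleq _ _) _.
by have := ue i; have := Ac i l; lia.
Qed.

(* The elements x^i y^j with i, j <= d are (d + 1)^2 vectors which, up to a  *)
(* common denominator, lie in a space of dimension linear in d.              *)
Lemma monomials_dependent (x y : K) : exists d (a : 'I_d.+1 * 'I_d.+1 -> k),
  (exists ij, a ij != 0) /\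
  \sum_ij iota (a ij) * (x ^+ ij.1 * y ^+ ij.2) = 0.
Proof.
pose T : finType := (('I_n + 'I_n) + unit)%type.
pose F (l : T) : K := match l with
  inl (inl i) => x * b i | inl (inr i) => y * b i | inr _ => 1 end.
have [q q0 [p pE]] := common_denominator F.
pose c := (size q + \max_l \max_i size (p l i))%N.
have pc l i : (size (p l i) <= c.+1)%N.
  apply: leqW; apply: leq_trans (leq_addl _ _).
  apply: leq_trans (leq_bigmax (l : T)).
  exact: (leq_bigmax (F := fun i => size (p l i)) i).
pose X i := p (inl (inl i)); pose Y i := p (inl (inr i)); pose u := p (inr tt).
(* Coordinates of q^(i+j+1) x^i y^j on b: each multiplication by x or y costs a factor q, and
   writing 1 on b costs one more. *)
pose w i j := iter j (row_act^~ Y) (iter i (row_act^~ X) u).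
have wE i j : \sum_l ev (w i j l) * b l = ev q ^+ (i + j).+1 * (x ^+ i * y ^+ j).
  have uE : \sum_l ev (u l) * b l = ev q by rewrite -pE mulr1.
  have iE : \sum_l ev (iter i (row_act^~ X) u l) * b l = ev q ^+ i.+1 * x ^+ i.
    elim: i => [|i IH]; first by rewrite expr1 mulr1.
    rewrite /= (row_actE (s := ev q) (x := x) _ IH).
      by rewrite (exprS _ i.+1) (exprS x i) -!mulrA; congr (_ * _); rewrite mulrCA.
    by move=> i'; rewrite -mulrA -[RHS]pE.
  elim: j => [|j IH]; first by rewrite addn0 expr0 mulr1.
  rewrite /w iterS (row_actE (s := ev q) (x := y) _ IH).
    by rewrite addnS (exprS _ (i + j).+1) (exprS y j); ring.
  by move=> i'; rewrite -mulrA -[RHS]pE.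
have wsize i j l : (size (w i j l) <= (c * (i + j).+1).+1)%N.
  have isize l' : (size (iter i (row_act^~ X) u l') <= (c * i.+1).+1)%N.
    elim: i l' => [|i IH] l'; first by rewrite muln1; exact: pc.
    rewrite /= mulnS addnC; apply: size_row_act => // i' l''; exact: pc.
  elim: j l => [|j IH] l; first by rewrite addn0; exact: isize.
  rewrite /w iterS addnS mulnS addnC; apply: size_row_act => // i' l'; exact: pc.
(* S bounds the size of the coordinates of q^(2d+1) x^i y^j, and with this d one has n S <
   (d+1)^2. *)
pose d := (n * (2 * c + 1))%N; pose S := (c * (2 * d + 1)).+1.
pose W (ij : 'I_d.+1 * 'I_d.+1) l := q ^+ (2 * d - (ij.1 + ij.2)) * w ij.1 ij.2 l.
have dE (ij : 'I_d.+1 * 'I_d.+1) : (ij.1 + ij.2 <= 2 * d)%N.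
  by have := ltn_ord ij.1; have := ltn_ord ij.2; lia.
have Wsize ij l : (size (W ij l) <= S)%N.
  apply: leq_trans (size_polyMleq _ _) _.
  have e1 := size_poly_exp_leq q (2 * d - (ij.1 + ij.2)); have e2 := wsize ij.1 ij.2 l.
  have e3 : ((size q).-1 * (2 * d - (ij.1 + ij.2)) <= c * (2 * d - (ij.1 + ij.2)))%N.
    by rewrite leq_mul2r; apply/orP; right; rewrite /c; lia.
  have e4 : (c * (2 * d - (ij.1 + ij.2)) + c * (ij.1 + ij.2).+1 = c * (2 * d + 1))%N.
    by rewrite -mulnDr; congr muln; have := dE ij; lia.
  by rewrite /S; lia.
have WE ij : \sum_l ev (W ij l) * b l
    = ev q ^+ (2 * d).+1 * (x ^+ ij.1 * y ^+ ij.2).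
  under eq_bigr => l _ do rewrite rmorphM -mulrA.
  rewrite -mulr_sumr wE rmorphXn mulrA -exprD; congr (_ ^+ _ * _).
  by rewrite addnS subnK.
have [|v [v0 vW]] := @nontrivial_kernel _ ('I_n * 'I_S)%type
    (fun ij lt => (W ij lt.1)`_lt.2).
  by rewrite !card_prod !card_ord /S /d; nia.
exists d, v; split=> //.
have vW0 l : \sum_ij v ij *: W ij l = 0.
  apply/polyP=> t; rewrite coef_sum coef0.
  have [tS|St] := ltnP t S.
    by rewrite -[RHS](vW (l, Ordinal tS)); apply: eq_bigr => ij _; rewrite coefZ.
  apply: big1 => ij _; rewrite coefZ nth_default ?mulr0 //.
  exact: leq_trans (Wsize ij l) St.
have q1 : ev q ^+ (2 * d).+1 != 0.
  by rewrite expf_neq0 //; apply: contra_neq q0; exact: ev_inj.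
apply: (mulfI q1); rewrite mulr0 mulr_sumr.
transitivity (\sum_l ev (\sum_ij v ij *: W ij l) * b l); last first.
  by apply: big1 => l _; rewrite vW0 rmorph0 mul0r.
under [RHS]eq_bigr => l _ do rewrite rmorph_sum mulr_suml.
rewrite [RHS]exchange_big; apply: eq_bigr => ij _ /=.
rewrite mulrCA -WE mulr_sumr; apply: eq_bigr => l _.
by rewrite mulrA -ev_C -mul_polyC (rmorphM ev _%:P (W ij l)).
Qed.
End Fixed.

Lemma algebraic_relation (x y : K) : function_field iota ->
  exists2 Q : {poly P}, Q != 0 &
    (map_poly (fun p => (map_poly iota p).[x]) Q).[y] = 0.
Proof.
case=> t [t_transc [n [b b_span]]].
pose ev : {rmorphism P -> K} := horner_morph (fun c : k => mulrC t (iota c)).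
have [||f|d [a [[[i0 j0] a0] aE]]] := @monomials_dependent ev n b _ _ _ x y.
- by move=> c; rewrite /ev /= horner_morphC.
- by move=> p p0; apply: t_transc; rewrite /root; exact/eqP.
- exact: b_span.
pose ex : {rmorphism P -> K} := horner_morph (fun c : k => mulrC x (iota c)).
pose coefs j : P := \poly_(i < d.+1) (if insub i is Some i' then a (i', j) else 0).
pose Q : {poly P} := \poly_(j < d.+1) (if insub j is Some j' then coefs j' else 0).
have QE j : Q`_(j : 'I_d.+1) = coefs j.
  by rewrite coef_poly ltn_ord; case: insubP => [j' _ /val_inj ->|]; rewrite ?ltn_ord.
have cE i j : (coefs j)`_(i : 'I_d.+1) = a (i, j).
  by rewrite coef_poly ltn_ord; case: insubP => [i' _ /val_inj ->|]; rewrite ?ltn_ord.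
exists Q; first by apply: contra_neq a0 => Q0; rewrite -cE -QE Q0 !coef0.
rewrite -[map_poly _ Q]/(map_poly ex Q).
have sz : (size (map_poly ex Q) <= d.+1)%N.
  by apply: leq_trans (size_poly _ _) _; exact: size_poly.
rewrite (horner_coef_wide _ sz) -[RHS]aE.
rewrite [RHS](eq_bigr (fun ij => iota (a (ij.1, ij.2)) * (x ^+ ij.1 * y ^+ ij.2)));
  last by case.
rewrite -(pair_bigA _ (fun i j => iota (a (i, j)) * (x ^+ i * y ^+ j))) /=.
rewrite exchange_big /=; apply: eq_bigr => j _.
rewrite coef_map QE /ex /= /horner_morph.
have szj : (size (map_poly iota (coefs j)) <= d.+1)%N.
  by rewrite size_map_poly; exact: size_poly.
rewrite (horner_coef_wide _ szj) mulr_suml; apply: eq_bigr => i _.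
by rewrite coef_map cE mulrA.
Qed.
End AlgebraicRelation.

(** * Calculus of formal power series *)

Section Fps.
Variable k : fieldType.
Implicit Types f g : fps k.
Local Notation Xn n := (fps_of_poly ('X^n : {poly k})).

Lemma fps_of_polyD (p q : {poly k}) :
  fps_of_poly (p + q) = fps_of_poly p + fps_of_poly q.
Proof. by apply/funext => n; rewrite fpsD /fps_of_poly coefD. Qed.

Lemma fps_of_polyM (p q : {poly k}) :
  fps_of_poly (p * q) = fps_of_poly p * fps_of_poly q.
Proof. by apply/funext => n; rewrite fpsM /fps_of_poly coefM. Qed.

Lemma fps_of_poly1 : fps_of_poly (1 : {poly k}) = 1.
Proof. by apply/funext => n; rewrite /fps_of_poly coef1. Qed.

Lemma fpsXnM n f i : (Xn n * f) i = if (i < n)%N then 0 else f (i - n)%N.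
Proof.
rewrite fpsM /fps_of_poly; case: ltnP => [ni|ni].
  apply: big1 => j _; rewrite coefXn ltn_eqF ?mul0r //.
  exact: leq_ltn_trans (leq_ord j) ni.
have ni' : (n < i.+1)%N by [].
rewrite (bigD1 (Ordinal ni')) //= coefXn eqxx mul1r big1 ?addr0 // => j jn.
rewrite coefXn; case: eqP => [jE|_]; last by rewrite mul0r.
by case/eqP: jn; exact: val_inj.
Qed.

Lemma fpsXn_inj n f g : Xn n * f = Xn n * g -> f = g.
Proof.
move=> fg; apply/funext => i.
have := congr1 (fun h : fps k => h (i + n)%N) fg.
by rewrite /= !fpsXnM ltnNge leq_addl /= addnK.
Qed.

Lemma fpsXn_dvd n f : (forall i, (i < n)%N -> f i = 0) ->
  exists g, f = Xn n * g.
Proof.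
move=> f0; exists (fun i => f (i + n)%N); apply/funext => i; rewrite fpsXnM.
by case: ltnP => [/f0 //|ni]; rewrite subnK.
Qed.

Lemma fps_derivD f g : fps_deriv (f + g) = fps_deriv f + fps_deriv g.
Proof. by apply/funext => n; rewrite fpsD /fps_deriv fpsD mulrDr. Qed.

Lemma eulerM f g : euler (f * g) = euler f * g + f * euler g.
Proof.
apply/funext => n; rewrite fpsD /euler !fpsM mulr_sumr -big_split.
apply: eq_bigr => i _ /=.
have -> : n%:R = i%:R + (n - i)%:R :> k by rewrite -natrD subnKC // leq_ord.
by ring.
Qed.

Lemma euler_deriv f : euler f = Xn 1 * fps_deriv f.
Proof.
apply/funext => -[|n]; rewrite fpsXnM /euler ?mul0r //=.
by rewrite subn1 /fps_deriv.
Qed.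

Lemma fps_derivM f g : fps_deriv (f * g) = fps_deriv f * g + f * fps_deriv g.
Proof.
apply: (@fpsXn_inj 1); rewrite mulrDr -euler_deriv eulerM !euler_deriv.
by rewrite -mulrA; congr (_ + _); rewrite mulrCA.
Qed.

Lemma fps_deriv1 : fps_deriv 1 = 0 :> fps k.
Proof. by apply/funext => n; rewrite /fps_deriv -fps_of_poly1 /fps_of_poly coef1 mulr0. Qed.

Lemma fps_derivX : fps_deriv (Xn 1) = 1.
Proof.
apply/funext => n; rewrite -fps_of_poly1 /fps_deriv /fps_of_poly coefXn coef1.
by case: n => [|n]; rewrite /= ?mulr1 ?mulr0.
Qed.
End Fps.

(** * Taylor expansion and valuation on the local ring *)

Section LocalRing.
Variables (k K : fieldType) (iota : {rmorphism k -> K}).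
Variables (x : point iota) (z : uniformizer x).
Local Notation O := (local_ring x).
Local Notation Xn n := (fps_of_poly ('X^n : {poly k})).
Implicit Types f g u : O.

Lemma valO f : to_K x f \in val_ring x. Proof. exact: (valP f). Qed.

Lemma to_K_neq0 f : f != 0 -> to_K x f != 0.
Proof. by rewrite -val_eqE. Qed.

Lemma unif_K_neq0 : to_K x (unif z) != 0.
Proof. by have := unif_neq0 z; rewrite -val_eqE. Qed.

Lemma expansion_zM f : expansion z (unif z * f) = (0, f).
Proof. by apply: expansionE; rewrite raddf0 add0r. Qed.

Lemma taylor0 f : taylor z f 0%N = (expansion z f).1. Proof. by []. Qed.
Lemma taylorS f n : taylor z f n.+1 = taylor z (expansion z f).2 n.
Proof. by rewrite /taylor iterSr. Qed.

Lemma inverseO u : (to_K x u)^-1 \in val_ring x -> u != 0 -> exists u', u * u' = 1.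
Proof.
move=> uV u0; exists (Sub ((to_K x u)^-1) uV : O); apply: val_inj.
by rewrite /= divff // val_eqE.
Qed.

Lemma taylor0_unit u : taylor z u 0%N != 0 -> exists u', u * u' = 1.
Proof.
move=> u0; have uN0 : u != 0 by apply: contra_neq u0 => ->; rewrite raddf0.
apply: inverseO => //; apply/negPn/negP => uV.
have um : to_K x u \in maximal_ideal x.
  by apply/andP; split; [exact: valO|rewrite uV orbT].
have [/(_ um)[g gE] _] := unif_gen z u.
by move: u0; rewrite taylor0 gE expansion_zM eqxx.
Qed.

Lemma z_not_unit u : unif z * u <> 1.
Proof.
move/(congr1 (taylor z)) => /(congr1 (fun f : fps k => f 0%N)).
rewrite rmorph1 taylor0 expansion_zM /= => /eqP.
by rewrite eq_sym -[X in X == _]/(1%:R : k) oner_eq0.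
Qed.

Lemma taylor_z : taylor z (unif z) = Xn 1.
Proof.
apply/funext => n; rewrite /fps_of_poly coefXn -[X in taylor z X]mulr1.
case: n => [|n]; first by rewrite taylor0 expansion_zM.
rewrite taylorS expansion_zM /= rmorph1 -fps_of_poly1 /fps_of_poly coef1.
by case: n.
Qed.

Lemma taylor_zn n : taylor z (unif z ^+ n) = Xn n.
Proof.
elim: n => [|n IH]; first by rewrite expr0 rmorph1 expr0 fps_of_poly1.
by rewrite exprS rmorphM /= IH taylor_z -fps_of_polyM -exprD add1n.
Qed.

Lemma taylor_const c : taylor z (local_const x c) = fps_of_poly c%:P.
Proof.
have E c' : expansion z (local_const x c') = (c', 0).
  by apply: expansionE; rewrite mulr0 addr0.
apply/funext => n; rewrite /fps_of_poly coefC; case: n => [|n].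
  by rewrite taylor0 E.
by rewrite taylorS E raddf0.
Qed.

Lemma taylor_eval p : taylor z (eval_unif z p) = fps_of_poly p.
Proof.
elim/poly_ind: p => [|p c IH].
  by rewrite !rmorph0; apply/funext => n; rewrite /fps_of_poly coef0.
have -> : eval_unif z (p * 'X + c%:P) = eval_unif z p * unif z + local_const x c.
  by rewrite rmorphD rmorphM /= /eval_unif /= horner_morphX horner_morphC.
rewrite rmorphD rmorphM /= IH taylor_z taylor_const.
by rewrite fps_of_polyD fps_of_polyM expr1.
Qed.

Lemma taylor_dvd n f : (forall i, (i < n)%N -> taylor z f i = 0) ->
  exists g, f = unif z ^+ n * g.
Proof.
elim: n f => [|n IH] f f0; first by exists f; rewrite mul1r.
have [|g gE] := IH (expansion z f).2.
  by move=> i ni; rewrite -taylorS f0.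
exists g; rewrite (expansionP z f) -taylor0 f0 // raddf0 add0r gE.
by rewrite mulrA -exprS.
Qed.

(** In terms of a parameter t, f = t^a u and z = t^c w with u, w units, and c > 0 because z is not a
    unit. If z^(a+1) divided f, then t^-1 would lie in the ring. *)
Lemma dvr_bound f : f != 0 -> exists n, forall g, f <> unif z ^+ n * g.
Proof.
move=> f0; have [t [t0 tm] dvr] := val_ring_dvr x.
have /andP[tO] := tm; rewrite (negPf t0) /= => tV.
have tnat (g : O) : g != 0 -> exists (n : nat) (u : K),
    [/\ u \in val_ring x, u^-1 \in val_ring x & to_K x g = t ^+ n * u].
  move=> g0; have gK0 := to_K_neq0 g0.
  have [[n|n] [u [uO uV gE]]] := dvr _ gK0; first by exists n, u.
  case/negP: tV; have -> : t^-1 = t ^+ n * to_K x g * u^-1.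
    have u0 : u != 0 by apply: contra_neq gK0 => u0; rewrite gE u0 mulr0.
    rewrite gE -[t ^ Negz n]/((t ^+ n.+1)^-1) exprS; field.
    by rewrite u0 t0 expf_neq0.
  by rewrite !rpredM ?rpredX ?valO.
have [a [u [uO uV fE]]] := tnat f f0.
have [c [w [wO wV zE]]] := tnat (unif z) (unif_neq0 z).
have c0 : (0 < c)%N.
  rewrite lt0n; apply/eqP => c0.
  have [|z' zz'] := @inverseO (unif z) _ (unif_neq0 z); last exact: z_not_unit zz'.
  by rewrite zE c0 expr0 mul1r.
exists a.+1 => g gE; case/negP: tV.
have E : t ^+ a * u = t ^+ (c * a.+1) * (w ^+ a.+1 * to_K x g).
  by rewrite -fE gE rmorphM rmorphXn zE exprMn exprM mulrA.
have u0 : u != 0.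
  have fK0 := to_K_neq0 f0.
  by apply: contra_neq fK0 => u0; rewrite fE u0 mulr0.
have ca : (a.+1 <= c * a.+1)%N by rewrite leq_pmull.
have -> : t^-1 = t ^+ (c * a.+1 - a.+1) * (w ^+ a.+1 * to_K x g) * u^-1.
  apply: (mulfI (expf_neq0 a.+1 t0)); rewrite !mulrA -exprD subnKC //.
  by rewrite -[_ * _ * _ * u^-1]/((t ^+ (c * a.+1) * w ^+ a.+1 * to_K x g) / u)
     -[X in _ = X / _]mulrA -E mulfK // exprSr mulfK.
by rewrite !rpredM ?rpredX ?valO.
Qed.

Lemma dvr_factor f : f != 0 ->
  exists n u u', f = unif z ^+ n * u /\ u * u' = 1.
Proof.
case/dvr_bound=> n; elim: n f => [|n IH] f nf.
  by case: (nf f); rewrite mul1r.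
have [c0|c0] := eqVneq (taylor z f 0%N) 0; last first.
  by have [u' uu'] := taylor0_unit c0; exists 0%N, f, u'; rewrite mul1r.
have [|g gE] := @taylor_dvd 1 f; first by case.
have [|a [u [u' [gE' uu']]]] := IH g.
  by move=> h hE; apply: (nf h); rewrite gE hE mulrA -exprD add1n.
by exists a.+1, u, u'; rewrite gE gE' mulrA -exprD add1n.
Qed.

(** A nonzero difference is z^n times a unit, so its n-th Taylor coefficient is nonzero. *)
Lemma taylor_inj f g : taylor z f = taylor z g -> f = g.
Proof.
move=> fg; apply/eqP; rewrite -subr_eq0; apply/negP => /negP/dvr_factor.
case=> n [u [u' [fgE uu']]].
have : taylor z (f - g) n = 0 by rewrite rmorphB /= fg subrr.
rewrite fgE rmorphM /= taylor_zn fpsXnM ltnn subnn => u0.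
have := congr1 (fun h : fps k => h 0%N) (congr1 (taylor z) uu').
rewrite rmorphM rmorph1 /= fpsM big_ord1 u0 mul0r => /eqP.
by rewrite eq_sym -[X in X == _]/(1%:R : k) oner_eq0.
Qed.

Lemma K_denominator (f : K) : exists n g, f * to_K x (unif z) ^+ n = to_K x g.
Proof.
have [->|f0] := eqVneq f 0.
  by exists 0%N, 0; rewrite mul0r raddf0.
have [t [t0 tm] dvr] := val_ring_dvr x; have [/andP[tO _]] := (tm, tm).
have [[n|n] [u [uO uV fE]]] := dvr f f0.
  have fO : f \in val_ring x by rewrite fE rpredM ?rpredX.
  by exists 0%N, (Sub f fO : O); rewrite mulr1.
have u0 : u != 0 by apply: contra_neq f0 => u0; rewrite fE u0 mulr0.
have fV : f^-1 \in val_ring x.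
  by rewrite fE -[t ^ Negz n]/((t ^+ n.+1)^-1) invfM invrK rpredM ?rpredX.
have [|a [w [w' [gE ww']]]] := @dvr_factor (Sub f^-1 fV : O).
  by rewrite -val_eqE /= invr_eq0.
exists a, w'; have /(congr1 (to_K x)) := gE; rewrite rmorphM rmorphXn /= => fVE.
have /(congr1 (to_K x)) := ww'; rewrite rmorphM rmorph1 => ww1.
apply: (mulfI (invr_neq0 f0)); rewrite mulKf //.
by rewrite [in RHS]fVE -mulrA [X in _ * X]ww1 mulr1.
Qed.
End LocalRing.

(** * The derivation d/dz of the local ring and of the function field *)

Section Derivations.
Variables (k K : fieldType) (iota : {rmorphism k -> K}).
Hypothesis natr_neq0 : forall n, (n.+1)%:R != 0 :> k.
Variables (x : point iota) (z : uniformizer x).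
Local Notation O := (local_ring x).
Local Notation P := {poly k}.
Local Notation Xn n := (fps_of_poly ('X^n : P)).
Local Notation zK := (to_K x (unif z)).
Implicit Types f g u : O.

Definition biv_eval (g : O) (Q : {poly P}) : O := (map_poly (eval_unif z) Q).[g].

Lemma biv_evalMXaddC g Q p :
  biv_eval g (Q * 'X + p%:P) = biv_eval g Q * g + eval_unif z p.
Proof. by rewrite /biv_eval rmorphD rmorphM /= map_polyX map_polyC !hornerE. Qed.

Lemma to_K_eval p : to_K x (eval_unif z p) = (map_poly iota p).[zK].
Proof.
rewrite -[eval_unif z p]/((map_poly (local_const x) p).[unif z]).
by rewrite -(horner_map (to_K x)) -map_poly_comp.
Qed.

Lemma to_K_biv_eval g Q : to_K x (biv_eval g Q) =
  (map_poly (fun p : P => (map_poly iota p).[zK]) Q).[to_K x g].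
Proof.
rewrite /biv_eval -(horner_map (to_K x)) -map_poly_comp; congr horner.
by apply: eq_map_poly => p /=; exact: to_K_eval.
Qed.

Section Rule.
Variables (M : lmodType O) (d : O -> M).
Hypothesis dD : forall f g, d (f + g) = d f + d g.
Hypothesis dM : forall f g, d (f * g) = f *: d g + g *: d f.
Hypothesis dC : forall c, d (local_const x c) = 0.

Lemma deriv_eval p : d (eval_unif z p) = eval_unif z p^`() *: d (unif z).
Proof.
elim/poly_ind: p => [|p c IH].
  by rewrite deriv0 rmorph0 scale0r -(raddf0 (local_const x)) dC.
have E q c' : eval_unif z (q * 'X + c'%:P) = eval_unif z q * unif z + local_const x c'.
  by rewrite rmorphD rmorphM /= /eval_unif /= horner_morphX horner_morphC.
rewrite E dD dM dC addr0 IH derivD derivM derivX derivC addr0 mulr1.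
rewrite rmorphD rmorphM /= scalerDl addrC scalerA; congr (_ *: _ + _).
by rewrite mulrC; congr (_ * _); rewrite /eval_unif /= horner_morphX.
Qed.

Lemma deriv_biv_eval g Q : d (biv_eval g Q) =
  biv_eval g (map_poly (@deriv k) Q) *: d (unif z) + biv_eval g Q^`() *: d g.
Proof.
elim/poly_ind: Q => [|Q p IH].
  rewrite deriv0 !raddf0 /biv_eval !rmorph0 !horner0 !scale0r addr0.
  by rewrite -(raddf0 (local_const x)) dC.
have -> : map_poly (@deriv k) (Q * 'X + p%:P)
    = map_poly (@deriv k) Q * 'X + p^`()%:P.
  apply/polyP=> i; rewrite coef_map coefD coefMX coefC !coefD coefMX coefC.
  by case: i => [|i]; rewrite /= ?coef_map ?add0r ?addr0.
rewrite !biv_evalMXaddC dD dM IH deriv_eval.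
have -> : (Q * 'X + p%:P)^`() = Q^`() * 'X + Q.
  by rewrite derivD derivM derivX derivC addr0 mulr1.
have -> : biv_eval g (Q^`() * 'X + Q) = biv_eval g Q^`() * g + biv_eval g Q.
  by rewrite /biv_eval rmorphD rmorphM /= map_polyX !hornerE.
rewrite scalerDr !scalerA !scalerDl [g * _]mulrC [g * _]mulrC.
have AC (a b c e : M) : a + (b + c) + e = b + e + (c + a).
  by rewrite [a + _]addrC -addrA [a + e]addrC addrACA.
exact: AC.
Qed.
End Rule.

Lemma deriv_eq0 (Q : {poly P}) : Q^`() = 0 -> Q = (Q`_0)%:P.
Proof.
move=> Q0; apply/polyP=> -[|i]; rewrite coefC //=.
have /eqP := congr1 (fun q : {poly P} => q`_i) Q0; rewrite coef0 coef_deriv.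
rewrite -mulr_natl mulf_eq0 => /orP[|/eqP //].
by rewrite -polyC_natr polyC_eq0 (negPf (natr_neq0 i)).
Qed.

Lemma eval_unif_eq0 p : eval_unif z p = 0 -> p = 0.
Proof.
move=> p0; apply/polyP => i; have := taylor_eval z p; rewrite p0 rmorph0.
by move/(congr1 (fun f : fps k => f i)); rewrite coef0.
Qed.

(** If the Y-derivative of a relation Q(z, Y) also vanishes at g, it is a relation of smaller
    degree. In characteristic 0 it is zero only when Q is constant in Y, and p(z) = 0 forces p = 0
    since the Taylor series of p(z) is p. *)
Lemma separable_relation g : function_field iota ->
  exists2 Q, biv_eval g Q = 0 & biv_eval g Q^`() != 0.
Proof.
move=> hK; have [Q Q0 QE] := algebraic_relation zK (to_K x g) hK.
have {}QE : biv_eval g Q = 0 by apply: val_inj; rewrite -[LHS]to_K_biv_eval in QE *.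
elim: (size Q) {-2}Q (leqnn (size Q)) Q0 QE => {Q} [|n IH] Q sQ Q0 QE.
  by move: sQ; rewrite leqn0 size_poly_eq0 (negPf Q0).
have [Q'E|Q'E] := eqVneq (biv_eval g Q^`()) 0; last by exists Q.
apply: (IH Q^`()) => //.
  by rewrite -ltnS; apply: leq_trans sQ; exact: lt_size_deriv.
apply: contra_neq Q0 => /deriv_eq0 QC; rewrite QC.
suff -> : Q`_0 = 0 by rewrite polyC0.
by apply: eval_unif_eq0; rewrite -QE QC /biv_eval map_polyC hornerC /= coefC.
Qed.

(** Differentiating Q(z, g) = 0 gives u dg = w dz for every derivation trivial on constants, where u
    is the Y-derivative of Q at (z, g) and -w its z-derivative. So h has to be w/u. *)
Lemma derivative_exists g : function_field iota -> exists h : O,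
  taylor z h = fps_deriv (taylor z g) /\
  forall (M : lmodType K) (delta : K -> M), is_derivation iota delta ->
    delta (to_K x g) = to_K x h *: delta zK.
Proof.
move=> hK; have [Q QE] := separable_relation g hK.
set u := biv_eval g Q^`(); pose w := - biv_eval g (map_poly (@deriv k) Q).
move=> u0; have [n [u1 [u' [uE uu']]]] := dvr_factor z u0.
have rule (M : lmodType O) (d : O -> M) : (forall f g, d (f + g) = d f + d g) ->
    (forall f g, d (f * g) = f *: d g + g *: d f) ->
    (forall c, d (local_const x c) = 0) -> u *: d g = w *: d (unif z).
  move=> dD dM dC; have := deriv_biv_eval dD dM dC g Q.
  rewrite QE -(raddf0 (local_const x)) dC => /eqP.
  by rewrite eq_sym addrC addr_eq0 -scaleNr => /eqP.
have uw : taylor z u * fps_deriv (taylor z g) = taylor z w.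
  have := rule (restr (taylor z) ((fps k)^o : lmodType (fps k)))
    (fun f => fps_deriv (taylor z f)).
  rewrite taylor_z fps_derivX => E; rewrite -[RHS]mulr1; apply: E => [f f'|f f'|c].
  - by rewrite raddfD; exact: fps_derivD.
  - rewrite rmorphM; have := fps_derivM (taylor z f) (taylor z f') => ->.
    by rewrite addrC [X in _ + X]mulrC.
  - rewrite taylor_const; apply/funext => i.
    by rewrite /fps_deriv /fps_of_poly coefC mulr0.
(* The relation for power series shows that w is divisible by the power of z contained in u, hence
   that w/u lies in the local ring. *)
have [|w1 wE] := @taylor_dvd _ _ _ _ z n w.
  move=> i ni; rewrite -uw uE rmorphM /= taylor_zn -mulrA.
  by rewrite fpsXnM ni.
have u1w1 : taylor z u1 * fps_deriv (taylor z g) = taylor z w1.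
  apply: (@fpsXn_inj _ n); rewrite mulrA -!(taylor_zn z n).
  by rewrite -!rmorphM /= -uE uw wE.
exists (u' * w1); split.
  by rewrite rmorphM /= -u1w1 mulrA -rmorphM [u' * _]mulrC uu' rmorph1 mul1r.
move=> M delta [deltaD deltaM deltaC].
have E : to_K x u *: delta (to_K x g) = to_K x w *: delta zK.
  apply: (rule (restr (to_K x) M) (fun f => delta (to_K x f))) => [f f'|f f'|c].
  - by rewrite rmorphD deltaD.
  - by rewrite rmorphM deltaM.
  - exact: deltaC.
rewrite uE wE !rmorphM in E.
have zn0 : to_K x (unif z ^+ n) != 0 by rewrite rmorphXn expf_neq0 // unif_K_neq0.
have u1K : to_K x u' * to_K x u1 = 1 by rewrite -rmorphM mulrC uu' rmorph1.
rewrite -[LHS]scale1r -u1K -scalerA rmorphM -scalerA; congr (_ *: _).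
by apply: (scalerI zn0); rewrite !scalerA.
Qed.

Section Extension.
Hypothesis hK : function_field iota.

Definition derivO g : O := projT1 (cid (derivative_exists g hK)).
Lemma taylor_derivO g : taylor z (derivO g) = fps_deriv (taylor z g).
Proof. exact: (projT2 (cid (derivative_exists g hK))).1. Qed.
Lemma derivation_derivO g (M : lmodType K) (delta : K -> M) :
  is_derivation iota delta -> delta (to_K x g) = to_K x (derivO g) *: delta zK.
Proof. exact: (projT2 (cid (derivative_exists g hK))).2. Qed.

Lemma derivOD f g : derivO (f + g) = derivO f + derivO g.
Proof.
apply: (@taylor_inj _ _ _ _ z); rewrite rmorphD /= !taylor_derivO rmorphD.
exact: fps_derivD.
Qed.

Lemma derivOM f g : derivO (f * g) = f * derivO g + g * derivO f.
Proof.
apply: (@taylor_inj _ _ _ _ z); rewrite rmorphD !rmorphM /= !taylor_derivO.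
by rewrite rmorphM /= fps_derivM addrC [fps_deriv _ * _]mulrC.
Qed.

Lemma derivOC c : derivO (local_const x c) = 0.
Proof.
apply: (@taylor_inj _ _ _ _ z); rewrite taylor_derivO taylor_const rmorph0.
by apply/funext => i; rewrite /fps_deriv /fps_of_poly coefC mulr0.
Qed.

Lemma derivOz : derivO (unif z) = 1.
Proof.
by apply: (@taylor_inj _ _ _ _ z); rewrite taylor_derivO taylor_z fps_derivX rmorph1.
Qed.

Lemma derivOzn n : derivO (unif z ^+ n) = n%:R * unif z ^+ n.-1.
Proof.
elim: n => [|n IH]; first by rewrite expr0 mul0r -(rmorph1 (local_const x)) derivOC.
rewrite exprS derivOM IH derivOz mulr1 mulrCA.
case: n {IH} => [|n]; first by rewrite mul0r add0r expr0 mulr1.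
by rewrite /= -exprS -[in RHS]addn1 natrD mulrDl mul1r.
Qed.

Definition denomK (f : K) := projT1 (cid (K_denominator z f)).
Definition numerK (f : K) : O :=
  projT1 (cid (projT2 (cid (K_denominator z f)))).

Definition derivK (f : K) : K :=
  to_K x (derivO (numerK f)) / zK ^+ denomK f - (denomK f)%:R * f / zK.

(** The quotient rule for f = g/z^n does not depend on the denominator: enlarging n does not change
    its value, and any two denominators have a common enlargement. *)
Lemma derivKE (f : K) n g : f * zK ^+ n = to_K x g ->
  derivK f = to_K x (derivO g) / zK ^+ n - n%:R * f / zK.
Proof.
have z0 := unif_K_neq0 z.
suff up (f' : K) n' (g' : O) a : f' * zK ^+ n' = to_K x g' ->
    to_K x (derivO g') / zK ^+ n' - n'%:R * f' / zK
    = to_K x (derivO (g' * unif z ^+ a)) / zK ^+ (n' + a) - (n' + a)%:R * f' / zK.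
  have E : f * zK ^+ denomK f = to_K x (numerK f).
    exact: (projT2 (cid (projT2 (cid (K_denominator z f))))).
  move=> fE; rewrite /derivK (up _ _ _ n E) (up _ _ _ (denomK f) fE) [in RHS]addnC.
  congr (to_K x (derivO _) / _ - _); apply: val_inj.
  rewrite -[LHS]/(to_K x _) -[RHS]/(to_K x _) !rmorphM !rmorphXn -E -fE.
  by rewrite mulrAC.
move=> f'E; rewrite derivOM derivOzn rmorphD !rmorphM !rmorphXn -f'E rmorph_nat.
rewrite exprD natrD; case: a => [|a]; first by rewrite /=; field; rewrite ?z0 ?expf_neq0.
rewrite /= exprS; field.
by rewrite z0 !expf_neq0.
Qed.

Lemma derivK_derivation : is_derivation iota (derivK : K -> K^o).
Proof.
have z0 := unif_K_neq0 z; split=> [f g|f g|c].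
- have [n [u uE]] := K_denominator z f; have [n' [u' uE']] := K_denominator z g.
  have E1 : f * zK ^+ (n + n') = to_K x (u * unif z ^+ n').
    by rewrite rmorphM rmorphXn -uE exprD mulrA.
  have E2 : g * zK ^+ (n + n') = to_K x (u' * unif z ^+ n).
    by rewrite rmorphM rmorphXn -uE' addnC exprD mulrA.
  rewrite (derivKE E1) (derivKE E2) (@derivKE _ (n + n') (u * unif z ^+ n' + u' * unif z ^+ n)).
    by rewrite derivOD rmorphD; ring.
  by rewrite mulrDl rmorphD E1 E2.
- have [n [u uE]] := K_denominator z f; have [n' [u' uE']] := K_denominator z g.
  have E : f * g * zK ^+ (n + n') = to_K x (u * u').
    by rewrite rmorphM -uE -uE' exprD; ring.
  rewrite (derivKE uE) (derivKE uE') (derivKE E) derivOM rmorphD !rmorphM -uE -uE'.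
  rewrite -[_ *: _]/(f * _) -[g *: _]/(g * _) exprD natrD.
  by field; rewrite z0 !expf_neq0.
- rewrite (@derivKE _ 0 (local_const x c)) ?mulr1 // derivOC rmorph0.
  by rewrite !mul0r subrr.
Qed.

Lemma derivKz : derivK zK = 1.
Proof.
rewrite (@derivKE _ 0 (unif z)) ?mulr1 // derivOz rmorph1 divr1.
by rewrite !mul0r subr0.
Qed.
End Extension.
End Derivations.

Lemma basis_coord (A : nzRingType) (M : lmodType A) (n : nat) (b : 'I_n -> M) :
  is_basis b -> exists co : 'I_n -> {linear M -> A^o},
    (forall v, v = \sum_i (co i v : A) *: b i) /\
    (forall (c : 'I_n -> A) i, co i (\sum_j c j *: b j) = c i).
Proof.
move=> bb; pose c v := projT1 (cid (bb v)).
have cP v : v = \sum_i c v i *: b i by rewrite /c; case: cid => ? [].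
have cU v (d : {ffun 'I_n -> A}) : v = \sum_i d i *: b i -> c v = d.
  by rewrite /c; case: cid => ? [] /= _ h /h.
have cE (d : 'I_n -> A) i : c (\sum_j d j *: b j) i = d i.
  rewrite (cU _ [ffun j => d j]) ?ffunE //.
  by apply: eq_bigr => j _; rewrite ffunE.
have lin i : linear (fun v => c v i : A^o).
  move=> a u v; have -> : a *: u + v = \sum_j (a * c u j + c v j) *: b j.
    rewrite {1}(cP u) {1}(cP v) scaler_sumr -big_split; apply: eq_bigr => j _ /=.
    by rewrite scalerDl scalerA.
  by rewrite cE.
exists (fun i => projT1 (cid (linear_exists (lin i)))); split=> [v|d i].
  by rewrite {1}(cP v); apply: eq_bigr => i _; case: cid => /= F ->.
by case: cid => /= F ->.
Qed.

(** * Differentials and the connection on a stalk *)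

Section Kahler.
Variables (k K : fieldType) (iota : {rmorphism k -> K}).

Lemma diff_derivation : is_derivation iota (@diff k K iota).
Proof.
have ext (M : lmodType K) (h : K -> M) : is_derivation iota h ->
    exists2 F : {linear kahler iota -> M}, (F =1 presented_lift h)
      & forall f, F (diff iota f) = h f.
  move=> dh; have [F FE] := linear_exists (presented_lift_linear dh).
  by exists F => // f; rewrite FE presented_lift_generator.
split=> [f g|f g|c]; apply: presented_ext => M h dh;
  have [F lE FE] := ext _ _ dh; rewrite -!lE; case: dh => hD hM hC.
- by rewrite linearD !FE.
- by rewrite linearD !linearZ /= !FE.
- by rewrite linear0 FE.
Qed.
End Kahler.

Section Stalk.
Variables (k K : fieldType) (iota : {rmorphism k -> K}).
Hypothesis natr_neq0 : forall n, (n.+1)%:R != 0 :> k.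
Hypothesis hK : function_field iota.
Variables (r : nat) (E : bundle iota r) (D : divisor iota) (nabla : connection E D).
Variables (x : point iota) (m : nat) (z : uniformizer x).
Hypothesis hD : mult D x = m%:Z.
Local Notation O := (local_ring x).
Local Notation P := {poly k}.
Local Notation zK := (to_K x (unif z)).
Local Notation stalk := (stalk E x).
Local Notation G := (generic_fibre E).
Local Notation id_K := (idfun : {rmorphism K -> K}).
Local Notation derivO := (derivO natr_neq0 z hK).

Definition omega0 : kahler iota := zK ^- m *: diff iota zK.

Lemma stalk_scale (a : O) (e : stalk) : val (a *: e) = to_K x a *: (val e : G).
Proof. by []. Qed.

(** The extension of d/dz to K defines a functional on differentials that is nonzero on [omega0];
    paired with the coordinates of the fibre it recovers u. *)
Lemma tens_omega0_inj (u v : G) :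
  tens id_K u omega0 = tens id_K v omega0 -> u = v.
Proof.
move=> uv; have [b bb _] := lattice_free E x.
have [co [coP _]] := basis_coord bb.
have [F FE] := linear_exists (presented_lift_linear (derivK_derivation natr_neq0 z hK)).
have Fz : F (diff iota zK) = 1.
  rewrite FE (presented_lift_generator _ (derivK_derivation natr_neq0 z hK)).
  exact (derivKz natr_neq0 z hK).
have key i : co i u = co i v.
  pose g (u : G) (w : kahler iota) : K^o := (co i u : K) *: F w.
  have bg : is_bilinear id_K (fun p => g p.1 p.2).
    split=> [u1 u2 n|u1 n p|a u1 n|a u1 n]; rewrite /g /=.
    - by rewrite linearD scalerDl.
    - by rewrite linearD scalerDr.
    - rewrite (linearZZ (co i) a u1) (linearZZ F a n).
      rewrite -[LHS]/((a * co i u1) * F n) -[RHS]/(co i u1 * (a * F n)).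
      by rewrite mulrA [a * _]mulrC.
    - rewrite (linearZZ F a n); exact: scaler_swap.
  have := congr1 (tens_lift g) uv; rewrite !(tens_liftE _ _ bg) /g.
  have w0 : F omega0 != 0.
    rewrite (linearZZ F) Fz -[_ *: _]/((zK ^- m) * 1) mulr1 invr_eq0.
    by rewrite expf_neq0 // unif_K_neq0.
  by move/(mulIf w0).
by rewrite (coP u) (coP v); apply: eq_bigr => i _; rewrite key.
Qed.

(** The pole condition expresses nabla e through forms f dz/z^m with f regular; collecting them
    exhibits the element of the stalk that [xget] looks for. *)
Lemma nabla_zP (e : stalk) :
  nabla (val e) = tens id_K (val (nabla_z nabla z m e) : G) omega0.
Proof.
rewrite /nabla_z; apply: (@xgetPex _ 0 [set u : stalk | nabla (val e) =
  tens id_K (val u : G) omega0]).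
have [s sP ->] := conn_poles nabla (subvalP e).
suff: exists2 u : G, u \in smem (lattice E x) &
    \sum_(p <- s) tens id_K p.1 p.2 = tens id_K u omega0.
  by case=> u uL ->; exists (insub0 (lattice E x) u); rewrite /= insub0K.
elim: s sP => [|[u w] s IH] sP.
  by exists 0; [exact: (rpred0 (lattice E x))|rewrite big_nil tens0l].
have [v vL vE] : exists2 u : G, u \in smem (lattice E x) &
    \sum_(p <- s) tens id_K p.1 p.2 = tens id_K u omega0.
  by apply: IH => p ps; apply: sP; rewrite inE ps orbT.
have [/= uL wP] := sP (u, w) (mem_head _ _); have [f fE] := wP z.
exists (to_K x f *: u + v).
  have fu : f *: (u : restr (to_K x) G) \in smem (lattice E x) by rewrite rpredZ.
  exact: (rpredD fu vL).
rewrite big_cons vE /= tensDl; congr (_ + _).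
rewrite tensZl; congr tens; rewrite fE hD /omega0.
by rewrite [RHS]scalerA exprnN.
Qed.

Lemma nabla_zU (e u : stalk) :
  nabla (val e) = tens id_K (val u : G) omega0 -> nabla_z nabla z m e = u.
Proof. by rewrite nabla_zP => /tens_omega0_inj/val_inj. Qed.

Lemma nabla_zD (e f : stalk) :
  nabla_z nabla z m (e + f) = nabla_z nabla z m e + nabla_z nabla z m f.
Proof. by apply: nabla_zU; rewrite subvalD connD !nabla_zP -tensDl. Qed.

Lemma nabla_z_leibniz (a : O) (e : stalk) :
  nabla_z nabla z m (a *: e) =
  a *: nabla_z nabla z m e + (unif z ^+ m * derivO a) *: e.
Proof.
apply: nabla_zU; rewrite stalk_scale conn_leibniz nabla_zP subvalD !stalk_scale.
rewrite tensDl !tensZl; congr (_ + _); first by rewrite tensZr.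
congr tens.
rewrite (derivation_derivO natr_neq0 z hK a (diff_derivation iota)) /omega0.
rewrite [RHS]scalerA [in RHS]rmorphM rmorphXn mulrAC mulfV ?mul1r //.
by rewrite expf_neq0 // unif_K_neq0.
Qed.

Lemma stalk_basis : exists s : 'I_r -> stalk, is_basis s.
Proof.
have [b bb bs] := lattice_free E x; have [co [coP coE]] := basis_coord bb.
have bL i : b i \in smem (lattice E x).
  apply/bs; exists (fun j => (j == i)%:R : O).
  rewrite (bigD1 i) //= eqxx rmorph1 scale1r big1 ?addr0 // => j /negPf ->.
  by rewrite rmorph0 scale0r.
exists (fun i => insub0 (lattice E x) (b i)) => e.
have val_sum (c : 'I_r -> O) :
    val (\sum_i c i *: insub0 (lattice E x) (b i) : stalk)
    = \sum_i to_K x (c i) *: b i.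
  elim/big_rec2: _ => [//|i u v _ <-].
  by rewrite subvalD stalk_scale insub0K.
have [c cE] := iffLR (bs (val e)) (subvalP e).
exists [ffun i => c i]; split.
  apply: val_inj; rewrite val_sum cE; apply: eq_bigr => i _.
  by rewrite ffunE.
move=> d dE; apply/ffunP => i; rewrite ffunE; apply: val_inj.
rewrite -[LHS]/(to_K x (c i)) -[RHS]/(to_K x (d i)).
rewrite -(coE (fun i => to_K x (c i)) i) -(coE (fun i => to_K x (d i)) i).
by rewrite -cE -val_sum -dE.
Qed.
End Stalk.

(** * Congruences between power series *)

Section FpsCongruence.
Variable k : fieldType.
Implicit Types f g h : fps k.
Local Notation P := {poly k}.
Local Notation Xn n := (fps_of_poly ('X^n : P)).

Definition fps_eqmod n f g := forall i, (i < n)%N -> f i = g i.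

Lemma fps_eqmodM n f g h : fps_eqmod n f g -> fps_eqmod n (h * f) (h * g).
Proof.
move=> fg i ni; rewrite !fpsM; apply: eq_bigr => j _; rewrite fg //.
by apply: leq_ltn_trans ni; exact: leq_subr.
Qed.

Lemma fps_eqmodD n f g f' g' : fps_eqmod n f g -> fps_eqmod n f' g' ->
  fps_eqmod n (f + f') (g + g').
Proof. by move=> fg fg' i ni; rewrite !fpsD fg ?fg'. Qed.

Lemma fps_eqmod_trans n f g h : fps_eqmod n f g -> fps_eqmod n g h -> fps_eqmod n f h.
Proof. by move=> fg gh i ni; rewrite fg ?gh. Qed.

Lemma fps_eqmod_sym n f g : fps_eqmod n f g -> fps_eqmod n g f.
Proof. by move=> fg i ni; rewrite fg. Qed.

Lemma fps_eqmod_poly n (p q : P) :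
  fps_eqmod n (fps_of_poly p) (fps_of_poly q) <-> 'X^n %| p - q.
Proof.
split=> [h|/dvdp_XnP h i ni]; first apply/dvdp_XnP => i ni.
  by rewrite coefB -[p`_i]/(fps_of_poly p i) h // subrr.
by apply/eqP; rewrite -subr_eq0 -[_ - _]/(p`_i - q`_i) -coefB h.
Qed.

Lemma fps_truncate n f : exists p : P, fps_eqmod n f (fps_of_poly p).
Proof. by exists (\poly_(i < n) f i) => i ni; rewrite /fps_of_poly coef_poly ni. Qed.

Lemma fps_subst_poly r (p : P) : (0 < r)%N ->
  fps_subst r (fps_of_poly p) = fps_of_poly (z_to_w k r p).
Proof.
move=> r0; elim/poly_ind: p => [|p c IH].
  have -> : fps_of_poly (0 : P) = 0.
    by apply/funext => n; rewrite /fps_of_poly coef0.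
  rewrite !rmorph0; apply/funext => n; by rewrite /fps_of_poly coef0.
rewrite fps_of_polyD fps_of_polyM !rmorphD !rmorphM /= IH fps_of_polyD fps_of_polyM.
rewrite zw_X zw_C; congr (_ * _ + _); apply/funext => n; rewrite /fps_subst /fps_of_poly.
  rewrite coefX coefXn; case: ifP => [/dvdnP[q ->]|rn].
    by rewrite mulnK // -{2}[r]mul1n eqn_pmul2r.
  by case: eqP => // nr; rewrite nr dvdnn in rn.
rewrite coefC [RHS]coefC; case: ifP => [/dvdnP[q ->]|rn].
  by rewrite mulnK // muln_eq0 (gtn_eqF r0) orbF.
by case: eqP => // n0; rewrite n0 dvdn0 in rn.
Qed.

Lemma euler_poly (p : P) : euler (fps_of_poly p) = fps_of_poly ('X * p^`()).
Proof.
apply/funext => n; rewrite /euler /fps_of_poly coefXM coef_deriv.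
by case: n => [|n] /=; rewrite ?mul0r // mulr_natl.
Qed.

Lemma euler_eqmod n f g : fps_eqmod n f g -> fps_eqmod n (euler f) (euler g).
Proof. by move=> fg i ni; rewrite /euler fg. Qed.

Lemma nabla_nu_eqmod r m nu n f g :
  fps_eqmod n f g -> fps_eqmod n (nabla_nu r m nu f) (nabla_nu r m nu g).
Proof. by move=> fg; apply: fps_eqmodD; apply: fps_eqmodM => //; exact: euler_eqmod. Qed.

(** By Leibniz, differentiating w^j produces the shift (j/r) dz/z, and differentiating q produces
    the multiple of w^N that an adapted identification allows. *)
Lemma nabla_nu_poly r m nu j (q : P) : (0 < m)%N ->
  nabla_nu r m nu (fps_of_poly ('X^j * q)) = fps_of_poly ('X^j *
    (nu_shift r m nu j * q + 'X^((m * r - r).+1) * ((r%:R^-1)%:P * q^`()))).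
Proof.
move=> m0; rewrite /nabla_nu euler_poly -!fps_of_polyM -fps_of_polyD.
congr fps_of_poly; rewrite /nu_shift derivM derivXn.
have -> : (m * r - r = r * m.-1)%N by rewrite mulnC -{2}[r]muln1 -mulnBr subn1.
have jX : 'X * ('X^(j.-1) *+ j) = j%:R%:P * 'X^j :> P.
  case: j => [|j]; first by rewrite mulr0n mulr0 mul0r.
  by rewrite -mulr_natl mulrCA -exprS polyC_natr.
rewrite mulrDr [_ *+ j * q]mulrC mulrCA jX exprS polyCM.
by move: (nu_w r nu) => v; move: (r%:R^-1)%:P => c; ring.
Qed.
End FpsCongruence.

(** * Reduction of the completion modulo z^m *)

Section Fibre.
Variables (k K : fieldType) (iota : {rmorphism k -> K}).
Variables (r : nat) (E : bundle iota r).
Variables (x : point iota) (z : uniformizer x) (m : nat).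
Local Notation O := (local_ring x).
Local Notation P := {poly k}.
Local Notation stalk := (stalk E x).
Local Notation M := (fibre_mx E z m).
Local Notation class := (qclass (zm_multiples E z m) : stalk -> M).
Local Notation Xn n := (fps_of_poly ('X^n : P)).

Lemma eval_unifXn n : eval_unif z ('X^n : P) = unif z ^+ n.
Proof. by rewrite rmorphXn /= /eval_unif /= horner_morphX. Qed.

Lemma stalk_torsion_free n (e : stalk) : unif z ^+ n *: e = 0 -> e = 0.
Proof.
move=> e0; apply: val_inj; have zn : to_K x (unif z) ^+ n != 0.
  by rewrite expf_neq0 // unif_K_neq0.
apply: (scalerI zn); rewrite -rmorphXn -stalk_scale e0.
by rewrite [RHS]scaler0.
Qed.

Lemma fibre_classZ (p : P) (e : stalk) : class (eval_unif z p *: e) = p *: class e.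
Proof. exact: (linearZZ (qclass (zm_multiples E z m)) p). Qed.

Lemma fibre_classD (e f : stalk) : class (e + f) = class e + class f.
Proof. exact: (linearD (qclass (zm_multiples E z m))). Qed.

Lemma fibre_classB (e f : stalk) : class (e - f) = class e - class f.
Proof. exact: (linearB (qclass (zm_multiples E z m))). Qed.

Lemma fibre_class_eq0 (e : stalk) : class e = 0 <-> exists u, e = unif z ^+ m *: u.
Proof.
rewrite qclass_eq0; split=> [/scaledP[u _ ->]|[u ->]].
  by exists u; rewrite -eval_unifXn.
by apply/scaledP; exists u; rewrite // -eval_unifXn.
Qed.

Lemma fibre_killed (v : M) : 'X^m *: v = 0.
Proof.
have [e ->] := qclass_surj v; rewrite -fibre_classZ.
by apply/fibre_class_eq0; exists e; rewrite eval_unifXn.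
Qed.

Lemma fibre_torsion i (v : M) : (i < m)%N -> 'X^i *: v = 0 -> exists u, v = 'X *: u.
Proof.
move=> im; have [e ->] := qclass_surj v; rewrite -fibre_classZ eval_unifXn.
case/fibre_class_eq0 => u ue; exists (class (unif z ^+ (m - i.+1) *: u)).
rewrite -fibre_classZ -['X]expr1 eval_unifXn scalerA -exprD.
congr (qclass _ _); apply/eqP; rewrite -subr_eq0; apply/eqP.
apply: (@stalk_torsion_free i); rewrite scalerBr ue scalerA -exprD.
have -> : (i + (1 + (m - i.+1)) = m)%N by lia.
by rewrite subrr.
Qed.

Hypothesis r_gt0 : (0 < r)%N.
Variables (D : divisor iota) (nabla : connection E D) (nu : nat -> P).

(** The maps C i extend the coordinates of the stalk to its completion by Taylor expansion; they
    allow divisibility by z^m to be descended to the stalk. *)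
Lemma completion_coord : exists s : 'I_r -> stalk,
  exists co : 'I_r -> {linear stalk -> O^o},
  exists C : 'I_r -> {linear completion E z -> (fps k)^o},
  [/\ forall e, e = \sum_i (co i e : O) *: s i,
      forall (c : 'I_r -> O) i, co i (\sum_j c j *: s j) = c i
    & forall i e f, C i (tens _ e f) = taylor z (co i e) * f].
Proof.
have [s sb] := stalk_basis E x; have [co [coP coE]] := basis_coord sb.
exists s, co.
have ex i : exists F : {linear completion E z -> (fps k)^o},
    forall e f, F (tens _ e f) = taylor z (co i e) * f.
  pose g (e : stalk) (f : (fps k)^o) : (fps k)^o := taylor z (co i e) * f.
  have bg : is_bilinear (taylor z : {rmorphism O -> fps k}) (fun p => g p.1 p.2).
    split=> [e e' f|e f f'|a e f|a e f]; rewrite /g /=.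
    - by rewrite linearD rmorphD mulrDl.
    - by rewrite mulrDr.
    - rewrite (linearZZ (co i) a e) -[a *: _]/(a * _) rmorphM.
      by rewrite -[_ *: f]/(_ * f) mulrCA mulrA.
    - by rewrite -[RHS]/(a * _) -[a *: f]/(a * f) mulrCA.
  by have [F _ FE] := tens_lift_exists bg; exists F.
exists (fun i => projT1 (cid (ex i))); split=> // i e f.
exact: (projT2 (cid (ex i)) e f).
Qed.

(** The map e |-> Phi(e (x) 1) identifies E_x/z^m with k[[w]]/(w^(mr)) and intertwines the
    connections exactly, so its inverse is adapted. *)
Lemma adapted_from_generic_ramified : (0 < m)%N ->
  generic_ramified nabla z m nu ->
  exists eps, @adapted k r m nu M (nabla_mx nabla (z := z) (m := m)) eps.
Proof.
move=> m_gt0 [nh [[nhD nhE] [Phi [[Psi PsiK KPsi] PhiE]]]].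
pose S (e : stalk) : fps k := Phi (tens _ e (1 : (fps k)^o)).
have SD e f : S (e + f) = S e + S f by rewrite /S tensDl linearD.
have SZ a e : S (a *: e) = fps_subst r (taylor z a) * S e.
  by rewrite /S tensZl tensZr (linearZZ Phi).
have S_conn e : S (nabla_z nabla z m e) = nabla_nu r m nu (S e).
  rewrite /S -PhiE nhE fps_deriv1 mulr0; congr (Phi _).
  by rewrite (lin0 (tens_linear _ e)) addr0.
have subst_Xn n : fps_subst r (Xn n) = Xn (n * r)%N.
  by rewrite fps_subst_poly // zw_Xn mulnC.
have [s [co [C [coP _ CE]]]] := completion_coord.
(* If S e = w^(mr) h then e (x) 1 = z^m Psi(h), so z^m divides every coordinate of e. *)
have S_ker e : fps_eqmod (m * r) (S e) 0 <-> class e = 0.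
  rewrite fibre_class_eq0; split=> [/fpsXn_dvd[h Sh]|[u ->] i im]; last first.
    by rewrite SZ taylor_zn subst_Xn fpsXnM im.
  have tE : tens _ e (1 : (fps k)^o) = Xn m *: (Psi h : completion E z).
    apply: (can_inj PsiK); rewrite (linearZZ Phi) KPsi -[LHS]/(S e) Sh.
    by rewrite -subst_Xn.
  have co_dvd i : exists g, (co i e : O) = unif z ^+ m * g.
    apply: taylor_dvd => n nm; have := CE i e 1; rewrite mulr1 => <-.
    by rewrite tE (linearZZ (C i)) -[_ *: _]/(_ * _) fpsXnM nm.
  exists (\sum_i projT1 (cid (co_dvd i)) *: s i).
  rewrite {1}(coP e) scaler_sumr; apply: eq_bigr => i _.
  by rewrite scalerA; case: cid => g /= <-.
(* Write Psi(h) as a sum of tensors e (x) f and truncate each f modulo z^m; the remainder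
   contributes multiples of w^(mr). *)
have S_surj h : exists e, fps_eqmod (m * r) (S e) h.
  have [t tE] := tens_span (Psi h).
  suff: exists e, fps_eqmod (m * r) (S e) (Phi (Psi h)) by rewrite KPsi.
  rewrite tE; elim: t {tE} => [|[e f] t [e' IH]].
    exists 0; rewrite big_nil raddf0.
    by rewrite -(scale0r (0 : stalk)) SZ !rmorph0 mul0r.
  have [p pE] := fps_truncate m f.
  have [|g gE] := @fpsXn_dvd _ m (f - fps_of_poly p).
    by move=> i im; rewrite -[LHS]/(f i - fps_of_poly p i) pE // subrr.
  exists (eval_unif z p *: e + e'); rewrite big_cons SD linearD /=.
  apply: fps_eqmodD IH; rewrite SZ taylor_eval.
  have fE : f = fps_of_poly p *: (1 : (fps k)^o) + Xn m *: (g : (fps k)^o).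
    by rewrite -[_ + _]/(fps_of_poly p * 1 + Xn m * g) mulr1 -gE addrC subrK.
  rewrite {1}fE tensDr !tensZr linearD /= => i im.
  rewrite !(linearZZ Phi) fpsD -[RHS]/(_ + (fps_subst r (Xn m) * Phi (tens _ e (g : (fps k)^o))) i).
  by rewrite subst_Xn fpsXnM im addr0.
have S_cong e e' : fps_eqmod (m * r) (S e) (S e') <-> class e = class e'.
  have SN : S (- e') = - S e'.
    by apply/eqP; rewrite -addr_eq0 -SD addNr -(scale0r (0 : stalk)) SZ !rmorph0 mul0r.
  split=> [h|h].
    apply/eqP; rewrite -subr_eq0 -fibre_classB.
    apply/eqP/S_ker => i im; rewrite SD SN -[LHS]/(S e i - S e' i) h // subrr.
    by [].
  move=> i im; have /S_ker/(_ i im) : class (e - e') = 0.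
    by rewrite fibre_classB h subrr.
  by rewrite SD SN -[LHS]/(S e i - S e' i) => /eqP; rewrite subr_eq0 => /eqP.
pose lift (q : P) := projT1 (cid (S_surj (fps_of_poly q))).
have liftP q : fps_eqmod (m * r) (S (lift q)) (fps_of_poly q).
  exact: (projT2 (cid (S_surj (fps_of_poly q)))).
pose Pz := restr (z_to_w k r) (P^o : lmodType P).
have eps_lin : linear (fun q : Pz => class (lift q)).
  move=> a p q; rewrite -fibre_classZ -fibre_classD; apply/S_cong.
  apply: (fps_eqmod_trans (liftP _)); rewrite SD SZ taylor_eval fps_subst_poly //.
  rewrite -[a *: p]/(z_to_w k r a * p) fps_of_polyD fps_of_polyM.
  by apply: fps_eqmodD; [apply: fps_eqmodM|]; exact/fps_eqmod_sym/liftP.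
have [eps epsE] := linear_exists eps_lin; exists eps.
have repE (e : stalk) (q : P) : class e = eps q <-> fps_eqmod (m * r) (S e) (fps_of_poly q).
  rewrite epsE; split=> [/S_cong h|h]; first exact: fps_eqmod_trans h (liftP q).
  by apply/S_cong; apply: fps_eqmod_trans h _; exact/fps_eqmod_sym/liftP.
split=> [v|q|j q jr].
- have [e ->] := qclass_surj v; have [q qE] := fps_truncate (m * r) (S e).
  by exists q; apply/repE.
- rewrite epsE -S_ker -[X in 'X^_ %| X]subr0 -fps_eqmod_poly.
  have -> : fps_of_poly (0 : P) = 0.
    by apply/funext => n; rewrite /fps_of_poly coef0.
  by split; apply: fps_eqmod_trans; [exact/fps_eqmod_sym/liftP|exact: liftP].
exists ((r%:R^-1)%:P * q^`()); apply/repE; rewrite S_conn -nabla_nu_poly //.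
by apply: nabla_nu_eqmod; apply/repE; rewrite qclass_repr.
Qed.
End Fibre.

Section ConstantTerm.
Variable k : fieldType.
Definition const_term (f : fps k) : k := f 0%N.
Lemma const_term_additive : zmod_morphism const_term.
Proof. by []. Qed.
Lemma const_term_multiplicative : monoid_morphism const_term.
Proof. by split=> // f g; rewrite /const_term fpsM big_ord1. Qed.
HB.instance Definition _ := GRing.isZmodMorphism.Build (fps k) k const_term
  const_term_additive.
HB.instance Definition _ := GRing.isMonoidMorphism.Build (fps k) k const_term
  const_term_multiplicative.
End ConstantTerm.

Section FpsDecimation.
Variables (k : fieldType) (r : nat).
Hypothesis r_gt0 : (0 < r)%N.
Local Notation Xn n := (fps_of_poly ('X^n : {poly k})).
Implicit Types f g h : fps k.

Definition fps_dec (j : nat) h : fps k := fun n => h (r * n + j)%N.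

Lemma mul_polyC_fps (c : k) f n : c * f n = (fps_of_poly c%:P * f) n.
Proof.
rewrite fpsM big_ord_recl subn0 /fps_of_poly coefC /= big1 ?addr0 // => i _.
by rewrite coefC mul0r.
Qed.

Lemma XnM_subst j g n : (j < r)%N -> (Xn j * fps_subst r g) n =
  if (n %% r == j)%N then g (n %/ r)%N else 0.
Proof.
move=> jr; rewrite fpsXnM /fps_subst; case: ltnP => [nj|jn].
  by rewrite modn_small ?(ltn_trans nj) // ltn_eqF.
have nE := divn_eq n r; have nr : (n %% r < r)%N by rewrite ltn_pmod.
case: eqP => [nj|nj].
  by rewrite {1 2}nE nj addnK dvdn_mull // mulnK.
case: ifP => // /dvdnP[q qE]; case: nj.
have -> : n = (q * r + j)%N by rewrite -qE subnK.
by rewrite modnMDl modn_small.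
Qed.

Lemma fps_decK h : \sum_(j < r) Xn j * fps_subst r (fps_dec j h) = h.
Proof.
apply/funext => n; have nr : (n %% r < r)%N by rewrite ltn_pmod.
have sumE (F : 'I_r -> fps k) : (\sum_j F j) n = \sum_j F j n.
  by elim/big_rec2: _ => // j u v _ <-.
rewrite sumE (bigD1 (Ordinal nr)) //= XnM_subst // eqxx /fps_dec.
rewrite mulnC -divn_eq big1 ?addr0 // => j jn.
rewrite XnM_subst // ifN //; apply: contraNneq jn => jE.
by apply/eqP/val_inj.
Qed.

Lemma fps_decD j f g : fps_dec j (f + g) = fps_dec j f + fps_dec j g.
Proof. by []. Qed.

Lemma fps_dec_sum (G : 'I_r -> fps k) (j : 'I_r) :
  fps_dec j (\sum_(i < r) Xn i * fps_subst r (G i)) = G j.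
Proof.
apply/funext => n.
have sumE (F : 'I_r -> fps k) n' : (\sum_i F i) n' = \sum_i F i n'.
  by elim/big_rec2: _ => // i u v _ <-.
rewrite /fps_dec sumE (bigD1 j) //= XnM_subst // mulnC modnMDl.
rewrite modn_small // eqxx divnMDl // divn_small // addn0 big1 ?addr0 // => i ij.
rewrite XnM_subst // modnMDl modn_small // ifN //.
by apply: contra ij => /eqP h; apply/eqP/val_inj.
Qed.

Lemma euler_subst f :
  euler (fps_subst r f) = fps_of_poly r%:R%:P * (Xn r * fps_subst r (fps_deriv f)).
Proof.
apply/funext => n; rewrite -mul_polyC_fps.
rewrite fpsXnM /euler /fps_subst; case: ltnP => [nr|rn].
  case: ifP => [/dvdnP[q qE]|_]; last by rewrite !mulr0.
  have q0 : q = 0%N by case: q qE => // q qE; move: nr; rewrite qE mulSn; lia.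
  by rewrite qE q0 mul0n mul0r mulr0.
rewrite -(dvdn_subl _ (dvdnn r)) //; case: ifP => [/dvdnP[q qE]|_]; last by rewrite !mulr0.
rewrite qE mulnK //.
have -> : n = (q.+1 * r)%N by rewrite mulSn -qE subnKC.
by rewrite mulnK // /fps_deriv mulrA -natrM mulnC.
Qed.
End FpsDecimation.

Lemma linear_restr (A B : nzRingType) (f : {rmorphism A -> B}) (V : lmodType A)
    (W : lmodType B) (psi : V -> W) :
    (forall u v, psi (u + v) = psi u + psi v) ->
    (forall c u, psi (c *: u) = f c *: psi u) ->
  exists Phi : {linear V -> restr f W}, Phi =1 psi.
Proof.
move=> psiD psiZ; apply: (@linear_exists A V (restr f W) psi) => c u v.
by rewrite psiD psiZ.
Qed.

(** * Completed connections *)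

Section ConnectionOnFps.
Variables (k : fieldType) (r m : nat) (nu : nat -> {poly k}).
Hypothesis natr_neq0 : forall n, (n.+1)%:R != 0 :> k.
Hypothesis r_gt0 : (0 < r)%N.
Hypothesis m_gt0 : (0 < m)%N.
Local Notation P := {poly k}.
Local Notation Xn n := (fps_of_poly ('X^n : P)).
Local Notation n0 := (r * m.-1)%N.
Variable b : nat -> nat -> k.
Hypothesis b_per : forall d i, b d (i + r)%N = b d i.
Implicit Types f g : fps k.

Definition nabla_hat f := nabla_nu r m nu f + kernel_op b f.

Lemma nabla_nu_kernel f : nabla_nu r m nu f =
  kernel_op (conn_kernel r n0 (fun n => (nu_w r nu)`_n)) f.
Proof.
rewrite /nabla_nu !mul_kernel; apply/funext => n.
rewrite fpsD /kernel_op -big_split; apply: eq_bigr => j _ /=.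
rewrite /fps_of_poly coefCM coefXn /euler /conn_kernel.
by case: eqP => _; rewrite ?mulr1n ?mulr0n; [ring|ring].
Qed.

Lemma nabla_hat_kernel f : nabla_hat f = kernel_op (fun d i =>
  conn_kernel r n0 (fun n => (nu_w r nu)`_n) d i + b d i) f.
Proof.
rewrite /nabla_hat nabla_nu_kernel; apply/funext => n.
rewrite fpsD /kernel_op -big_split; apply: eq_bigr => j _ /=.
exact: (esym (mulrDl _ _ _)).
Qed.

Lemma nabla_hatD f g : nabla_hat (f + g) = nabla_hat f + nabla_hat g.
Proof. by rewrite !nabla_hat_kernel kernel_opD. Qed.

(** The perturbation b is linear over k[[z]], so the rule is that of nabla_nu; the factor w^(mr) is
    z^m, from trivializing by dz/z^m. *)
Lemma nabla_hat_leibniz g f : nabla_hat (fps_subst r g * f) =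
  fps_subst r g * nabla_hat f + Xn (m * r)%N * (fps_subst r (fps_deriv g) * f).
Proof.
rewrite /nabla_hat kernel_op_subst // /nabla_nu eulerM euler_subst //.
set c := fps_of_poly r%:R%:P; set e := fps_of_poly (_ * _).
have ec : e * c * Xn r = Xn (m * r)%N.
  rewrite -!fps_of_polyM; congr fps_of_poly.
  have r0 : r%:R != 0 :> k by case: r r_gt0 => // n _; exact: natr_neq0.
  rewrite -mulrA mulrACA -polyCM mulVf // mul1r -exprD; congr ('X^ _).
  by rewrite -{2}[r]muln1 -mulnDr addn1 prednK // mulnC.
rewrite -ec; ring.
Qed.

Lemma nabla_hat_Xn j : (j < r)%N ->
  nabla_hat (Xn j) = nabla_nu r m nu (Xn j)
    + (fun n => if (n < j)%N then 0 else b (n - j)%N j).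
Proof.
move=> jr; congr (_ + _); apply/funext => n; rewrite /kernel_op.
case: ltnP => [nj|jn].
  apply: big1 => i _; rewrite /fps_of_poly coefXn ltn_eqF ?mulr0 //.
  exact: leq_ltn_trans (leq_ord i) nj.
have jn' : (j < n.+1)%N by [].
rewrite (bigD1 (Ordinal jn')) //= /fps_of_poly coefXn eqxx mulr1.
rewrite big1 ?addr0 // => i ij; rewrite coefXn.
case: eqP => [iE|_]; last by rewrite mulr0.
by case/eqP: ij; exact: val_inj.
Qed.

Hypothesis r_gt1 : (1 < r)%N.
Hypothesis m_gt1 : (1 < m)%N.
Hypothesis nu_w1 : (nu_w r nu)`_1 != 0.
Hypothesis b_high : forall d i, (d <= n0)%N -> b d i = 0.

(** Composing [psi] with the gauge transformation removes b; that transformation is unipotent, hence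
    bijective, and periodic, hence linear over k[[z]]. *)
Lemma nabla_hat_gauge (V : lmodType (fps k)) (psi : V -> fps k) (inv : fps k -> V) :
    (forall u v, psi (u + v) = psi u + psi v) ->
    (forall c u, psi (c *: u) = fps_subst r c * psi u) ->
    cancel psi inv -> cancel inv psi ->
  exists Phi : {linear V -> restr (fps_subst r : {rmorphism fps k -> fps k}) (fps k)^o},
    bijective Phi /\
    forall u, Phi (inv (nabla_hat (psi u))) = nabla_nu r m nu (Phi u).
Proof.
move=> psiD psiZ psiK invK.
have n0_gt1 : (1 < n0)%N.
  by apply: (leq_trans r_gt1); rewrite -{1}[r]muln1 leq_pmul2l // -ltnS prednK.
have [G [G1 Gper GE]] := gauge_exists natr_neq0 r_gt0 n0_gt1 (dvdn_mulr _ (dvdnn r))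
  (v := fun n => (nu_w r nu)`_n) nu_w1 b_per b_high.
have [H GK KG] := kernel_op_bij G1.
have [||Phi PhiE] := @linear_restr _ _ (fps_subst r) V (fps k)^o
    (fun u => kernel_op G (psi u)).
- by move=> u v; rewrite psiD kernel_opD.
- by move=> c u; rewrite psiZ kernel_op_subst.
exists Phi; split.
  exists (fun h => inv (H h)) => u; first by rewrite PhiE GK psiK.
  by rewrite PhiE invK KG.
move=> u; rewrite !PhiE invK nabla_hat_kernel nabla_nu_kernel.
by rewrite !kernel_op_comp; exact: eq_kernel_op GE.
Qed.
End ConnectionOnFps.

(** * From an adapted identification to the completion *)

Section ToCompletion.
Variables (k K : fieldType) (iota : {rmorphism k -> K}).
Hypothesis natr_neq0 : forall n, (n.+1)%:R != 0 :> k.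
Hypothesis hK : function_field iota.
Variables (r : nat) (E : bundle iota r) (D : divisor iota) (nabla : connection E D).
Variables (x : point iota) (m : nat) (z : uniformizer x).
Hypothesis hD : mult D x = m%:Z.
Hypothesis r_gt1 : (1 < r)%N.
Hypothesis m_gt1 : (1 < m)%N.
Variable nu : nat -> {poly k}.
Hypothesis nu1 : (nu 1%N)`_0 != 0.
Local Notation O := (local_ring x).
Local Notation P := {poly k}.
Local Notation N := (m * r - r).+1.
Local Notation stalk := (stalk E x).
Local Notation M := (fibre_mx E z m).
Local Notation class := (qclass (zm_multiples E z m) : stalk -> M).
Local Notation Xn n := (fps_of_poly ('X^n : P)).
Local Notation Pz := (restr (z_to_w k r) (P^o : lmodType P)).
Local Notation derivO := (derivO natr_neq0 z hK).
Let r_gt0 : (0 < r)%N. Proof. exact: ltnW. Qed.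
Let m_gt0 : (0 < m)%N. Proof. exact: ltnW. Qed.

(** As r > 1, the exponent 1 occurs only in nu_1(w^r) w, so the pivot of the gauge equation is the
    leading coefficient of nu_1. *)
Lemma nu_w_coef1 : (nu_w r nu)`_1 = (nu 1%N)`_0.
Proof.
have zw_coef (p : P) i : (z_to_w k r p)`_i = if (r %| i)%N then p`_(i %/ r) else 0.
  exact: (esym (congr1 (fun f : fps k => f i) (fps_subst_poly p r_gt0))).
rewrite /nu_w coef_sum (bigD1 (Ordinal r_gt1)) //= big1 ?addr0 => [|j j1].
  by rewrite coefMX /= -[_ \Po _]/(z_to_w k r _) zw_coef dvdn0 div0n.
rewrite coefMXn -[_ \Po _]/(z_to_w k r _) zw_coef.
case: j j1 => -[|[|j]] //= jr _.
by rewrite subn0 dvdn1 gtn_eqF.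
Qed.

Section Adapted.
Variable eps : {linear Pz -> M}.
Hypothesis eps_adapted :
  @adapted k r m nu M (nabla_mx nabla (z := z) (m := m)) eps.

Definition eps_lift (j : 'I_r) : stalk := repr (eps ('X^j * 1)).

Lemma class_eps_lift j : class (eps_lift j) = eps 'X^j.
Proof. by rewrite /eps_lift qclass_repr mulr1. Qed.

Lemma class_sum (c : 'I_r -> O) (p : 'I_r -> P) :
  (forall j, exists g, c j = eval_unif z (p j) + unif z ^+ m * g) ->
  class (\sum_j c j *: eps_lift j)
  = eps (\sum_j z_to_w k r (p j) * 'X^j).
Proof.
move=> cp; have -> : class (\sum_j c j *: eps_lift j)
    = \sum_j class (c j *: eps_lift j).
  exact: (linear_sum (qclass (zm_multiples E z m))).
rewrite linear_sum; apply: eq_bigr => j _; have [g ->] := cp j.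
rewrite epsZ -class_eps_lift -fibre_classZ scalerDl fibre_classD.
rewrite [X in _ + X](_ : _ = 0) ?addr0 //.
by apply/fibre_class_eq0; exists (g *: eps_lift j); rewrite scalerA.
Qed.

(** Nakayama: the matrix B of the lifts in a basis of the stalk is invertible modulo z, and an
    element with nonzero constant term is a unit. *)
Lemma eps_lift_basis : is_basis eps_lift.
Proof.
have [s sb] := stalk_basis E x; have [co [coP coE]] := basis_coord sb.
pose B : 'M[O]_r := \matrix_(j, i) (co i (eps_lift j) : O).
pose ct : {rmorphism O -> k} := @const_term k \o taylor z.
(* A vector v killed by B at z = 0 gives e in z E_x, so the sum of the v_j w^j is a multiple of w^r
   modulo w^(mr), which forces v = 0. *)
have detB : ct (\det B) != 0.
  rewrite -det_map_mx; apply/det0P => -[v v0 vB].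
  pose e := \sum_j local_const x (v 0 j) *: eps_lift j.
  have co_e i : (co i e : O) = \sum_j local_const x (v 0 j) * (co i (eps_lift j) : O).
    by rewrite linear_sum; apply: eq_bigr => j _; rewrite linearZ.
  have dvd i : exists g, (co i e : O) = unif z ^+ 1 * g.
    apply: taylor_dvd => -[|n] // _; rewrite -[LHS]/(ct _) co_e rmorph_sum.
    have := congr1 (fun w : 'rV_r => w 0 i) vB; rewrite !mxE => {2}<-.
    apply: eq_bigr => j _; rewrite rmorphM !mxE; congr (_ * _).
    by rewrite /ct /= taylor_const /const_term /fps_of_poly coefC.
  have [u eu] : exists u, e = unif z *: u.
    exists (\sum_i projT1 (cid (dvd i)) *: s i).
    rewrite {1}(coP e) scaler_sumr; apply: eq_bigr => i _.
    by rewrite scalerA; case: cid => g /= ->; rewrite expr1.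
  have [surj ker _] := eps_adapted; have [q qE] := surj (class u).
  have cE : class e = eps (\sum_j z_to_w k r (v 0 j)%:P * 'X^j).
    apply: class_sum => j; exists 0; rewrite mulr0 addr0.
    by rewrite /eval_unif /= horner_morphC.
  have cE2 : class e = eps ('X^r * q).
    by rewrite eu -(zw_X k r) epsZ -qE -fibre_classZ -['X]expr1 eval_unifXn.
  have : 'X^(m * r) %| \sum_j z_to_w k r (v 0 j)%:P * 'X^j - 'X^r * q.
    by apply/ker; rewrite [LHS](linearB eps) -cE -cE2 subrr.
  move/dvdp_XnP => h; case/negP: v0; apply/eqP/rowP => j; rewrite mxE.
  have jmr : (j < m * r)%N by apply: leq_trans (ltn_ord j) _; rewrite leq_pmull.
  have := h j jmr; rewrite coefB coefXnM ltn_ord subr0 coef_sum.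
  rewrite (bigD1 j) //= big1 => [|i ij].
    by rewrite -[comp_poly _ _]/(z_to_w k r _) zw_C coefCM coefXn eqxx mulr1 addr0.
  rewrite -[comp_poly _ _]/(z_to_w k r _) zw_C coefCM coefXn.
  case: eqP => [ji|_]; last by rewrite mulr0.
  by case/eqP: ij; apply: val_inj.
have [d dB] := taylor0_unit detB.
pose C := d *: \adj B.
have BC : B *m C = 1%:M by rewrite -scalemxAr mul_mx_adj scale_scalar_mx mulrC dB.
have CB : C *m B = 1%:M by rewrite -scalemxAl mul_adj_mx scale_scalar_mx mulrC dB.
move=> v; pose cv : 'rV[O]_r := \row_i (co i v : O).
have co_sum (c : 'rV[O]_r) : (\row_i (co i (\sum_j c 0 j *: eps_lift j) : O)) = c *m B.
  apply/rowP => i; rewrite !mxE linear_sum; apply: eq_bigr => j _.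
  by rewrite linearZ !mxE.
exists [ffun j => (cv *m C) 0 j]; split.
  rewrite (coP v) [RHS]coP; apply: eq_bigr => i _; congr (_ *: _).
  have -> : \sum_j [ffun j => (cv *m C) 0 j] j *: eps_lift j
      = \sum_j (cv *m C) 0 j *: eps_lift j.
    by apply: eq_bigr => j _; rewrite ffunE.
  have := congr1 (fun w : 'rV_r => w 0 i) (co_sum (cv *m C)).
  by rewrite -mulmxA CB mulmx1 !mxE => ->.
move=> c cE; apply/ffunP => j; rewrite ffunE.
have -> : cv = (\row_j c j) *m B.
  rewrite -co_sum; apply/rowP => i; rewrite !mxE {1}cE; congr (co i _ : O).
  by apply: eq_bigr => l _; rewrite mxE.
by rewrite -mulmxA BC mulmx1 mxE.
Qed.

(** Sending the lifted basis to 1, w, ..., w^(r-1) identifies the completion with k[[w]] and the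
    connection with nabla_nu + b, and b is then gauged away. *)
Lemma generic_ramified_from_adapted : generic_ramified nabla z m nu.
Proof.
have [a [aP aE]] := basis_coord eps_lift_basis.
pose T (e : stalk) : fps k :=
  \sum_(j < r) Xn j * fps_subst r (taylor z (a j e : O)).
have TD e f : T (e + f) = T e + T f.
  rewrite /T -big_split; apply: eq_bigr => j _.
  by rewrite linearD !rmorphD mulrDr.
have TZ c e : T (c *: e) = fps_subst r (taylor z c) * T e.
  rewrite /T mulr_sumr; apply: eq_bigr => j _.
  by rewrite (linearZZ (a j) c e) -[c *: _]/(c * _) !rmorphM mulrCA.
have Te j : T (eps_lift j) = Xn j.
  have eE : eps_lift j = \sum_i (i == j)%:R *: eps_lift i.
    rewrite (bigD1 j) //= eqxx scale1r big1 ?addr0 // => i /negPf ->.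
    by rewrite scale0r.
  rewrite /T (bigD1 j) //= {1}eE aE eqxx !rmorph1 mulr1 big1 ?addr0 // => i ij.
  by rewrite eE aE (negPf ij) !rmorph0 mulr0.
have T0 : T 0 = 0 by rewrite -(scale0r (0 : stalk)) TZ !rmorph0 mul0r.
have T_sum (F : 'I_r -> stalk) : T (\sum_j F j) = \sum_j T (F j).
  by elim/big_rec2: _ => [//|j u v _ <-]; exact: TD.
have T_class e q : class e = eps q -> fps_eqmod (m * r) (T e) (fps_of_poly q).
  have ex (c : O) : exists (p : P) g, c = eval_unif z p + unif z ^+ m * g.
    have [p pE] := fps_truncate m (taylor z c).
    have [|g gE] := @taylor_dvd _ _ _ _ z m (c - eval_unif z p).
      move=> i im; rewrite rmorphB /= taylor_eval.
      by rewrite -[LHS]/(taylor z c i - fps_of_poly p i) pE // subrr.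
    by exists p, g; rewrite -gE addrC subrK.
  pose p j := projT1 (cid (ex (a j e : O))).
  have pP j : exists g, (a j e : O) = eval_unif z (p j) + unif z ^+ m * g.
    exact: (projT2 (cid (ex (a j e : O)))).
  rewrite {1}(aP e) (class_sum pP) => /eqP.
  rewrite -subr_eq0 -[_ - _](linearB eps) => /eqP.
  have [_ ker _] := eps_adapted; move/ker/fps_eqmod_poly => h.
  apply: fps_eqmod_trans h.
  have -> : fps_of_poly (\sum_j z_to_w k r (p j) * 'X^j)
      = \sum_(j < r) Xn j * fps_subst r (fps_of_poly (p j)).
    elim/big_rec2: _ => [|j u v _ <-].
      by apply/funext => n; rewrite /fps_of_poly coef0.
    by rewrite fps_of_polyD fps_of_polyM fps_subst_poly // [Xn j * _]mulrC.
  rewrite /T; elim/big_rec2: _ => [//|j u v _ uv].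
  apply: fps_eqmodD uv; apply: fps_eqmodM.
  have [g ->] := pP j; rewrite !rmorphD !rmorphM /= taylor_eval taylor_zn.
  move=> i im; rewrite fpsD [fps_subst r (Xn m)]fps_subst_poly // zw_Xn mulnC.
  by rewrite fpsXnM im addr0.
pose beta (j : 'I_r) : fps k :=
  T (nabla_z nabla z m (eps_lift j)) - nabla_nu r m nu (Xn j).
(* At q = 1 the derivative term of [nabla_nu_poly] vanishes and adaptedness leaves order N + j. This
   is visible modulo w^(mr) because N + j <= mr. *)
have beta0 (j : 'I_r) n : (n < N + j)%N -> beta j n = 0.
  move=> nN; have nmr : (n < m * r)%N.
    by apply: leq_trans nN _; have := ltn_ord j; have := leq_pmull r m_gt0; lia.
  have [_ _ conn] := eps_adapted; have [h hE] := conn j 1 (ltn_ord j).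
  have := T_class _ _ hE n nmr => TE.
  rewrite -[LHS]/(T _ n - nabla_nu r m nu (Xn j) n) TE.
  have := nabla_nu_poly r nu j (1 : P) m_gt0; rewrite mulr1 => ->.
  rewrite -[LHS]/((_ : P)`_n - (_ : P)`_n) -coefB -mulrBr.
  rewrite -polyC1 derivC mulr0 mulr0 addr0 polyC1 addrC addKr mulrA -exprD.
  by rewrite coefXnM addnC nN.
have b_ex (i : nat) : (i %% r < r)%N by rewrite ltn_pmod.
(* The kernel of the k[[z]]-linear operator sending w^j to beta j for j < r; it is therefore
   periodic in i. *)
pose b (d i : nat) : k := beta (Ordinal (b_ex i)) (i %% r + d)%N.
have b_per d i : b d (i + r)%N = b d i.
  rewrite /b; have -> : Ordinal (b_ex (i + r)%N) = Ordinal (b_ex i).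
    by apply: val_inj; rewrite /= modnDr.
  by rewrite modnDr.
have b_high d i : (d <= r * m.-1)%N -> b d i = 0.
  move=> dn; apply: beta0 => /=; rewrite addnC ltn_add2r ltnS.
  by rewrite -[(m * r - r)%N]/(N.-1) (N_pred r m).
pose hat := nabla_hat r m nu b.
have hat_e (j : 'I_r) : hat (Xn j) = T (nabla_z nabla z m (eps_lift j)).
  rewrite /hat nabla_hat_Xn //.
  have -> : (fun n => if (n < j)%N then 0 else b (n - j)%N j) = beta j :> fps k.
    apply/funext => n; case: ltnP => [nj|jn].
      by rewrite beta0 // (leq_trans nj) // leq_addl.
    rewrite /b; have -> : Ordinal (b_ex j) = j.
      by apply: val_inj; rewrite /= modn_small.
    by rewrite modn_small // subnKC.
  by rewrite /beta addrC subrK.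
have hatD f g : hat (f + g) = hat f + hat g by exact: nabla_hatD.
have hat_leibniz g f : hat (fps_subst r g * f) =
    fps_subst r g * hat f + Xn (m * r)%N * (fps_subst r (fps_deriv g) * f).
  exact: nabla_hat_leibniz.
have hat0 : hat 0 = 0 by apply: (addrI (hat 0)); rewrite -hatD !addr0.
have subst_Xm : fps_subst r (Xn m) = Xn (m * r)%N.
  by rewrite fps_subst_poly // zw_Xn mulnC.
have nz0 : nabla_z nabla z m (0 : stalk) = 0.
  apply: (addrI (nabla_z nabla z m (0 : stalk))).
  by rewrite -(nabla_zD natr_neq0 hK nabla z hD) !addr0.
(* Both sides are additive, satisfy the same Leibniz rule and agree on the basis. *)
have hatT e : hat (T e) = T (nabla_z nabla z m e).
  rewrite (aP e) T_sum.
  have -> : nabla_z nabla z m (\sum_i (a i e : O) *: eps_lift i)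
      = \sum_i nabla_z nabla z m ((a i e : O) *: eps_lift i).
    elim/big_rec2: _ => [//|i u v _ <-].
    exact: (nabla_zD natr_neq0 hK nabla z hD).
  rewrite T_sum; elim/big_rec2: _ => [//|j u v _ uv]; rewrite hatD uv.
  congr (_ + _); rewrite TZ Te hat_leibniz (nabla_z_leibniz natr_neq0 hK nabla z hD).
  rewrite TD !TZ Te hat_e !rmorphM /= taylor_zn subst_Xm taylor_derivO.
  by rewrite mulrA.
pose g (e : stalk) (f : (fps k)^o) : restr (fps_subst r) (fps k)^o :=
  T e * fps_subst r f.
have bg : is_bilinear (taylor z : {rmorphism O -> fps k}) (fun p => g p.1 p.2).
  split=> [e e' f|e f f'|c e f|c e f]; rewrite /g /=.
  - by rewrite TD mulrDl.
  - by rewrite rmorphD mulrDr.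
  - by rewrite TZ -[taylor z c *: f]/(taylor z c * f) rmorphM mulrCA mulrA.
  - rewrite -[c *: f]/(c * f) rmorphM mulrCA.
    by rewrite -[RHS]/(fps_subst r c * (T e * fps_subst r f)).
have [That _ ThatE] := tens_lift_exists bg.
(* The inverse sorts the exponents of h by their class modulo r, which gives the coordinates on the
   lifted basis. *)
pose inv (h : fps k) : completion E z :=
  \sum_(j < r) tens _ (eps_lift j) (fps_dec r j h : (fps k)^o).
have invE h : That (inv h) = h.
  rewrite /inv linear_sum -[RHS](fps_decK r_gt0 h); apply: eq_bigr => j _.
  by rewrite ThatE /g Te.
have invD h h' : inv (h + h') = inv h + inv h'.
  rewrite /inv -big_split; apply: eq_bigr => j _.
  by rewrite fps_decD tensDr.
have inv0 : inv 0 = 0 by apply: (addrI (inv 0)); rewrite -invD !addr0.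
have Einv t : inv (That t) = t.
  have [s ->] := tens_span t; rewrite linear_sum.
  elim: s => [|[e f] s IH]; first by rewrite !big_nil.
  rewrite !big_cons invD IH; congr (_ + _); rewrite ThatE /g /=.
  rewrite {2}(aP e) tens_suml /inv; apply: eq_bigr => j _.
  have -> : T e * fps_subst r f
      = \sum_(i < r) Xn i * fps_subst r (taylor z (a i e : O) * f).
    by rewrite /T mulr_suml; apply: eq_bigr => i _; rewrite rmorphM mulrA.
  rewrite fps_dec_sum //.
  by rewrite (tensZl (taylor z : {rmorphism O -> fps k}) (a j e : O) (eps_lift j)).
pose nh (t : completion E z) : completion E z := inv (hat (That t)).
have That_inj : injective That by exact: can_inj Einv.
exists nh; split; first split=> [u v|e f].
- by rewrite /nh linearD hatD invD.
- apply: That_inj; rewrite linearD /nh invE !ThatE /g [T e * _]mulrC hat_leibniz.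
  rewrite hatT mulrC rmorphM /= subst_Xm; congr (_ + _).
  by rewrite [RHS]mulrC mulrA.
have v1 : (nu_w r nu)`_1 != 0 by rewrite nu_w_coef1.
have := nabla_hat_gauge natr_neq0 r_gt0 m_gt0 b_per r_gt1 m_gt1 v1 b_high.
move/(_ (completion E z) That inv); apply=> //; first exact: linearD.
move=> c u; rewrite [LHS](linearZ_LR That) /=.
by rewrite -[LHS]/(fps_subst r c * That u).
Qed.
End Adapted.
End ToCompletion.

Unset Implicit Arguments.
Set Strict Implicit.
Local Open Scope complex_scope.

Theorem corollary4p4 (R : realType) (K : fieldType)
    (iota : {rmorphism R[i] -> K}) (hK : function_field iota)
    (r : nat) (hr : (2 <= r)%N) (E : bundle iota r)
    (D : divisor iota) (nabla : connection E D)
    (x : point iota) (m : nat) (hm : (2 <= m)%N) (hD : mult D x = m%:Z)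
    (z : uniformizer x)
    (nu : nat -> {poly R[i]})
    (hnu0 : (size (nu 0%N) <= m)%N)
    (hnu : forall j, (0 < j < r)%N -> (size (nu j) <= m.-1)%N)
    (hnu1 : (nu 1%N)`_0 != 0) :
  (generic_ramified nabla z m nu <->
     inhabited (generic_structure r m nu (nabla_mx nabla (z := z) (m := m)))) /\
  (generic_ramified nabla z m nu <->
     inhabited (factorized_structure r m nu (nabla_mx nabla (z := z) (m := m)))).
Proof.
have natr_neq0 n : n.+1%:R != 0 :> R[i] by rewrite Num.Theory.pnatr_eq0.
have r_gt0 : (0 < r)%N := ltnW hr.
have m_gt0 : (0 < m)%N := ltnW hm.
have ramified_adapted : generic_ramified nabla z m nu <->
    exists eps : {linear restr (z_to_w R[i] r) ({poly R[i]}^o : lmodType {poly R[i]})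
                  -> fibre_mx E z m},
      adapted m nu (nabla_mx nabla (z := z) (m := m)) eps.
  split; first exact: (adapted_from_generic_ramified r_gt0 m_gt0).
  by case=> eps; exact: (generic_ramified_from_adapted natr_neq0 hK hD hr hm hnu1).
have killed (v : fibre_mx E z m) : 'X^m *: v = 0 by exact: fibre_killed.
have torsion i (v : fibre_mx E z m) : (i < m)%N -> 'X^i *: v = 0 ->
  exists u, v = 'X *: u by exact: fibre_torsion.
split; split.
- by move/ramified_adapted => [eps]; exact: generic_from_adapted.
- by case=> S; apply/ramified_adapted; exact: (adapted_from_generic _ _ killed torsion S).
- move/ramified_adapted => [eps].
  exact: (factorized_from_adapted hr m_gt0 killed).
- by case=> S; apply/ramified_adapted; exact: (adapted_from_factorized _ _ killed torsion S).
Qed.
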